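(* Let $X$ be a compact special cube complex and let $n \geq 1$. If the universal cover of $X$ contains an $n$-dimensional combinatorial flat, then $\pi_1(X)$ contains a subgroup isomorphic to $\mathbb{Z}^n$.
   Context: A cube complex is a CW-complex constructed by gluing together cubes of arbitrary finite dimension by isometries along their faces (assumed connected). It is nonpositively curved if the link of each vertex is a simplicial flag complex ($n+1$ vertices span an $n$-simplex iff they are pairwise adjacent), and CAT(0) if it is moreover simply connected. A hyperplane is an equivalence class of edges for the equivalence relation generated by identifying two parallel (opposite) sides of a square. An oriented hyperplane is defined similarly with oriented edges. An edge is dual to the hyperplane containing it. Let $J$ be a hyperplane with orientation $\vec{J}$, the opposite orientation being $-\vec{J}$. $J$ is 2-sided if $\vec{J}\neq -\vec{J}$; self-intersecting if two edges dual to $J$ are non-parallel sides of some square; self-osculating if there are two (distinct) oriented edges dual to $\vec{J}$ with the same initial point or the same terminal point which do not belong to a same square. Two distinct hyperplanes $J,H$ are transverse if there are edges dual to $J$ and $H$ respectively which are non-parallel sides of some square; inter-osculating if they are transverse and there are edges dual to $J$ and $H$ respectively with a common endpoint which do not belong to a same square. A special cube complex is a nonpositively curved cube complex all of whose hyperplanes are 2-sided and which contains no self-intersecting, self-osculating or inter-osculating hyperplanes. An $n$-dimensional combinatorial flat in a CAT(0) cube complex is the image of a combinatorial isometric embedding of $\mathbb{R}^n$, endowed with its standard cubulation by unit cubes with vertex set $\mathbb{Z}^n$ (combinatorial: cubes are sent to cubes; isometric: with respect to the graph metrics on the one-skeleta). *)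

(* Defs.v *)
From HB Require Import structures.
From mathcomp Require Import all_boot all_order all_algebra generic_quotient.
From mathcomp Require Import all_classical reals topology normedtype.
From mathcomp Require Import lra.
From Stdlib Require Import Relation_Operators.

Set Implicit Arguments.
Unset Strict Implicit.
Unset Printing Implicit Defensive.

Import Order.TTheory GRing.Theory Num.Theory numFieldNormedType.Exports.

Local Open Scope classical_set_scope.
Local Open Scope ring_scope.

Section FundamentalGroup.
Context {R : realType} {T : topologicalType}.
Implicit Types (x y z : T) (u v w : R -> T).

Local Notation I := (`[0%R, 1%R]%classic : set R).

(* Only the values on [0, 1] are relevant. *)
Definition is_path x y u := [/\ {within I, continuous u}, u 0 = x & u 1 = y].

(* Homotopy relative to the endpoints; the second variable is the time. *)
Definition path_homotopic x y u v := exists h : R * R -> T,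
  [/\ {within I `*` I, continuous h},
      forall t, I t -> h (t, 0) = u t /\ h (t, 1) = v t &
      forall s, I s -> h (0, s) = x /\ h (1, s) = y].

Definition path_cat u v : R -> T :=
  fun t => if t <= 2^-1 then u (2 * t) else v (2 * t - 1).

Definition path_rev u : R -> T := fun t => u (1 - t).

Lemma within_comp (U V W : topologicalType) (A : set U) (B : set V)
    (f : U -> V) (g : V -> W) :
  {within A, continuous f} -> {within B, continuous g} ->
  (forall a, A a -> B (f a)) -> {within A, continuous (g \o f)}.
Proof.
move=> /subspace_continuousP cf /subspace_continuousP cg AB.
apply/subspace_continuousP => a Aa.
apply: cvg_comp (cg _ (AB _ Aa)) => S; rewrite /within /= => nS.
have := cf a Aa _ nS; rewrite /nbhs/= /within/=.
by apply: filterS => b + Ab; apply => //; exact: AB.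
Qed.

Lemma within_glue (U W : topologicalType) (A B : set U) (f g h : U -> W) :
  closed A -> closed B ->
  {within A, continuous f} -> {within B, continuous g} ->
  {in A, f =1 h} -> {in B, g =1 h} -> {within A `|` B, continuous h}.
Proof.
move=> cA cB cf cg fh gh; apply: withinU_continuous => //.
  exact: subspace_eq_continuous cf.
exact: subspace_eq_continuous cg.
Qed.

Lemma closed_I : closed I. Proof. exact: interval_closed. Qed.

Lemma closed_II : closed (I `*` I).
Proof.
rewrite (_ : I `*` I = fst @^-1` I `&` snd @^-1` I)//.
by apply: closedI; apply: preimage_closed closed_I => ? _; [exact: cvg_fst|exact: cvg_snd].
Qed.

Lemma path_homotopic_refl x y u : is_path x y u -> path_homotopic x y u u.
Proof.
move=> [cu u0 u1]; exists (u \o fst); split => //.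
by apply: within_comp cu _ => [|[]//=? ? []//]; apply: continuous_subspaceT => ?; exact: cvg_fst.
Qed.


Lemma inI t : I t <-> 0 <= t <= 1.
Proof. by rewrite /= in_itv. Qed.

Lemma I0 : I 0. Proof. by apply/inI; rewrite lexx ler01. Qed.
Lemma I1 : I 1. Proof. by apply/inI; rewrite lexx ler01. Qed.

Lemma half_lt1 : ((1 : R) <= 2^-1) = false.
Proof. by apply/negbTE; rewrite -ltNge; lra. Qed.

Lemma double_half : 2 * 2^-1 = 1 :> R. Proof. by lra. Qed.
Lemma double1B : 2 * 1 - 1 = 1 :> R. Proof. by lra. Qed.

Lemma continuous_pair (U V W : topologicalType) (f : U -> V) (g : U -> W) :
  continuous f -> continuous g -> continuous (fun p => (f p, g p)).
Proof. by move=> cf cg p; apply: cvg_pair; [exact: cf|exact: cg]. Qed.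

Lemma continuous_affine (U : topologicalType) (f : U -> R) a b :
  continuous f -> continuous (fun p => a * f p + b).
Proof.
by move=> cf p; apply: cvgD; [apply: cvgM; [exact: cvg_cst|exact: cf]|exact: cvg_cst].
Qed.

Lemma within_if_le (U : topologicalType) (phi : U -> R) (A : set U)
    (f g : U -> T) :
  continuous phi -> closed A ->
  {within A `&` [set p | phi p <= 2^-1], continuous f} ->
  {within A `&` [set p | 2^-1 <= phi p], continuous g} ->
  (forall p, A p -> phi p = 2^-1 -> f p = g p) ->
  {within A, continuous (fun p => if phi p <= 2^-1 then f p else g p)}.
Proof.
move=> cphi cA cf cg fg.
have -> : A = (A `&` [set p | phi p <= 2^-1]) `|` (A `&` [set p | 2^-1 <= phi p]).
  rewrite -setIUr; apply/seteqP; split => [p Ap|p []//]; split => //=.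
  by case: (leP (phi p) 2^-1) => [|/ltW]; [left|right].
apply: within_glue cf cg _ _.
- apply: closedI => //; have -> : [set p | phi p <= 2^-1] = phi @^-1` [set t | t <= 2^-1] by [].
  by apply: preimage_closed => [? _|]; [exact: cphi|exact: closed_le].
- apply: closedI => //; have -> : [set p | 2^-1 <= phi p] = phi @^-1` [set t | 2^-1 <= t] by [].
  by apply: preimage_closed => [? _|]; [exact: cphi|exact: closed_ge].
- by move=> p; rewrite inE => -[_ /= ->].
- move=> p; rewrite inE => -[Ap /= le2]; case: ifP => // le2'.
  by rewrite fg//; apply/eqP; rewrite eq_le le2 le2'.
Qed.

Lemma path_homotopic_sym x y u v : path_homotopic x y u v -> path_homotopic x y v u.
Proof.
move=> [h [ch hI hE]]; exists (h \o (fun p => (p.1, 1 - p.2))); split.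
- apply: within_comp ch _.
    apply: continuous_subspaceT; apply: continuous_pair => p; first exact: cvg_fst.
    by apply: cvgB; [exact: cvg_cst|exact: cvg_snd].
  by move=> [t s] [/= /inI It /inI Is]; split; apply/inI => //=; lra.
- by move=> t /hI[h0 h1]; rewrite /= subrr subr0.
- by move=> s /inI Is; apply: hE; apply/inI => /=; lra.
Qed.

Lemma path_homotopic_trans x y u v w :
  path_homotopic x y u v -> path_homotopic x y v w -> path_homotopic x y u w.
Proof.
move=> [h [ch hI hE]] [k [ck kI kE]].
exists (fun p => if p.2 <= 2^-1 then h (p.1, 2 * p.2 + 0) else k (p.1, 2 * p.2 + - 1)).
split.
- apply: within_if_le => [p| | | |].
  + exact: cvg_snd.
  + exact: closed_II.
  + apply: (within_comp (f := fun p : R * R => (p.1, 2 * p.2 + 0)) _ ch _).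
      apply: continuous_subspaceT; apply: continuous_pair; first by move=> p; exact: cvg_fst.
      by apply: continuous_affine => p; exact: cvg_snd.
    by move=> [t s] [[/= /inI It /inI Is]] le2; split; apply/inI => //=; lra.
  + apply: (within_comp (f := fun p : R * R => (p.1, 2 * p.2 + -1)) _ ck _).
      apply: continuous_subspaceT; apply: continuous_pair; first by move=> p; exact: cvg_fst.
      by apply: continuous_affine => p; exact: cvg_snd.
    by move=> [t s] [[/= /inI It /inI Is]] le2; split; apply/inI => //=; lra.
  + move=> [t s] [/= It _] ->.
    have -> : 2 * 2^-1 + 0 = 1 :> R by lra.
    have -> : 2 * 2^-1 + -1 = 0 :> R by lra.
    by rewrite (hI t It).2 (kI t It).1.
- move=> t It; rewrite /= mulr0 addr0 invr_ge0 ler0n (hI t It).1; split => //.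
  case: ifP => [|_]; first by move=> ?; exfalso; lra.
  have -> : 2 * 1 - 1 = 1 :> R by lra.
  by rewrite (kI t It).2.
- move=> s /inI Is /=; case: leP => s2; [apply: hE|apply: kE]; apply/inI; lra.
Qed.

Lemma is_path_cat x y z u v :
  is_path x y u -> is_path y z v -> is_path x z (path_cat u v).
Proof.
move=> [cu u0 u1] [cv v0 v1]; split; last 2 first.
- by rewrite /path_cat mulr0 invr_ge0 ler0n.
- by rewrite /path_cat half_lt1 double1B.
apply: (@within_if_le _ (fun t => t)) => [t| | | |].
- by [].
- exact: closed_I.
- apply: (within_comp (f := fun t : R => 2 * t) _ cu _).
    apply: continuous_subspaceT => t; apply: cvgM => //; exact: cvg_cst.
  by move=> t [/= /inI It /= le2]; apply/inI; lra.
- apply: (within_comp (f := fun t : R => 2 * t + -1) _ cv _).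
    by apply: continuous_subspaceT; apply: continuous_affine => t.
  by move=> t [/= /inI It /= le2]; apply/inI; lra.
- by move=> t It ->; rewrite double_half subrr v0.
Qed.

Lemma is_path_rev x y u : is_path x y u -> is_path y x (path_rev u).
Proof.
move=> [cu u0 u1]; split; rewrite /path_rev ?subr0 ?subrr//.
apply: (within_comp (f := fun t : R => 1 - t) _ cu _) => [|t /inI It]; last by apply/inI; lra.
by apply: continuous_subspaceT => t; apply: cvgB => //; exact: cvg_cst.
Qed.

Lemma is_path_cst x : is_path x x (cst x).
Proof. by split => //; apply: continuous_subspaceT => ?; exact: cvg_cst. Qed.

Lemma path_homotopic_cat x y z u u' v v' :
  path_homotopic x y u u' -> path_homotopic y z v v' ->
  path_homotopic x z (path_cat u v) (path_cat u' v').
Proof.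
move=> [h [ch hI hE]] [k [ck kI kE]].
exists (fun p => if p.1 <= 2^-1 then h (2 * p.1 + 0, p.2) else k (2 * p.1 + - 1, p.2)).
split.
- apply: within_if_le => [p| | | |].
  + exact: cvg_fst.
  + exact: closed_II.
  + apply: (within_comp (f := fun p : R * R => (2 * p.1 + 0, p.2)) _ ch _).
      apply: continuous_subspaceT; apply: continuous_pair; last by move=> p; exact: cvg_snd.
      by apply: continuous_affine => p; exact: cvg_fst.
    by move=> [t s] [[/= /inI It /inI Is]] le2; split; apply/inI => //=; lra.
  + apply: (within_comp (f := fun p : R * R => (2 * p.1 + -1, p.2)) _ ck _).
      apply: continuous_subspaceT; apply: continuous_pair; last by move=> p; exact: cvg_snd.
      by apply: continuous_affine => p; exact: cvg_fst.
    by move=> [t s] [[/= /inI It /inI Is]] le2; split; apply/inI => //=; lra.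
  + move=> [t s] [/= _ Is] ->.
    have -> : 2 * 2^-1 + 0 = 1 :> R by lra.
    have -> : 2 * 2^-1 + -1 = 0 :> R by lra.
    by rewrite (hE s Is).2 (kE s Is).1.
- move=> t /inI It; rewrite /path_cat /= addr0; case: leP => t2; [apply: hI|apply: kI]; apply/inI; lra.
- move=> s Is /=; rewrite mulr0 addr0 invr_ge0 ler0n (hE s Is).1; split => //.
  case: ifP => [|_]; first by move=> ?; exfalso; lra.
  have -> : 2 * 1 - 1 = 1 :> R by lra.
  by rewrite (kE s Is).2.
Qed.

Lemma path_homotopic_rev x y u v :
  path_homotopic x y u v -> path_homotopic y x (path_rev u) (path_rev v).
Proof.
move=> [h [ch hI hE]]; exists (h \o (fun p => (1 - p.1, p.2))); split.
- apply: within_comp ch _.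
    apply: continuous_subspaceT; apply: continuous_pair => p; last exact: cvg_snd.
    by apply: cvgB; [exact: cvg_cst|exact: cvg_fst].
  by move=> [t s] [/= /inI It /inI Is]; split; apply/inI => //=; lra.
- by move=> t /inI It; apply: hI; apply/inI => /=; lra.
- by move=> s /hE[h0 h1]; rewrite /= subrr subr0.
Qed.

Lemma path_homotopic_reparam x y a b u v w (f g : R -> R) :
  is_path x y w -> continuous f -> continuous g ->
  (forall t, I t -> I (f t)) -> (forall t, I t -> I (g t)) ->
  f 0 = g 0 -> f 1 = g 1 -> w (f 0) = a -> w (f 1) = b ->
  (forall t, I t -> u t = w (f t)) -> (forall t, I t -> v t = w (g t)) ->
  path_homotopic a b u v.
Proof.
move=> [cw w0 w1] cf cg fI gI fg0 fg1 wa wb uE vE.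
exists (w \o (fun p => f p.1 + p.2 * (g p.1 - f p.1))); split.
- apply: within_comp cw _.
    have cf1 : continuous (f \o (fst : R * R -> R)) by move=> p; apply: continuous_comp; [exact: cvg_fst|exact: cf].
    have cg1 : continuous (g \o (fst : R * R -> R)) by move=> p; apply: continuous_comp; [exact: cvg_fst|exact: cg].
    apply: continuous_subspaceT => p; apply: cvgD; first exact: cf1.
    by apply: cvgM; [exact: cvg_snd|apply: cvgB; [exact: cg1|exact: cf1]].
  move=> [t s] [/= It /inI /andP[s0 s1]]; move: (fI t It) (gI t It) => /inI ft /inI gt.
  by apply/inI; nra.
- move=> t It; rewrite /= mul0r addr0 mul1r addrC subrK.
  by split; rewrite ?uE ?vE.
- by move=> s Is; rewrite /= -fg0 -fg1 !subrr !mulr0 !addr0.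
Qed.

Lemma continuous_minr (f g : R -> R) : continuous f -> continuous g ->
  continuous (fun t => Num.min (f t) (g t)).
Proof. by move=> cf cg t; apply: (continuous_min (cf t) (cg t)). Qed.

Lemma continuous_maxr (f g : R -> R) : continuous f -> continuous g ->
  continuous (fun t => Num.max (f t) (g t)).
Proof. by move=> cf cg t; apply: (continuous_max (cf t) (cg t)). Qed.

Lemma continuous_aff a b : continuous (fun t : R => a * t + b).
Proof. by apply: continuous_affine => t. Qed.

Lemma continuous_Rid : continuous (id : R -> R).
Proof. by move=> t. Qed.

Ltac minmax := repeat match goal with
  | |- context [Order.min ?a ?b] =>
    lazymatch a with context [Order.min _ _] => fail | _ => case: (leP a b) => ? end
  | |- context [Order.max ?a ?b] => case: (leP a b) => ?
  end.

Lemma path_catA x y z a u v w :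
  is_path x y u -> is_path y z v -> is_path z a w ->
  path_homotopic x a (path_cat u (path_cat v w)) (path_cat (path_cat u v) w).
Proof.
move=> pu pv pw.
have pc := is_path_cat pu (is_path_cat pv pw).
pose g (t : R) := Num.min (Num.min (2 * t + 0) (1 * t + 4^-1)) (2^-1 * t + 2^-1).
apply: (@path_homotopic_reparam _ _ _ _ _ _ _ id g pc continuous_Rid) => //.
- by apply: continuous_minr; [apply: continuous_minr|]; exact: continuous_aff.
- by move=> t /inI It; apply/inI; rewrite /g; minmax; lra.
- by rewrite /g; minmax; lra.
- by rewrite /g; minmax; lra.
- by case: pc.
- by case: pc.
- move=> t /inI It; rewrite /path_cat /g; clear pu pv pw pc.
  have [t2|t2] := leP t 2^-1; [have [t4|t4] := leP (2 * t) 2^-1|]; minmax;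
    repeat (case: leP => ?); try (exfalso; lra);
    match goal with |- ?f ?p = ?f ?q => by have -> : p = q by lra end.
Qed.

Lemma path_cat1p x y u :
  is_path x y u -> path_homotopic x y (path_cat (cst x) u) u.
Proof.
move=> pu.
pose f (t : R) := Num.max (0 * t + 0) (2 * t + -1).
apply: (@path_homotopic_reparam _ _ _ _ _ _ _ f id pu _ continuous_Rid) => //.
- by apply: continuous_maxr; exact: continuous_aff.
- by move=> t /inI It; apply/inI; rewrite /f; minmax; lra.
- by rewrite /f; minmax; lra.
- by rewrite /f; minmax; lra.
- by case: pu => _ <- _; congr u; rewrite /f; minmax; lra.
- by case: pu => _ _ <-; congr u; rewrite /f; minmax; lra.
- move=> t /inI It; rewrite /path_cat /f.
  case: pu => _ u0 _; rewrite /cst -{1}u0 => {u0}; case: leP => ?; congr u; minmax; lra.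
Qed.

Lemma path_catp1 x y u :
  is_path x y u -> path_homotopic x y (path_cat u (cst y)) u.
Proof.
move=> pu.
pose f (t : R) := Num.min (2 * t + 0) (0 * t + 1).
apply: (@path_homotopic_reparam _ _ _ _ _ _ _ f id pu _ continuous_Rid) => //.
- by apply: continuous_minr; exact: continuous_aff.
- by move=> t /inI It; apply/inI; rewrite /f; minmax; lra.
- by rewrite /f; minmax; lra.
- by rewrite /f; minmax; lra.
- by case: pu => _ <- _; congr u; rewrite /f; minmax; lra.
- by case: pu => _ _ <-; congr u; rewrite /f; minmax; lra.
- move=> t /inI It; rewrite /path_cat /f.
  case: pu => _ _ u1; rewrite /cst -{1}u1 => {u1}; case: leP => ?; congr u; minmax; lra.
Qed.

Lemma path_catpV x y u :
  is_path x y u -> path_homotopic x x (path_cat u (path_rev u)) (cst x).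
Proof.
move=> pu.
pose f (t : R) := Num.min (2 * t + 0) (- 2 * t + 2).
apply: (@path_homotopic_reparam _ _ _ _ _ _ _ f (fun=> 0) pu _ _) => //.
- by apply: continuous_minr; exact: continuous_aff.
- by move=> t; exact: cvg_cst.
- by move=> t /inI It; apply/inI; rewrite /f; minmax; lra.
- by move=> t _; exact: I0.
- by rewrite /f; minmax; lra.
- by rewrite /f; minmax; lra.
- by case: pu => _ <- _; congr u; rewrite /f; minmax; lra.
- by case: pu => _ <- _; congr u; rewrite /f; minmax; lra.
- move=> t /inI It; rewrite /path_cat /path_rev /f => {pu}.
  by case: leP => ?; congr u; minmax; lra.
- by case: pu => _ <-.
Qed.

Lemma path_revK u : path_rev (path_rev u) = u.
Proof. by apply/funext => t; rewrite /path_rev subKr. Qed.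

Lemma path_catVp x y u :
  is_path x y u -> path_homotopic y y (path_cat (path_rev u) u) (cst y).
Proof. by move=> /is_path_rev/path_catpV; rewrite path_revK. Qed.

Record loop x := Loop { loop_fun :> R -> T; loopP : is_path x x loop_fun }.

HB.instance Definition _ x := gen_eqMixin (loop x).
HB.instance Definition _ x := gen_choiceMixin (loop x).

Definition loop_homotopic x : rel (loop x) :=
  fun a b => `[< path_homotopic x x a b >].

Lemma loop_homotopic_refl x : reflexive (@loop_homotopic x).
Proof. by move=> a; apply/asboolP/path_homotopic_refl/loopP. Qed.

Lemma loop_homotopic_sym x : symmetric (@loop_homotopic x).
Proof. by move=> a b; apply/asboolP/asboolP => /path_homotopic_sym. Qed.

Lemma loop_homotopic_trans x : transitive (@loop_homotopic x).
Proof.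
move=> a b c /asboolP ba /asboolP ac; apply/asboolP.
exact: path_homotopic_trans ba ac.
Qed.

Definition loop_equiv x := EquivRel (@loop_homotopic x) (@loop_homotopic_refl x)
  (@loop_homotopic_sym x) (@loop_homotopic_trans x).

Local Open Scope quotient_scope.

Definition pi1 x := {eq_quot loop_equiv x}.

HB.instance Definition _ x := Choice.on (pi1 x).
HB.instance Definition _ x := EqQuotient.on (pi1 x).

Lemma pi1P x (a b : loop x) :
  (\pi_(pi1 x) a = \pi_(pi1 x) b) <-> path_homotopic x x a b.
Proof.
split=> [/eqquotP|ab]; first exact: asboolW.
by apply/eqquotP; exact: asboolT.
Qed.

Definition loop_cat x (a b : loop x) : loop x :=
  Loop (is_path_cat (loopP a) (loopP b)).
Definition loop_rev x (a : loop x) : loop x := Loop (is_path_rev (loopP a)).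
Definition loop_cst x : loop x := Loop (is_path_cst x).

Definition pi1_mul x (g h : pi1 x) : pi1 x := \pi_(pi1 x) (loop_cat (repr g) (repr h)).
Definition pi1_inv x (g : pi1 x) : pi1 x := \pi_(pi1 x) (loop_rev (repr g)).
Definition pi1_one x : pi1 x := \pi_(pi1 x) (loop_cst x).

Lemma pi1_mulE x (a b : loop x) :
  pi1_mul (\pi_(pi1 x) a) (\pi_(pi1 x) b) = \pi_(pi1 x) (loop_cat a b).
Proof. by apply/pi1P/path_homotopic_cat; apply/pi1P; rewrite reprK. Qed.

Lemma pi1_invE x (a : loop x) :
  pi1_inv (\pi_(pi1 x) a) = \pi_(pi1 x) (loop_rev a).
Proof. by apply/pi1P/path_homotopic_rev; apply/pi1P; rewrite reprK. Qed.

Lemma pi1_mulA x : associative (@pi1_mul x).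
Proof.
elim/quotW=> a; elim/quotW=> b; elim/quotW=> c.
rewrite (pi1_mulE b c) (pi1_mulE a b) (pi1_mulE a) (pi1_mulE _ c).
by apply/pi1P; exact: (path_catA (loopP _) (loopP _) (loopP _)).
Qed.

Lemma pi1_mul1g x : left_id (pi1_one x) (@pi1_mul x).
Proof.
elim/quotW=> a; rewrite (pi1_mulE (loop_cst x) a).
by apply/pi1P; exact: (path_cat1p (loopP _)).
Qed.

Lemma pi1_mulg1 x : right_id (pi1_one x) (@pi1_mul x).
Proof.
elim/quotW=> a; rewrite (pi1_mulE a (loop_cst x)).
by apply/pi1P; exact: (path_catp1 (loopP _)).
Qed.

Lemma pi1_mulVg x : left_inverse (pi1_one x) (@pi1_inv x) (@pi1_mul x).
Proof.
elim/quotW=> a; rewrite (pi1_invE a) (pi1_mulE (loop_rev a) a).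
by apply/pi1P; exact: (path_catVp (loopP _)).
Qed.

Lemma pi1_mulgV x : right_inverse (pi1_one x) (@pi1_inv x) (@pi1_mul x).
Proof.
elim/quotW=> a; rewrite (pi1_invE a) (pi1_mulE a (loop_rev a)).
by apply/pi1P; exact: (path_catpV (loopP _)).
Qed.

HB.instance Definition _ x := isGroup.Build (pi1 x) (@pi1_mulA x) (@pi1_mul1g x)
  (@pi1_mulg1 x) (@pi1_mulVg x) (@pi1_mulgV x).

End FundamentalGroup.
Arguments pi1 R {T} x.

Definition simply_connected (R : realType) (T : topologicalType) :=
  [/\ [set: T] !=set0,
      forall x y : T, exists u : R -> T, is_path x y u &
      forall (x : T) (g : pi1 R x), g = 1%g].

(* The elements of [S] are the sheets of [p] over [U]: each of them is mapped
   homeomorphically onto [U]. *)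
Definition evenly_covered (Y X : topologicalType) (p : Y -> X) (U : set X) :=
  exists S : set (set Y),
    [/\ p @^-1` U = \bigcup_(V in S) V,
        trivIset S id &
        forall V, S V ->
          [/\ open V, p @` V = U, {in V &, injective p} &
              forall W, open W -> W `<=` V -> open (p @` W)]].

Definition covering_map (Y X : topologicalType) (p : Y -> X) :=
  [/\ continuous p, p @` [set: Y] = [set: X] &
      forall x, exists2 U, open_nbhs x U & evenly_covered p U].

Section Cubes.
Context {R : realType}.

Definition cube {k} : set 'rV[R]_k := [set x | forall i, 0 <= x 0 i <= 1].
Definition open_cube {k} : set 'rV[R]_k := [set x | forall i, 0 < x 0 i < 1].

Definition sqdist k (x y : 'rV[R]_k) : R := \sum_i (x 0 i - y 0 i) ^+ 2.

Definition cube_isometry k (g : 'rV[R]_k -> 'rV[R]_k) :=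
  g @` cube = cube /\
  forall x y, cube x -> cube y -> sqdist (g x) (g y) = sqdist x y.

(* The inclusion of the codimension 1 face of equation x_i = b. *)
Definition cube_face k (i : 'I_k.+1) (b : bool) (x : 'rV[R]_k) : 'rV[R]_k.+1 :=
  \row_j (if unlift i j is Some l then x 0 l else b%:R).

Definition corner k := {ffun 'I_k -> bool}.

(* The edge of the cube that starts at the corner [e] in the direction [i],
   parametrized by t in [0, 1]. *)
Definition corner_edge k (e : corner k) (i : 'I_k) (t : R) : 'rV[R]_k :=
  \row_j (if j == i then (if e j then 1 - t else t) else (e j)%:R).

End Cubes.

(* Cells of each dimension k, with their characteristic maps; only the values
   of the latter on [cube k] are relevant. *)
Record cubulation (R : realType) (T : topologicalType) := Cubulation {
  cell : nat -> Type;
  chi : forall k, cell k -> 'rV[R]_k -> T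
}.
Arguments chi {R T} c [k].

Section CubeComplexes.
Context {R : realType} {T : topologicalType} (K : cubulation R T).

(* A CW-complex whose cells are cubes: the open cubes are embedded and partition
   the space, the restriction of a characteristic map to a face is, up to an
   isometry, another characteristic map, and the topology is the weak one
   (in particular the characteristic maps are continuous on the cubes). *)
Record is_cube_complex : Prop := IsCubeComplex {
  cube_complex_connected : connected [set: T];
  cube_complex_partition : forall t : T,
    exists! p : {k & (cell K k * 'rV[R]_k)%type},
      open_cube (projT2 p).2 /\ chi K (projT2 p).1 (projT2 p).2 = t;
  cube_complex_face : forall k (c : cell K k.+1) (i : 'I_k.+1) (b : bool),
    exists (d : cell K k) (g : 'rV[R]_k -> 'rV[R]_k), cube_isometry g /\
      forall x, cube x -> chi K c (cube_face i b x) = chi K d (g x);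
  cube_complex_weak : forall A : set T,
    closed A <-> forall k (c : cell K k), closed (cube `&` chi K c @^-1` A)
}.

Definition is_vertex (t : T) := exists v : cell K 0, chi K v 0 = t.

(* An edge with an orientation: [true] is the direction of increasing
   parameter. *)
Definition oedge := (cell K 1 * bool)%type.
Implicit Types (a : oedge) (J : set (cell K 1)) (oJ : set oedge).

Definition rev_edge a : oedge := (a.1, ~~ a.2).
Definition edge_map a (t : R) : T :=
  chi K a.1 (const_mx (if a.2 then t else 1 - t)).
Definition src a : T := edge_map a 0.
Definition tgt a : T := edge_map a 1.

(* [a] is the side of [c] that starts at the corner [e] in the direction [i]. *)
Definition corner_side k (c : cell K k) (e : corner k) (i : 'I_k) a :=
  forall t, 0 <= t <= 1 -> chi K c (corner_edge e i t) = edge_map a t.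

(* The vertices of the link of v are the oriented edges issued from v; its
   n-simplices are the corners at v of the (n+1)-dimensional cubes; a simplex is
   spanned by the vertices in [corner_link]. *)

Definition corner_link k (c : cell K k) (e : corner k) : set oedge :=
  [set a | exists i, corner_side c e i a].

Definition span_square a a' := exists (c : cell K 2) (e : corner 2) i i',
  [/\ i != i', corner_side c e i a & corner_side c e i' a'].

Record nonpositively_curved : Prop := NonpositivelyCurved {
  link_nondegenerate : forall k (c : cell K k) (e : corner k) i i' a,
    corner_side c e i a -> corner_side c e i' a -> i = i';
  link_simplicial : forall k (c c' : cell K k.+1) (e e' : corner k.+1),
    corner_link c e = corner_link c' e' -> c = c' /\ e = e';
  link_flag : forall (v : T) n (a : 'I_n.+1 -> oedge),
    injective a -> (forall i, src (a i) = v) ->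
    (exists (c : cell K n.+1) (e : corner n.+1), corner_link c e = range a) <->
    (forall i j, i != j -> span_square (a i) (a j))
}.

(* [a] and [a'] are opposite sides of a square, oriented in the same way. *)
Definition oparallel a a' := exists (c : cell K 2) (e e' : corner 2) i,
  [/\ corner_side c e i a, corner_side c e' i a' &
      forall j, (e j == e' j) = (j == i)].

Definition parallel (f f' : cell K 1) :=
  exists o o', oparallel (f, o) (f', o').

Definition ohyperplane a : set oedge :=
  [set a' | clos_refl_sym_trans _ oparallel a a'].
Definition hyperplane (f : cell K 1) : set (cell K 1) :=
  [set f' | clos_refl_sym_trans _ parallel f f'].

Definition two_sided oJ := oJ <> rev_edge @` oJ.

(* The case [f = f'] is allowed: both sides of the square may be the same edge. *)
Definition perpendicular (f f' : cell K 1) :=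
  exists (c : cell K 2) (e e' : corner 2) i i' o o',
    [/\ i != i', corner_side c e i (f, o) & corner_side c e' i' (f', o')].

Definition self_intersecting J :=
  exists f f', [/\ J f, J f' & perpendicular f f'].

(* For two oriented edges issued from a common vertex, not belonging to a same
   square means that no square has a corner at this vertex with these edges as
   sides. *)
Definition self_osculating oJ := exists a a',
  [/\ oJ a, oJ a', a <> a' &
      (src a = src a' /\ ~ span_square a a') \/
      (tgt a = tgt a' /\ ~ span_square (rev_edge a) (rev_edge a'))].

Definition transverse J H :=
  J <> H /\ exists f f', [/\ J f, H f' & perpendicular f f'].

Definition inter_osculating J H :=
  transverse J H /\
  exists a a', [/\ J a.1, H a'.1, src a = src a' & ~ span_square a a'].

Record special_cube_complex : Prop := SpecialCubeComplex {
  special_is_cube_complex : is_cube_complex;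
  special_nonpositively_curved : nonpositively_curved;
  special_two_sided : forall a, two_sided (ohyperplane a);
  special_self_intersecting : forall f, ~ self_intersecting (hyperplane f);
  special_self_osculating : forall a, ~ self_osculating (ohyperplane a);
  special_inter_osculating : forall f f',
    ~ inter_osculating (hyperplane f) (hyperplane f')
}.

Fixpoint edge_walk k (x y : T) : Prop :=
  if k is k'.+1 then exists2 a, src a = x & edge_walk k' (tgt a) y else x = y.

Definition graph_dist (x y : T) k :=
  edge_walk k x y /\ forall l, edge_walk l x y -> (k <= l)%N.

End CubeComplexes.

Definition combinatorial (R : realType) (T U : topologicalType)
    (K : cubulation R T) (L : cubulation R U) (f : T -> U) :=
  forall k (c : cell K k), exists (d : cell L k) (g : 'rV[R]_k -> 'rV[R]_k),
    cube_isometry g /\ forall x, cube x -> f (chi K c x) = chi L d (g x).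

Record universal_cover (R : realType) (Y X : topologicalType)
    (L : cubulation R Y) (K : cubulation R X) (p : Y -> X) : Prop :=
  UniversalCover {
    universal_cover_simply_connected : simply_connected R Y;
    universal_cover_covering : covering_map p;
    universal_cover_complex : is_cube_complex L;
    universal_cover_combinatorial : combinatorial L K p
  }.

(* The k-cubes of R^n are given by their smallest vertex in Z^n and k
   directions, listed in increasing order. *)
Definition std_cubulation (R : realType) n : cubulation R 'rV[R]_n :=
  @Cubulation R 'rV[R]_n
    (fun k => 'rV[int]_n * {d : {ffun 'I_k -> 'I_n} |
        [forall i : 'I_k, forall j : 'I_k, (i < j)%N ==> (d i < d j)%N]})%type
    (fun k c x =>
      \row_j ((c.1 0 j)%:~R + \sum_(i | sval c.2 i == j) x 0 i)).

Definition combinatorial_flat (R : realType) (Y : topologicalType)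
    (L : cubulation R Y) n (F : set Y) :=
  exists f : 'rV[R]_n -> Y,
    [/\ combinatorial (std_cubulation R n) L f,
        forall x y, is_vertex (std_cubulation R n) x ->
          is_vertex (std_cubulation R n) y -> forall k,
          graph_dist (std_cubulation R n) x y k <-> graph_dist L (f x) (f y) k &
        F = range f].

(* Main.v *)
From mathcomp Require Import all_boot all_order all_algebra generic_quotient perm.
From mathcomp Require Import all_classical reals topology normedtype.
From mathcomp Require Import lra zify.
From Stdlib Require Import Relation_Operators.
Require Import Defs.

Set Implicit Arguments.
Unset Strict Implicit.
Unset Printing Implicit Defensive.

Import Order.TTheory GRing.Theory Num.Theory numFieldNormedType.Exports.

Local Open Scope classical_set_scope.
Local Open Scope ring_scope.

(** The flat is a map from the lattice to the vertices of the universal cover, and we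
    look at its image in the special cube complex. The oriented hyperplane dual to the
    image of the edge from [v] to [v + unit_vec i] depends only on [i] and on the [i]-th
    coordinate of [v], because opposite sides of squares are dual to the same oriented
    hyperplane. As there is neither self-intersection nor self-osculation, an edge is
    determined by its origin and by its oriented hyperplane ([same_side_src_inj]). The
    image of the flat is therefore deterministic: if two vertices with the same image
    have the same [i]-th coordinate, then moving both of them along the [i]-th direction
    leads again to vertices with the same image. A compact cube complex has finitely many
    edges ([finite_edges]), so that along each axis the image returns to an oriented edge
    which it has already traversed, at positions [a i < b i]. By determinism, each
    direction gives a closed path at the image of the vertex with coordinates [a i], and
    any two of these paths commute, since they bound the image of a rectangle tiled by
    squares ([period_commute]). This defines a homomorphism from the lattice to the
    fundamental group.

    Its injectivity rests on reduced words. Read an edge path as the word formed by its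
    oriented edges, and call it reduced when it contains no two letters dual to opposite
    orientations of the same hyperplane and separated only by letters whose hyperplanes
    are transverse to this one ([reduced]). Three facts are needed.

    - The axes of the flat are reduced. As there is no inter-osculation, a letter can be
      pushed through squares across letters with transverse hyperplanes, and inverse
      letters then cancel, so that a path which is not reduced is not a geodesic
      ([shorten_walk]).

    - The positions [a i < b i] can be chosen so that all powers of the corresponding
      period are reduced ([periodic_reduced]). The pigeonhole principle is applied not
      only to the edges, but also to the set of letters that can be brought to the
      current position by commutations from the right: a cancellation between two
      consecutive periods would then yield one in the axis. Products of powers of the
      periods in the different directions remain reduced, because the hyperplanes of
      different directions are transverse.

    - A closed edge path in the universal cover with reduced image is trivial
      ([reduced_closed_nil]). A hyperplane of the universal cover defines a map to the
      circle which winds once when the hyperplane is crossed; as the universal cover is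
      simply connected, a closed path crosses it as often in both directions
      ([closed_walk_crossing]). A shortest subpath that crosses the same hyperplane
      twice, closed up along the carrier of this hyperplane, shows that the two
      crossings are opposite and that all the hyperplanes crossed in between are
      transverse to it, contradicting the assumption that the image is reduced
      ([reduced_crosses_once]).

    If a product of powers of the periods is trivial in the fundamental group, then by
    homotopy lifting it lifts to a closed edge path, which is empty by the last fact, so
    that all the exponents vanish ([lattice_rep_ker]). *)

(** * Lifting paths and homotopies to a covering space *)

Section Within.
Context {D W : topologicalType}.

Lemma within_nearP (A : set D) (f : D -> W) :
  {within A, continuous f} <->
  forall a, A a -> forall B, nbhs (f a) B -> \forall b \near a, A b -> B (f b).
Proof.
split=> [/subspace_continuousP cf a Aa B nB|H].
  by have := cf a Aa B nB; rewrite /nbhs/= /within/=.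
by apply/subspace_continuousP => a Aa B nB; exact: H.
Qed.

End Within.

Section Cousin.
Context {R : realType}.

(** A property of intervals which is additive and holds for all small enough
    intervals around each point of [0, 1] holds for [0, 1]. *)
Lemma interval_additive_local (P : R -> R -> Prop) :
  (forall a m b, a <= m -> m <= b -> P a m -> P m b -> P a b) ->
  (forall x, 0 <= x <= 1 -> exists2 e : R, 0 < e &
     forall a b, 0 <= a -> a <= b -> b <= 1 ->
       `|a - x| < e -> `|b - x| < e -> P a b) ->
  P 0 1.
Proof.
move=> Padd Ploc.
pose B := [set x : R | 0 <= x <= 1 /\ forall y, 0 <= y <= x -> P 0 y].
have B0 : B 0.
  split=> [|y y0]; first lra.
  have [|e e0 He] := Ploc 0; first lra.
  have -> : y = 0 by lra.
  by apply: He; rewrite ?subrr ?normr0//; lra.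
have hsB : has_sup B by split; [exists 0 | exists 1 => x [] /andP[]].
have s0 : 0 <= sup B by apply: sup_upper_bound hsB _ _.
have s1 : sup B <= 1 by apply: sup_le_ub; [exists 0|move=> x [] /andP[]].
have [|e e0 He] := Ploc (sup B); first by rewrite s0 s1.
have [x [x01 Bx] xs] := sup_adherent e0 hsB.
have xs' : x <= sup B by apply: sup_upper_bound hsB _ _.
(* a point of B beyond sup B, unless it is 1 *)
pose z := Num.min 1 (sup B + e / 2).
have Bz : B z.
  rewrite /z; split=> [|y]; first by case: (leP 1 (sup B + e / 2)) => ?; lra.
  move=> /andP[y0]; rewrite le_min => /andP[y1 ys].
  have [yx|xy] := leP y x; first by apply: Bx; rewrite y0.
  apply: (Padd _ x) => //; [lra|lra|by apply: Bx; lra|].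
  apply: He => //; [lra|lra| |]; rewrite ltr_norml; apply/andP; split; lra.
have : z <= sup B by apply: sup_upper_bound hsB _ _.
have : B z by []; rewrite /z.
case: (leP 1 (sup B + e / 2)) => ? [_ BB] ?; last lra.
by apply: BB; lra.
Qed.

End Cousin.

Section Lifting.
Context {R : realType} {Y X : topologicalType} (p : Y -> X).
Hypothesis covp : covering_map p.

Lemma covering_continuous : continuous p. Proof. by case: covp. Qed.

(** Each point of the fibre of an evenly covered open set lies on a sheet, over
    which there is a continuous inverse of the covering map. *)
Lemma covering_sheet x : exists2 U : set X, open_nbhs x U &
  forall y, U (p y) -> exists V : set Y,
    [/\ open V, V y, {in V &, injective p}, forall z, U z -> exists2 v, V v & p v = z &
        forall W : set Y, open W -> W `<=` V -> open (p @` W)].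
Proof.
have [_ _ /(_ x)[U oU [S [SU _ HS]]]] := covp; exists U => // y Uy.
have : (p @^-1` U) y by [].
rewrite SU => -[V SV Vy]; have [oV VU inj opn] := HS _ SV.
exists V; split => // z; rewrite -VU => -[v Vv <-]; by exists v.
Qed.

(** Distinct points of a fibre are separated by open sets. *)
Lemma covering_separated y1 y2 : p y1 = p y2 -> y1 <> y2 ->
  exists V1 V2 : set Y, [/\ nbhs y1 V1, nbhs y2 V2 & V1 `&` V2 = set0].
Proof.
move=> p12 ne; have [_ _ /(_ (p y1))[U [oU Uy] [S [SU triv HS]]]] := covp.
have : (p @^-1` U) y1 by []. have : (p @^-1` U) y2 by rewrite /= -p12.
rewrite SU => -[V2 SV2 V2y] [V1 SV1 V1y].
have [oV1 _ inj _] := HS _ SV1; have [oV2 _ _ _] := HS _ SV2.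
exists V1, V2; split; [exact: open_nbhs_nbhs|exact: open_nbhs_nbhs|].
apply/eqP; apply: contra_notT ne => /eqP/eqP/set0P V12.
have V1E : V1 = V2 by apply: triv.
by apply: inj p12; rewrite inE // V1E.
Qed.

(** Two lifts of a map defined on a connected set coincide if they agree at a point:
    the set where they agree is open and closed. *)
Lemma lift_unique (D : topologicalType) (A : set D) (f g : D -> Y) :
  connected A -> {within A, continuous f} -> {within A, continuous g} ->
  (forall z, A z -> p (f z) = p (g z)) ->
  (exists2 z, A z & f z = g z) -> forall z, A z -> f z = g z.
Proof.
move=> cA /within_nearP cf /within_nearP cg pfg [z0 Az0 fg0].
pose E := [set b | A b -> f b = g b]; pose N := [set b | A b -> f b <> g b].
have nE z : A z -> f z = g z -> nbhs z E.
  move=> Az fg; have [U [oU Uz] HU] := covering_sheet (p (f z)).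
  have [V [oV Vf injV _ _]] := HU _ Uz.
  have nVf : nbhs (f z) V by exact: open_nbhs_nbhs.
  have nVg : nbhs (g z) V by rewrite -fg.
  apply: filterS2 (cf _ Az _ nVf) (cg _ Az _ nVg) => b Vfb Vgb Ab.
  by apply: injV (pfg _ Ab); rewrite inE; [exact: Vfb|exact: Vgb].
have nN z : A z -> f z <> g z -> nbhs z N.
  move=> Az fg; have [V1 [V2 [n1 n2 V12]]] := covering_separated (pfg _ Az) fg.
  apply: filterS2 (cf _ Az _ n1) (cg _ Az _ n2) => b Vfb Vgb Ab fgb.
  have : (V1 `&` V2) (f b) by split; [exact: Vfb|rewrite fgb; exact: Vgb].
  by rewrite V12.
suff BA : A `&` E = A by move=> z Az; move: (Az); rewrite -{1}BA => -[_]; apply.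
apply: cA.
- by exists z0; split=> // _.
- exists E°; first exact: open_interior.
  apply/seteqP; split=> z [Az Ez]; split=> //; first exact: nE (Ez Az).
  exact: nbhs_singleton Ez.
- exists (~` N°); first by apply: open_closedC; exact: open_interior.
  apply/seteqP; split=> z [Az Ez]; split=> //.
    by move=> Nz; apply: (nbhs_singleton Nz) => //; exact: Ez.
  by move=> _; apply: contrapT => fg; apply: Ez; exact: nN.
Qed.

(** A closed rectangle of the plane. *)
Definition box (a b c d : R) : set (R * R) :=
  [set z | [/\ a <= z.1, z.1 <= b, c <= z.2 & z.2 <= d]].

Lemma closed_box a b c d : closed (box a b c d).
Proof.
have -> : box a b c d = (fst @^-1` `[a, b]) `&` (snd @^-1` `[c, d]).
  apply/seteqP; split=> z; rewrite /box/= !in_itv /=.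
    by move=> [-> -> -> ->].
  by move=> [/andP[-> ->] /andP[-> ->]].
apply: closedI; apply: preimage_closed; try exact: interval_closed.
  by move=> ? _; exact: cvg_fst.
by move=> ? _; exact: cvg_snd.
Qed.

Lemma near_pair (x y : R) (P : set (R * R)) : nbhs (x, y) P ->
  exists2 e : R, 0 < e & forall t s, `|t - x| < e -> `|s - y| < e -> P (t, s).
Proof.
move=> /nbhs_ballP[e e0 He]; exists e => // t s tx sy; apply: He.
by split; rewrite /ball/= distrC.
Qed.

Section Homotopy.
Variable F : R * R -> X.
Hypothesis cF : {within box 0 1 0 1, continuous F}.

(** Every lift of the image of the lower left corner of the box extends to a
    continuous lift over the box. *)
Definition liftable a b c d := forall y, p y = F (a, c) -> exists G : R * R -> Y,
  [/\ {within box a b c d, continuous G}, G (a, c) = y &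
      forall z, box a b c d z -> p (G z) = F z].

Lemma continuous_hline (y : R) : continuous (fun t : R => (t, y)).
Proof. by apply: continuous_pair; [exact: continuous_Rid|move=> t; exact: cvg_cst]. Qed.

Lemma continuous_vline (x : R) : continuous (fun s : R => (x, s)).
Proof. by apply: continuous_pair; [move=> t; exact: cvg_cst|exact: continuous_Rid]. Qed.

Lemma liftable_addh a m b c d : a <= m -> m <= b -> c <= d ->
  liftable a m c d -> liftable m b c d -> liftable a b c d.
Proof.
move=> am mb cd L1 L2 y py.
have [G1 [cG1 G1y pG1]] := L1 _ py.
have [|G2 [cG2 G2y pG2]] := L2 (G1 (m, c)); first by rewrite pG1//; split=> //=; lra.
have GG s : c <= s <= d -> G1 (m, s) = G2 (m, s).
  move=> scd.
  apply: (@lift_unique R `[c, d] (fun s => G1 (m, s)) (fun s => G2 (m, s))) => //=.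
  - exact: segment_connected.
  - apply: (within_comp (f := fun s : R => (m, s)) _ cG1).
      by apply: continuous_subspaceT; exact: continuous_vline.
    by move=> t /=; rewrite in_itv/= => /andP[? ?]; split.
  - apply: (within_comp (f := fun s : R => (m, s)) _ cG2).
      by apply: continuous_subspaceT; exact: continuous_vline.
    by move=> t /=; rewrite in_itv/= => /andP[? ?]; split.
  - by move=> t; rewrite in_itv/= => /andP[? ?]; rewrite pG1 ?pG2.
  - by exists c => //; rewrite in_itv /= lexx cd.
pose G z := if z.1 <= m then G1 z else G2 z.
have bE : box a b c d = box a m c d `|` box m b c d.
  apply/seteqP; split=> -[t s]; rewrite /box/= => H.
    by case: H => /= *; case: (leP t m) => tm; [left|right]; split=> //=; exact: ltW.
  by case: H => -[/= *]; split=> //=; lra.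
have G12 : {in box a m c d, G1 =1 G} /\ {in box m b c d, G2 =1 G}.
  split=> -[t s]; rewrite inE /G/= => -[/= t1 t2 s1 s2]; first by rewrite t2.
  by case: (leP t m) => // tm; rewrite (_ : t = m) ?GG//; lra.
exists G; split.
- by rewrite bE; case: G12; apply: within_glue cG1 cG2; exact: closed_box.
- by rewrite /G /= am.
- move=> z; rewrite bE => -[] bz; first by rewrite -G12.1 ?inE// pG1.
  by rewrite -G12.2 ?inE// pG2.
Qed.

Lemma liftable_addv a b c m d : a <= b -> c <= m -> m <= d ->
  liftable a b c m -> liftable a b m d -> liftable a b c d.
Proof.
move=> ab cm md L1 L2 y py.
have [G1 [cG1 G1y pG1]] := L1 _ py.
have [|G2 [cG2 G2y pG2]] := L2 (G1 (a, m)); first by rewrite pG1//; split=> //=; lra.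
have GG s : a <= s <= b -> G1 (s, m) = G2 (s, m).
  move=> scd.
  apply: (@lift_unique R `[a, b] (fun s => G1 (s, m)) (fun s => G2 (s, m))) => //=.
  - exact: segment_connected.
  - apply: (within_comp (f := fun s : R => (s, m)) _ cG1).
      by apply: continuous_subspaceT; exact: continuous_hline.
    by move=> t /=; rewrite in_itv/= => /andP[? ?]; split.
  - apply: (within_comp (f := fun s : R => (s, m)) _ cG2).
      by apply: continuous_subspaceT; exact: continuous_hline.
    by move=> t /=; rewrite in_itv/= => /andP[? ?]; split.
  - by move=> t; rewrite in_itv/= => /andP[? ?]; rewrite pG1 ?pG2.
  - by exists a => //; rewrite in_itv /= lexx ab.
pose G z := if z.2 <= m then G1 z else G2 z.
have bE : box a b c d = box a b c m `|` box a b m d.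
  apply/seteqP; split=> -[t s]; rewrite /box/= => H.
    by case: H => /= *; case: (leP s m) => tm; [left|right]; split=> //=; exact: ltW.
  by case: H => -[/= *]; split=> //=; lra.
have G12 : {in box a b c m, G1 =1 G} /\ {in box a b m d, G2 =1 G}.
  split=> -[t s]; rewrite inE /G/= => -[/= t1 t2 s1 s2]; first by rewrite s2.
  by case: (leP s m) => // sm; rewrite (_ : s = m) ?GG//; lra.
exists G; split.
- by rewrite bE; case: G12; apply: within_glue cG1 cG2; exact: closed_box.
- by rewrite /G /= cm.
- move=> z; rewrite bE => -[] bz; first by rewrite -G12.1 ?inE// pG1.
  by rewrite -G12.2 ?inE// pG2.
Qed.

Lemma liftable_local x y : 0 <= x <= 1 -> 0 <= y <= 1 -> exists2 e : R, 0 < e &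
  forall a b c d, 0 <= a -> a <= b -> b <= 1 -> 0 <= c -> c <= d -> d <= 1 ->
    `|a - x| < e -> `|b - x| < e -> `|c - y| < e -> `|d - y| < e ->
    liftable a b c d.
Proof.
move=> x01 y01; have [U [oU Uxy] HU] := covering_sheet (F (x, y)).
have bxy : box 0 1 0 1 (x, y) by move: x01 y01 => /andP[? ?] /andP[? ?].
have /near_pair[e e0 He] := (within_nearP _ _).1 cF _ bxy _ (open_nbhs_nbhs (conj oU Uxy)).
exists e => // a b c d a0 ab b1 c0 cd d1 ax bx cy dy y0 py0.
have bU z : box a b c d z -> U (F z).
  case: z => t s [/= ta tb sc sd].
  move: ax bx cy dy; rewrite !ltr_norml => /andP[? ?] /andP[? ?] /andP[? ?] /andP[? ?].
  apply: He; rewrite ?ltr_norml; try (apply/andP; split; lra).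
  by split=> /=; lra.
have bac : box a b c d (a, c) by [].
have Uy0 : U (p y0) by rewrite py0; exact: bU.
have [V [oV Vy0 injV surV opnV]] := HU _ Uy0.
have ex z : exists v, box a b c d z -> V v /\ p v = F z.
  have [bz|nbz] := pselect (box a b c d z); last by exists y0.
  by have [v Vv pv] := surV _ (bU _ bz); exists v.
have [G HG] := choice ex.
exists G; split; last by move=> z /HG[].
  apply/within_nearP => z bz B nB; have [VG pG] := HG _ bz.
  have oW : open (p @` (B° `&` V)).
    by apply: opnV; [apply: openI => //; exact: open_interior|move=> ? []].
  have nW : nbhs (F z) (p @` (B° `&` V)).
    by apply: open_nbhs_nbhs; split=> //; exists (G z).
  have bz' : box 0 1 0 1 z.
    by case: bz => *; split; lra.
  move/within_nearP: cF => /(_ _ bz' _ nW); apply: filterS => w Hw bw.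
  have bw' : box 0 1 0 1 w.
    by case: bw => *; split; lra.
  have [v [Bv Vv] pv] := Hw bw'; have [VGw pGw] := HG _ bw.
  suff -> : G w = v by exact: nbhs_singleton Bv.
  by apply: injV; rewrite ?inE// pGw.
by have [VG pG] := HG _ bac; apply: injV; rewrite ?inE// pG.
Qed.

(** Both coordinates are treated in turn: rectangles around a vertical line are first
    assembled from small ones, then juxtaposed. *)
Theorem homotopy_lift : liftable 0 1 0 1.
Proof.
suff H x : 0 <= x <= 1 -> exists2 e : R, 0 < e & forall a b,
    0 <= a -> a <= b -> b <= 1 -> `|a - x| < e -> `|b - x| < e -> liftable a b 0 1.
  have := @interval_additive_local R (fun a b => a <= b -> liftable a b 0 1).
  apply=> // [a m b am mb L1 L2 ab|x /H[e e0 He]].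
    by apply: (liftable_addh am mb); [exact: ler01|exact: L1|exact: L2].
  by exists e => // a b a0 ab b1 ax bx _; exact: He.
move=> x01.
pose P c d := c <= d -> exists2 e : R, 0 < e & forall a b,
    0 <= a -> a <= b -> b <= 1 -> `|a - x| < e -> `|b - x| < e -> liftable a b c d.
suff : P 0 1 by apply; exact: ler01.
apply: interval_additive_local.
  move=> c m d cm md /(_ cm)[e e0 He] /(_ md)[e' e0' He'] _.
  exists (Num.min e e') => [|a b a0 ab b1]; first by rewrite lt_min e0.
  rewrite !lt_min => /andP[ax ax'] /andP[bx bx'].
  by apply: (liftable_addv ab cm md); [exact: He|exact: He'].
move=> y y01; have [e e0 He] := liftable_local x01 y01.
exists e => // c d c0 cd d1 cy dy _; exists e => // a b a0 ab b1 ax bx.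
exact: He.
Qed.

End Homotopy.

Local Notation I := (`[0%R, 1%R]%classic : set R).

Lemma box_II : box 0 1 0 1 = I `*` I.
Proof.
apply/seteqP; split=> z; rewrite /box/= !in_itv /=.
  by move=> [-> -> -> ->].
by move=> [/andP[-> ->] /andP[-> ->]].
Qed.

Lemma path_lift x1 x2 u y1 : is_path x1 x2 u -> p y1 = x1 ->
  exists2 v : R -> Y, is_path y1 (v 1) v & forall t, I t -> p (v t) = u t.
Proof.
move=> [cu u0 u1] py.
have cF : {within box 0 1 0 1, continuous (u \o fst)}.
  rewrite box_II; apply: within_comp cu _ => [|[]//=? ? []//].
  by apply: continuous_subspaceT => ?; exact: cvg_fst.
have [|G [cG G0 pG]] := homotopy_lift cF (y := y1); first by rewrite py -u0.
exists (fun t => G (t, 0)) => [|t It]; last by rewrite pG// box_II; split=> //; exact: I0.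
split=> //; rewrite box_II in cG.
apply: (within_comp (f := fun t : R => (t, 0)) _ cG) => [|t It].
  by apply: continuous_subspaceT; exact: continuous_hline.
by split=> //; exact: I0.
Qed.

Lemma path_lift_unique y1 y2 z1 z2 (v w : R -> Y) t0 :
  is_path y1 y2 v -> is_path z1 z2 w -> (forall t, I t -> p (v t) = p (w t)) ->
  I t0 -> v t0 = w t0 -> forall t, I t -> v t = w t.
Proof.
move=> [cv _ _] [cw _ _] pvw It0 vw0.
by apply: lift_unique => //; [exact: segment_connected|exists t0].
Qed.

(** Lifts of homotopic paths with the same origin have the same end. *)
Lemma homotopic_lift_end x1 x2 u u' y1 z z' (v v' : R -> Y) :
  path_homotopic x1 x2 u u' -> is_path y1 z v -> is_path y1 z' v' ->
  (forall t, I t -> p (v t) = u t) -> (forall t, I t -> p (v' t) = u' t) -> z = z'.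
Proof.
move=> [h [ch hI hE]] pv pv' vu vu'.
have py1 : p y1 = x1.
  by case: pv => _ <- _; rewrite (vu 0 I0) -(hI 0 I0).1 (hE 0 I0).1.
have [||G [cG G0 pG]] := homotopy_lift (F := h) _ (y := y1).
- by rewrite box_II.
- by rewrite (hE 0 I0).1.
rewrite box_II in cG pG.
have pG' t s : I t -> I s -> p (G (t, s)) = h (t, s).
  by move=> It Is; apply: pG; split.
have hp s : I s -> is_path (G (0, s)) (G (1, s)) (fun t => G (t, s)).
  move=> Is; split=> //; apply: (within_comp (f := fun t : R => (t, s)) _ cG) => [|t It //].
  by apply: continuous_subspaceT; exact: continuous_hline.
have vp t : I t -> is_path (G (t, 0)) (G (t, 1)) (fun s => G (t, s)).
  move=> Is; split=> //; apply: (within_comp (f := fun s : R => (t, s)) _ cG) => [|s It //].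
  by apply: continuous_subspaceT; exact: continuous_vline.
have G0s s : I s -> G (0, s) = y1.
  move=> Is; rewrite -[RHS]/(cst y1 s).
  apply: (path_lift_unique (vp _ I0) (is_path_cst y1) _ I0) => // t It.
  by rewrite (pG' _ _ I0 It) (hE t It).1.
have G1s s : I s -> G (1, s) = G (1, 0).
  move=> Is; rewrite -[RHS]/(cst (G (1, 0)) s).
  apply: (path_lift_unique (vp _ I1) (is_path_cst _) _ I0) => // t It.
  by rewrite /cst (pG' _ _ I1 It) (pG' _ _ I1 I0) (hE t It).2 (hE 0 I0).2.
have Gv t : I t -> G (t, 0) = v t.
  move=> It; apply: (path_lift_unique (hp _ I0) pv _ I0) => // [s Is|].
    by rewrite (vu _ Is) (pG' _ _ Is I0) (hI s Is).1.
  by rewrite G0; case: pv.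
have Gv' t : I t -> G (t, 1) = v' t.
  move=> It; apply: (path_lift_unique (hp _ I1) pv' _ I0) => // [s Is|].
    by rewrite (vu' _ Is) (pG' _ _ Is I1) (hI s Is).2.
  by rewrite (G0s _ I1); case: pv'.
case: pv => _ _ <-; case: pv' => _ _ <-.
by rewrite -(Gv _ I1) -(Gv' _ I1) (G1s _ I1).
Qed.

End Lifting.

(** * The circle and its universal covering *)

Section Circle.
Context {R : realType}.

(** Congruence modulo the integers. *)
Definition int_diff : rel R := fun r s => `[< exists k : int, r - s = k%:~R >].

Lemma int_diff_refl : reflexive int_diff.
Proof. by move=> r; apply/asboolP; exists 0; rewrite subrr. Qed.

Lemma int_diff_sym : symmetric int_diff.
Proof.
by move=> r s; apply/asboolP/asboolP => -[k E]; exists (- k); rewrite mulrNz -E opprB.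
Qed.

Lemma int_diff_trans : transitive int_diff.
Proof.
move=> s r t /asboolP[k E] /asboolP[l E']; apply/asboolP; exists (k + l).
by rewrite intrD -E -E'; lra.
Qed.

Definition int_diff_equiv :=
  EquivRel int_diff int_diff_refl int_diff_sym int_diff_trans.

Definition circle_quot := {eq_quot int_diff_equiv}%qT.

(** The quotient of the real line by the integers, with the quotient topology. *)
Definition circle : topologicalType := quotient_topology circle_quot.

(** The canonical projection of the line onto the circle. *)
Definition to_circle (r : R) : circle := (\pi_circle_quot r)%qT.

Lemma to_circleP r s : to_circle r = to_circle s <-> exists k : int, r - s = k%:~R.
Proof.
split=> [/(@eqquotP _ int_diff_equiv)/asboolP//|H].
by apply/(@eqquotP _ int_diff_equiv)/asboolP.
Qed.

Lemma to_circleD r (k : int) : to_circle (r + k%:~R) = to_circle r.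
Proof. by apply/to_circleP; exists k; rewrite addrC addKr. Qed.

Lemma to_circle_continuous : continuous to_circle.
Proof. exact: (@pi_continuous R circle_quot). Qed.

Lemma to_circle_surj x : exists r, to_circle r = x.
Proof. by exists (@repr _ circle_quot x); rewrite /to_circle reprK. Qed.

Lemma to_circle_open (W : set R) : open W -> open (to_circle @` W).
Proof.
move=> oW; suff : open (to_circle @^-1` (to_circle @` W)) by [].
have -> : to_circle @^-1` (to_circle @` W) =
    \bigcup_(k in [set: int]) (fun r => 1 * r + k%:~R) @^-1` W.
  apply/seteqP; split=> r /=.
    move=> [s Ws /to_circleP[k E]]; exists k => //=.
    by rewrite (_ : 1 * r + k%:~R = s)// -E; lra.
  by move=> [k _ Wk]; exists (1 * r + k%:~R) => //; rewrite mul1r to_circleD.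
apply: bigcup_open => k _; apply: open_comp oW => r _; exact: continuous_aff.
Qed.

Lemma circle_covering : covering_map to_circle.
Proof.
split; first exact: to_circle_continuous.
  by apply/seteqP; split=> // x _; have [r <-] := to_circle_surj x; exists r.
move=> x; have [r rx] := to_circle_surj x.
pose V (k : int) : set R := [set` `](r + k%:~R - 2^-1), (r + k%:~R + 2^-1)[].
have VP k s : V k s <-> - 2^-1 < s - r - k%:~R < 2^-1 by rewrite /V/= in_itv/=; lra.
have Vcongr k s t : V k s -> V k t -> to_circle s = to_circle t -> s = t.
  move=> /VP Vs /VP Vt /to_circleP[l E].
  have l1 : l%:~R < (1%:~R : R) by rewrite -E; lra.
  have l2 : (-1)%:~R < (l%:~R : R) by rewrite -E; lra.
  have l0 : l = 0 by move: l1 l2; rewrite !ltr_int; lia.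
  by move: E; rewrite l0 => /eqP; rewrite subr_eq0 => /eqP.
have Vshift k l s : V k s -> V l (s + (l - k)%:~R).
  by move=> /VP Vs; apply/VP; rewrite intrB; lra.
have imV k : to_circle @` V k = to_circle @` V 0.
  by apply/seteqP; split=> y [s Vs <-];
    [exists (s + (0 - k)%:~R)|exists (s + (k - 0)%:~R)];
    rewrite ?to_circleD//; apply: Vshift Vs.
(* the sheets over the image of an open interval of length 1 are its translates *)
have oV k : open (V k) by exact: interval_open.
exists (to_circle @` V 0).
  split; first by apply: to_circle_open.
  by exists r => //; apply/VP; lra.
exists (range V); split.
- apply/seteqP; split=> s /=.
    move=> [t Vt /to_circleP[k E]].
    exists (V (- k)); first by exists (- k).
    by have := Vshift _ (- k) _ Vt; rewrite subr0 mulrNz -E; congr V; lra.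
  move=> [_ [k _ <-] Vk]; suff : (to_circle @` V 0) (to_circle s) by [].
  by rewrite -(imV k); exists s.
- move=> _ _ [k _ <-] [l _ <-] [s [/VP Vk /VP Vl]].
  have l1 : (l - k)%:~R < (1%:~R : R) by rewrite intrB; lra.
  have l2 : (-1)%:~R < ((l - k)%:~R : R) by rewrite intrB; lra.
  by congr V; move: l1 l2; rewrite !ltr_int; lia.
- move=> _ [k _ <-]; split=> //.
    by move=> s t; rewrite !inE; exact: Vcongr.
  by move=> W oW _; exact: to_circle_open.
Qed.

End Circle.

(** * Isometries and faces of cubes *)

Section CubeIsometries.
Context {R : realType}.

(** The vertex of the cube given by a corner. *)
Definition vertex_pt k (e : corner k) : 'rV[R]_k := \row_j (e j)%:R.

Lemma vertex_pt_cube k (e : corner k) : cube (vertex_pt e).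
Proof. by move=> i; rewrite mxE; case: (e i); rewrite lexx ler01. Qed.

(** [g] permutes the coordinates according to [s] and reflects those
    distinguished by [r]. *)
Definition cube_symmetry k (g : 'rV[R]_k -> 'rV[R]_k) (s : {perm 'I_k})
    (r : 'I_k -> bool) :=
  forall x, cube x -> forall i, g x 0 (s i) = if r i then 1 - x 0 i else x 0 i.

Lemma sqr_dist01 (x y : R) : 0 <= x <= 1 -> 0 <= y <= 1 ->
  (x - y) ^+ 2 <= 1 ?= iff (((x == 0) && (y == 1)) || ((x == 1) && (y == 0))).
Proof.
move=> x01 y01; split; first by nra.
apply/eqP/idP => [E|]; last first.
  by move=> /orP[] /andP[/eqP -> /eqP ->]; nra.
have /eqP : (x - y - 1) * (x - y + 1) = 0 by nra.
rewrite mulf_eq0 => /orP[] /eqP E'; apply/orP; [right|left];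
  by apply/andP; split; apply/eqP; lra.
Qed.

Lemma isometry_vertex k (g : 'rV[R]_k -> 'rV[R]_k) (e : corner k) :
  cube_isometry g -> exists e' : corner k, g (vertex_pt e) = vertex_pt e'.
Proof.
move=> [gC gD]; pose e1 : corner k := [ffun j => ~~ e j].
have gcube x : cube x -> cube (g x) by move=> cx; rewrite -gC; exists x.
have c0 := gcube _ (vertex_pt_cube e); have c1 := gcube _ (vertex_pt_cube e1).
have d1 : sqdist (vertex_pt e) (vertex_pt e1) = \sum_(i < k) 1.
  by rewrite /sqdist; apply: eq_bigr => i _; rewrite !mxE ffunE; case: (e i) => /=; lra.
have := gD _ _ (vertex_pt_cube e) (vertex_pt_cube e1); rewrite d1 => /eqP.
rewrite /sqdist (leif_sum (fun i _ => sqr_dist01 (c0 i) (c1 i))).2.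
move=> /forallP /= H; exists [ffun j => g (vertex_pt e) 0 j == 1].
apply/rowP => j; rewrite !mxE ffunE.
by have := H j => /orP[] /andP[/eqP -> _]; rewrite ?eqxx// eq_sym oner_eq0.
Qed.

Lemma vertex_pt_sqdist k (e e' : corner k) :
  sqdist (vertex_pt e) (vertex_pt e') = #|[set i | e i != e' i]%SET|%:R.
Proof.
rewrite /sqdist -sum1_card natr_sum [RHS]big_mkcond /=; apply: eq_bigr => i _.
by rewrite !mxE inE; case: (e i); case: (e' i) => /=; lra.
Qed.

(** An isometry maps vertices to vertices, and a point of the cube is determined
    by its distances to the vertices. *)
Lemma isometry_symmetry k (g : 'rV[R]_k -> 'rV[R]_k) : cube_isometry g ->
  exists s r, cube_symmetry g s r.
Proof.
move=> gI; have [gC gD] := gI.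
(* the images of the origin and of its neighbours determine the symmetry *)
pose o : corner k := [ffun=> false]; pose dlt i : corner k := [ffun j => j == i].
have [c gc] := isometry_vertex o gI.
have /choice[d gd] i := isometry_vertex (dlt i) gI.
have ex i : exists j, [set l | c l != d i l]%SET = [set j]%SET.
  apply/cards1P; rewrite -(eqr_nat R) -vertex_pt_sqdist -gc -gd gD; try exact: vertex_pt_cube.
  rewrite vertex_pt_sqdist eqr_nat; apply/cards1P; exists i.
  by apply/setP => l; rewrite !inE !ffunE; case: (l == i).
have [s0 Hs0] := choice ex.
have E x i : cube x -> g x 0 (s0 i) = if c (s0 i) then 1 - x 0 i else x 0 i.
  move=> cx.
  have sqB (y : 'rV[R]_k) (a b : corner k) j : [set l | a l != b l]%SET = [set j]%SET ->
      sqdist y (vertex_pt a) - sqdist y (vertex_pt b) =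
      (y 0 j - (a j)%:R) ^+ 2 - (y 0 j - (~~ a j)%:R) ^+ 2.
    move=> /setP abj; rewrite /sqdist -sumrB (bigD1 j)//= big1 ?addr0.
      by rewrite !mxE; have := abj j; rewrite !inE eqxx; case: (a j); case: (b j).
    move=> l lj; rewrite !mxE; have := abj l; rewrite !inE (negbTE lj).
    by move=> /negbFE/eqP ->; rewrite subrr.
  have := sqB (g x) _ _ _ (Hs0 i); rewrite -gc -gd !gD; try exact: vertex_pt_cube; try by [].
  rewrite (sqB x o (dlt i) i); last by apply/setP => l; rewrite !inE !ffunE; case: (l == i).
  by rewrite !ffunE; case: (c (s0 i)) => /=; nra.
have s0_inj : injective s0.
  move=> i j sij; apply/eqP; apply: contraT => ij.
  have := E _ i (vertex_pt_cube (dlt i)); have := E _ j (vertex_pt_cube (dlt i)).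
  rewrite sij => ->; rewrite !mxE !ffunE eqxx eq_sym (negbTE ij).
  by case: (c _) => /=; lra.
exists (perm s0_inj), (fun i => c (s0 i)) => x cx i.
by rewrite permE; exact: E.
Qed.

(** The action on corners of the symmetry described by [s] and [r]. *)
Definition symmetry_corner k (s : {perm 'I_k}) (r : 'I_k -> bool) (e : corner k) : corner k :=
  [ffun j => e (s^-1%g j) (+) r (s^-1%g j)].

Lemma symmetry_cornerE k (s : {perm 'I_k}) r (e : corner k) j :
  symmetry_corner s r e (s j) = e j (+) r j.
Proof. by rewrite ffunE permK. Qed.

Lemma symmetry_corner_surj k (s : {perm 'I_k}) r (e : corner k) :
  exists e', symmetry_corner s r e' = e.
Proof.
exists [ffun j => e (s j) (+) r j]; apply/ffunP => j.
by rewrite !ffunE permKV addbK.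
Qed.

Lemma corner_edge_cube k (e : corner k) i (t : R) : 0 <= t <= 1 -> cube (corner_edge e i t).
Proof. by move=> t01 j; rewrite mxE; case: (j == i); case: (e j) => /=; lra. Qed.

Lemma symmetry_corner_edge k (g : 'rV[R]_k -> 'rV[R]_k) s r e i t :
  cube_symmetry g s r -> 0 <= t <= 1 ->
  g (corner_edge e i t) = corner_edge (symmetry_corner s r e) (s i) t.
Proof.
move=> gs t01; apply/rowP => l; rewrite -(permKV s l); set j := (s^-1)%g l.
rewrite (gs _ (corner_edge_cube e i t01)) !mxE symmetry_cornerE (inj_eq perm_inj).
by case: (j == i); case: (r j); case: (e j) => /=; lra.
Qed.

(** The corner at the other end of the edge in the direction [j]. *)
Definition flip k (j : 'I_k) (e : corner k) : corner k := [ffun l => e l (+) (l == j)].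

Lemma flipK k (j : 'I_k) : involutive (flip j).
Proof. by move=> e; apply/ffunP => l; rewrite !ffunE addbK. Qed.

Lemma symmetry_corner_flip k (s : {perm 'I_k}) r (e : corner k) j :
  symmetry_corner s r (flip j e) = flip (s j) (symmetry_corner s r e).
Proof.
apply/ffunP => l; rewrite -(permKV s l) symmetry_cornerE !ffunE permK (inj_eq perm_inj).
by rewrite addbAC.
Qed.

Lemma corner_edge_flip k (e : corner k) i (t : R) :
  corner_edge (flip i e) i t = corner_edge e i (1 - t).
Proof.
apply/rowP => j; rewrite !mxE ffunE; case: eqP => //= _; last by rewrite addbF.
by rewrite addbT; case: (e j) => /=; lra.
Qed.

(** The corner of a cube which projects to [e] in the face where the coordinate
    [j] is equal to [b]. *)
Definition face_corner k (j : 'I_k.+1) (b : bool) (e : corner k) : corner k.+1 :=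
  [ffun l => if unlift j l is Some l' then e l' else b].

Lemma face_cornerP k (j : 'I_k.+1) (e : corner k.+1) :
  exists e', face_corner j (e j) e' = e.
Proof.
exists [ffun l => e (lift j l)]; apply/ffunP => l; rewrite !ffunE.
by case: unliftP => [l' ->|->]; rewrite ?ffunE.
Qed.

Lemma face_corner_flip k (j : 'I_k.+1) b i (e : corner k) :
  face_corner j b (flip i e) = flip (lift j i) (face_corner j b e).
Proof.
apply/ffunP => l; rewrite !ffunE; case: unliftP => [l' ->|->].
  by rewrite ffunE (inj_eq lift_inj).
by rewrite (negbTE (neq_lift _ _)) addbF.
Qed.

Lemma corner_edge_face k (j : 'I_k.+1) b (e : corner k) i (t : R) :
  corner_edge (face_corner j b e) (lift j i) t = cube_face j b (corner_edge e i t).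
Proof.
apply/rowP => l; rewrite !mxE ffunE; case: unliftP => [l' ->|->].
  by rewrite (inj_eq lift_inj) mxE.
by rewrite (negbTE (neq_lift _ _)).
Qed.

Lemma cube_faceP k (j : 'I_k.+1) (b : bool) (x : 'rV[R]_k.+1) : cube x -> x 0 j = b%:R ->
  exists2 y, cube y & x = cube_face j b y.
Proof.
move=> cx xj; exists (\row_l x 0 (lift j l)) => [l|]; first by rewrite mxE.
apply/rowP => l; rewrite mxE; case: unliftP => [l' ->|->//].
by rewrite mxE.
Qed.

Lemma open_cubeW k (x : 'rV[R]_k) : open_cube x -> cube x.
Proof. by move=> ox i; have /andP[/ltW -> /ltW ->] := ox i. Qed.

Lemma cube_open_or_face k (x : 'rV[R]_k.+1) : cube x ->
  open_cube x \/ exists j b y, cube y /\ x = cube_face j b y.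
Proof.
move=> cx; have [ox|nox] := pselect (open_cube x); [by left|right].
have [j xj] : exists j, ~ (0 < x 0 j < 1) by exact/existsNP.
have /andP[x0 x1] := cx j.
have [x0'|x0'] := eqVneq (x 0 j) 0.
  by have [|y cy xy] := @cube_faceP _ j false x cx; [rewrite x0'|exists j, false, y].
have x1' : x 0 j = 1.
  apply: contrapT => /eqP x1'; apply: xj; apply/andP.
  by rewrite !lt_neqAle x0 x1 x1' eq_sym x0'.
by have [|y cy xy] := @cube_faceP _ j true x cx; [rewrite x1'|exists j, true, y].
Qed.

Definition cube_center k : 'rV[R]_k := const_mx 2^-1.

Lemma cube_center_open k : open_cube (cube_center k).
Proof. by move=> i; rewrite mxE; lra. Qed.

(** The affine path from [x] to [y]. *)
Definition segment k (x y : 'rV[R]_k) (t : R) : 'rV[R]_k :=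
  \row_j ((y 0 j - x 0 j) * t + x 0 j).

Lemma segment_cube k (x y : 'rV[R]_k) t : cube x -> cube y -> 0 <= t <= 1 ->
  cube (segment x y t).
Proof. by move=> cx cy t01 j; rewrite mxE; have := cx j; have := cy j; nra. Qed.

Lemma symmetry_segment k (g : 'rV[R]_k -> 'rV[R]_k) s r x y t :
  cube_symmetry g s r -> cube x -> cube y -> 0 <= t <= 1 ->
  g (segment x y t) = segment (g x) (g y) t.
Proof.
move=> gs cx cy t01; apply/rowP => l; rewrite -(permKV s l) !mxE.
rewrite !gs//; last exact: segment_cube.
by rewrite mxE; case: (r _); lra.
Qed.

Lemma rV_continuous (U : topologicalType) k (f : U -> 'rV[R]_k) :
  (forall i, continuous (fun u => f u 0 i)) -> continuous f.
Proof.
move=> cf u A [P nP sPA].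
have : \forall v \near u, forall j, P 0 j (f v 0 j).
  by apply: filter_forall => j; exact: cf (nP 0 j).
by apply: filterS => v Hv; apply: sPA => i j; rewrite (ord1 i).
Qed.

Lemma segment_continuous k (x y : 'rV[R]_k) : continuous (segment x y).
Proof.
apply: rV_continuous => i.
rewrite (_ : (fun u => _) = fun t => (y 0 i - x 0 i) * t + x 0 i); first exact: continuous_aff.
by apply/funext => t; rewrite mxE.
Qed.

End CubeIsometries.

(** * Edges and squares of a cube complex *)

Section Cells.
Context {R : realType} {T : topologicalType} {K : cubulation R T}.
Hypothesis KC : is_cube_complex K.

Local Notation I := (`[0%R, 1%R]%classic : set R).

Lemma closed_cube k : closed (@cube R k).
Proof.
rewrite (_ : cube = \bigcap_(i in [set: 'I_k]) (fun x : 'rV[R]_k => x 0 i) @^-1` I).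
  apply: closed_bigI => i _; apply: preimage_closed; last exact: interval_closed.
  by move=> x _; exact: coord_continuous.
apply/seteqP; split=> x.
  by move=> cx i _; rewrite /= in_itv /=; exact: cx.
by move=> cx i; have := cx i Logic.I; rewrite /= in_itv.
Qed.

Lemma chi_continuous k (c : cell K k) : {within cube, continuous (chi K c)}.
Proof.
apply/within_nearP => x cx B /nbhs_interior nB.
have cA : closed (cube `&` chi K c @^-1` (~` B°)).
  by apply: (cube_complex_weak KC (~` B°)).1; apply: open_closedC; exact: open_interior.
have oA := closed_openC cA.
have : nbhs x (~` (cube `&` chi K c @^-1` (~` B°))).
  by apply: open_nbhs_nbhs; split=> // -[_]; apply; exact: nbhs_singleton nB.
apply: filterS => y nA cy; apply: (@nbhs_singleton _ _ B); apply: contrapT => nBy.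
by apply: nA.
Qed.

(** The pair formed by a cell and a point of its open cube is determined by the image
    of this point, the dimension of the cell included. *)
Lemma chi_inj k k' (c : cell K k) (c' : cell K k') x x' :
  open_cube x -> open_cube x' -> chi K c x = chi K c' x' ->
  existT (fun k => (cell K k * 'rV[R]_k)%type) k (c, x) = existT _ k' (c', x').
Proof.
move=> ox ox' E; have [q [_ uq]] := cube_complex_partition KC (chi K c x).
by rewrite -(uq (existT _ k (c, x)))// -(uq (existT _ k' (c', x'))).
Qed.

Lemma chi_inj_eq k (c c' : cell K k) x x' :
  open_cube x -> open_cube x' -> chi K c x = chi K c' x' -> c = c' /\ x = x'.
Proof.
move=> ox ox' /(chi_inj ox ox') E.
by have [-> ->] := Eqdep_dec.inj_pair2_eq_dec _ PeanoNat.Nat.eq_dec _ _ _ _ E.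
Qed.

Lemma edge_map_inj (a b : oedge K) : (forall t, I t -> edge_map a t = edge_map b t) -> a = b.
Proof.
have I3 : I (3^-1) by apply/inI; lra.
move=> /(_ _ I3); case: a b => [f o] [f' o'] /chi_inj_eq[||/= -> /rowP/(_ 0)].
- by move=> i; rewrite mxE; case: o => /=; lra.
- by move=> i; rewrite mxE; case: o' => /=; lra.
- by rewrite !mxE; case: o; case: o' => //= E; exfalso; lra.
Qed.

Lemma edge_map_path (a : oedge K) : is_path (src a) (tgt a) (edge_map a).
Proof.
split=> //; apply: (within_comp (f := fun t : R => const_mx (if a.2 then t else 1 - t) : 'rV[R]_1) _
  (@chi_continuous 1 a.1)).
  apply: continuous_subspaceT; apply: rV_continuous => i.
  rewrite (_ : (fun u => _) = fun t => (if a.2 then 1 else -1) * t + (if a.2 then 0 else 1)).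
    exact: continuous_aff.
  by apply/funext => t; rewrite mxE; case: a.2; lra.
by move=> t /inI It i; rewrite mxE; case: a.2; lra.
Qed.

Lemma edge_map_rev (a : oedge K) t : edge_map (rev_edge a) t = edge_map a (1 - t).
Proof. by rewrite /edge_map/=; case: a.2 => //=; rewrite subKr. Qed.

Lemma rev_edgeK : involutive (@rev_edge R T K).
Proof. by move=> [f o]; rewrite /rev_edge/= negbK. Qed.

Lemma src_rev (a : oedge K) : src (rev_edge a) = tgt a.
Proof. by rewrite /src /tgt edge_map_rev subr0. Qed.

Lemma tgt_rev (a : oedge K) : tgt (rev_edge a) = src a.
Proof. by rewrite -{2}[a]rev_edgeK src_rev. Qed.

Lemma corner_side_inj k (c : cell K k) (e : corner k) i a b :
  corner_side c e i a -> corner_side c e i b -> a = b.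
Proof.
by move=> ca cb; apply: edge_map_inj => t /inI t01; rewrite -ca// -cb.
Qed.

Lemma corner_side_rev k (c : cell K k) (e : corner k) i a :
  corner_side c e i a -> corner_side c (flip i e) i (rev_edge a).
Proof.
move=> ca t t01; rewrite corner_edge_flip edge_map_rev ca//; lra.
Qed.

Lemma corner_side_src k (c : cell K k) (e : corner k) i a :
  corner_side c e i a -> src a = chi K c (vertex_pt e).
Proof.
move=> ca; rewrite /src -ca ?lexx ?ler01//; congr (chi K c _).
by apply/rowP => j; rewrite !mxE; case: eqP => // _; case: (e j) => /=; lra.
Qed.

Lemma corner_side_tgt k (c : cell K k) (e : corner k) i a :
  corner_side c e i a -> tgt a = chi K c (vertex_pt (flip i e)).
Proof. by move=> /corner_side_rev/corner_side_src; rewrite src_rev. Qed.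

(** The faces of a cube, together with their sides. *)
Lemma face_cell k (c : cell K k.+1) (j : 'I_k.+1) (b : bool) :
  exists (d : cell K k) (g : 'rV[R]_k -> 'rV[R]_k) s r,
  [/\ cube_symmetry g s r, g @` cube = cube,
      forall x, cube x -> chi K c (cube_face j b x) = chi K d (g x) &
      forall e i a, corner_side d (symmetry_corner s r e) (s i) a ->
        corner_side c (face_corner j b e) (lift j i) a].
Proof.
have [d [g [gI cd]]] := cube_complex_face KC c j b.
have [s [r gs]] := isometry_symmetry gI.
exists d, g, s, r; split=> //; first by case: gI.
move=> e i a da t t01; rewrite corner_edge_face cd; last exact: corner_edge_cube.
by rewrite (symmetry_corner_edge _ _ gs)// da.
Qed.

Lemma edge_corner_side (c : cell K 1) (e : corner 1) i :
  corner_side c e i (c, ~~ e i).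
Proof.
move=> t t01; rewrite /edge_map /=; congr (chi K c _); apply/rowP => j.
by rewrite !mxE (ord1 i) (ord1 j) eqxx; case: (e 0).
Qed.

Lemma corner_side_exists k (c : cell K k) (e : corner k) i :
  exists a, corner_side c e i a.
Proof.
elim: k => [|[|k] IH] in c e i *; first by case: i.
  by exists (c, ~~ e i); exact: edge_corner_side.
have [j ji] : exists j : 'I_k.+2, j != i.
  exists (if i == ord0 then lift ord0 ord0 else ord0).
  by case: (eqVneq i ord0) => [->//|]; rewrite eq_sym.
have [d [g [s [r [_ _ _ dc]]]]] := face_cell c j (e j).
have [e' <-] := face_cornerP j e.
case: (unliftP j i) => [i' ->|ij]; last by rewrite ij eqxx in ji.
have [a da] := IH d (symmetry_corner s r e') (s i').
by exists a; exact: dc.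
Qed.

(** In a cube of any dimension, the sides in the direction [i] at two corners joined
    by an edge in another direction are opposite sides of a square. *)
Lemma opposite_sides_parallel k (c : cell K k) (e : corner k) i j a a' : i != j ->
  corner_side c e i a -> corner_side c (flip j e) i a' -> oparallel a a'.
Proof.
elim: k => [|[|[|k]] IH] in c e i j a a' *; first by case: i.
- by rewrite (ord1 i) (ord1 j).
- move=> ij ca ca'; exists c, e, (flip j e), i; split=> // l.
  rewrite ffunE; case: (eqVneq l j) => [->|lj].
    by rewrite addbT [j == i]eq_sym (negbTE ij); case: (e j).
  rewrite addbF eqxx; apply/esym/eqP/val_inj.
  have := ltn_ord i; have := ltn_ord j; have := ltn_ord l.
  by move: ij lj; rewrite -!val_eqE /=; lia.
move=> ij ca ca'.
have [l /andP[li lj]] : exists l : 'I_k.+3, (l != i) && (l != j).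
  apply/existsP; apply: contraT; rewrite negb_exists => /forallP H.
  have : (#|'I_k.+3| <= #|[set i; j]%SET|)%N.
    by apply: subset_leq_card; apply/fintype.subsetP => l _; have := H l; rewrite !inE negb_and !negbK.
  by rewrite card_ord cards2; lia.
have [d [g [s [r [_ _ _ dc]]]]] := face_cell c l (e l).
have [e' ee'] := face_cornerP l e.
case: (unliftP l i) li => [i' iE|->]; last by rewrite eqxx.
case: (unliftP l j) lj => [j' jE|->]; last by rewrite eqxx.
move=> _ _; have [b db] := corner_side_exists d (symmetry_corner s r e') (s i').
have [b' db'] := corner_side_exists d (symmetry_corner s r (flip j' e')) (s i').
have -> : a = b by apply: corner_side_inj ca _; rewrite -ee' iE; exact: dc.
have -> : a' = b'.
  by apply: corner_side_inj ca' _; rewrite -ee' iE jE -face_corner_flip; exact: dc.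
apply: (IH d _ _ (s j')) db _; last by rewrite -symmetry_corner_flip.
by rewrite (inj_eq perm_inj) -(inj_eq (@lift_inj _ l)) -iE -jE.
Qed.

Lemma oparallel_rev a b : oparallel a b -> oparallel (rev_edge a) (rev_edge b : oedge K).
Proof.
move=> [c [e [e' [i [ca cb H]]]]]; exists c, (flip i e), (flip i e'), i.
split; [exact: corner_side_rev|exact: corner_side_rev|move=> j].
by rewrite !ffunE -H; case: (e j); case: (e' j); case: (j == i).
Qed.

Lemma oparallelP a b : oparallel a b -> exists (c : cell K 2) e i j,
  [/\ i != j, corner_side c e i a & corner_side c (flip j e) i (b : oedge K)].
Proof.
move=> [c [e [e' [i [ca cb H]]]]].
have [j ji] : exists j : 'I_2, i != j.
  exists (if i == ord0 then lift ord0 ord0 else ord0).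
  by case: (eqVneq i ord0) => [->|].
exists c, e, i, j; split=> //; suff -> : flip j e = e' by [].
apply/ffunP => l; rewrite ffunE; have := H l; case: (eqVneq l j) => [->|lj].
  by rewrite [j == i]eq_sym (negbTE ji); case: (e j); case: (e' j).
suff -> : l = i by rewrite eqxx => /eqP ->; rewrite addbF.
apply/val_inj; have := ltn_ord i; have := ltn_ord j; have := ltn_ord l.
by move: ji lj; rewrite -!val_eqE /=; lia.
Qed.

(** The two other sides of a square with given sides [a] and [b] at a corner. *)
Lemma span_square_complete a b : span_square a b -> exists a' b' : oedge K,
  [/\ oparallel a a', oparallel b b', src a' = tgt b, src b' = tgt a & tgt a' = tgt b'].
Proof.
move=> [c [e [i [i' [ii' ca cb]]]]].
have [a' ca'] := corner_side_exists c (flip i' e) i.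
have [b' cb'] := corner_side_exists c (flip i e) i'.
exists a', b'; split.
- exact: opposite_sides_parallel ii' ca ca'.
- by apply: opposite_sides_parallel cb cb'; rewrite eq_sym.
- by rewrite (corner_side_src ca') (corner_side_tgt cb).
- by rewrite (corner_side_src cb') (corner_side_tgt ca).
- rewrite (corner_side_tgt ca') (corner_side_tgt cb'); congr (chi K c (vertex_pt _)).
  by apply/ffunP => l; rewrite !ffunE addbAC.
Qed.

End Cells.

(** * Combinatorial maps *)

Section CombinatorialMaps.
Context {R : realType} {T U : topologicalType}.
Context {K : cubulation R T} {L : cubulation R U} {f : T -> U}.
Hypothesis LC : is_cube_complex L.
Hypothesis fC : combinatorial K L f.

Local Notation I := (`[0%R, 1%R]%classic : set R).

Lemma combinatorial_cell k (c : cell K k) :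
  exists (d : cell L k) (g : 'rV[R]_k -> 'rV[R]_k) s r,
  [/\ cube_symmetry g s r, g @` cube = cube &
      forall x, cube x -> f (chi K c x) = chi L d (g x)].
Proof.
have [d [g [gI cd]]] := fC c; have [s [r gs]] := isometry_symmetry gI.
by exists d, g, s, r; split=> //; case: gI.
Qed.

Lemma combinatorial_edge_exists (a : oedge K) : exists b : oedge L,
  forall t, I t -> f (edge_map a t) = edge_map b t.
Proof.
have [d [g [s [r [gs _ cd]]]]] := combinatorial_cell a.1.
exists (d, a.2 (+) r 0) => t /inI t01; rewrite /edge_map cd /=; last first.
  by move=> i; rewrite mxE; case: a.2; lra.
congr (chi L d _); apply/rowP => i; rewrite mxE.
have -> : i = s 0 by rewrite !ord1.
rewrite gs ?mxE//; last by move=> j; rewrite mxE; case: a.2; lra.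
by case: a.2; case: (r 0) => //=; lra.
Qed.

(** The image of an oriented edge under a combinatorial map. *)
Definition edge_image (a : oedge K) : oedge L := projT1 (cid (combinatorial_edge_exists a)).

Lemma edge_imageE a t : I t -> f (edge_map a t) = edge_map (edge_image a) t.
Proof. by rewrite /edge_image; case: cid => b /= /(_ t). Qed.

Lemma edge_image_unique a b :
  (forall t, I t -> f (edge_map a t) = edge_map (b : oedge L) t) -> edge_image a = b.
Proof. by move=> H; apply: (edge_map_inj LC) => t It; rewrite -edge_imageE// H. Qed.

Lemma src_edge_image a : src (edge_image a) = f (src a).
Proof. by rewrite /src edge_imageE; last exact: I0. Qed.

Lemma tgt_edge_image a : tgt (edge_image a) = f (tgt a).
Proof. by rewrite /tgt edge_imageE; last exact: I1. Qed.

Lemma edge_image_rev a : edge_image (rev_edge a) = rev_edge (edge_image a).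
Proof.
apply: edge_image_unique => t /inI t01; rewrite !edge_map_rev edge_imageE//.
by apply/inI; lra.
Qed.

Lemma combinatorial_side k (c : cell K k) : exists (d : cell L k) s r,
  forall e i a, corner_side c e i a ->
    corner_side d (symmetry_corner s r e) (s i) (edge_image a).
Proof.
have [d [g [s [r [gs _ cd]]]]] := combinatorial_cell c.
exists d, s, r => e i a ca t t01.
rewrite -edge_imageE; last exact/inI.
rewrite -ca// cd; last exact: corner_edge_cube.
by rewrite (symmetry_corner_edge _ _ gs).
Qed.

Lemma edge_image_span_square a b :
  span_square a b -> span_square (edge_image a) (edge_image b).
Proof.
move=> [c [e [i [i' [ii' ca cb]]]]]; have [d [s [r H]]] := combinatorial_side c.
exists d, (symmetry_corner s r e), (s i), (s i'); rewrite (inj_eq perm_inj).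
by split=> //; exact: H.
Qed.

Lemma edge_image_oparallel a b :
  oparallel a b -> oparallel (edge_image a) (edge_image b).
Proof.
move=> [c [e [e' [i [ca cb E]]]]]; have [d [s [r H]]] := combinatorial_side c.
exists d, (symmetry_corner s r e), (symmetry_corner s r e'), (s i).
split=> [||j]; [exact: H|exact: H|].
rewrite -(permKV s j) !symmetry_cornerE (inj_eq perm_inj) -E.
by case: (e _); case: (e' _); case: (r _).
Qed.

End CombinatorialMaps.

(** * Edge paths and their crossings with a hyperplane *)

Section PathMaps.
Context {R : realType} {T U : topologicalType}.
Local Notation I := (`[0%R, 1%R]%classic : set R).

Lemma is_path_comp (f : T -> U) x y (u : R -> T) : continuous f ->
  is_path x y u -> is_path (f x) (f y) (f \o u).
Proof.
move=> cf [cu <- <-]; split=> //; apply: (within_comp (B := setT) cu) => //.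
exact: continuous_subspaceT.
Qed.

Lemma path_homotopic_comp (f : T -> U) x y (u v : R -> T) : continuous f ->
  path_homotopic x y u v -> path_homotopic (f x) (f y) (f \o u) (f \o v).
Proof.
move=> cf [h [ch hI hE]]; exists (f \o h); split.
- by apply: (within_comp (B := setT) ch) => //; exact: continuous_subspaceT.
- by move=> t /hI[/= -> ->].
- by move=> s /hE[/= -> ->].
Qed.

(** A relation that holds pointwise between two pairs of paths also holds between their
    concatenations. *)
Lemma path_cat_rel (P : T -> U -> Prop) (u u' : R -> T) (v v' : R -> U) :
  (forall t, I t -> P (u t) (v t)) -> (forall t, I t -> P (u' t) (v' t)) ->
  forall t, I t -> P (path_cat u u' t) (path_cat v v' t).
Proof.
move=> H H' t /inI t01; rewrite /path_cat; case: leP => t2; [apply: H|apply: H'];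
  apply/inI; lra.
Qed.

End PathMaps.

Section Walks.
Context {R : realType} {T : topologicalType} {K : cubulation R T}.
Hypothesis KC : is_cube_complex K.

(** The sequence [w] of oriented edges is an edge path from [x] to [y]. *)
Fixpoint walk (x : T) (w : seq (oedge K)) (y : T) : Prop :=
  if w is a :: w' then src a = x /\ walk (tgt a) w' y else x = y.

(** The edge path [w], as a parametrized path; [x] only matters if [w] is empty. *)
Fixpoint walk_path (x : T) (w : seq (oedge K)) : R -> T :=
  if w is a :: w' then path_cat (edge_map a) (walk_path (tgt a) w') else cst x.

Lemma walk_is_path x w y : walk x w y -> is_path x y (walk_path x w).
Proof.
elim: w x => [|a w IH] x /=; first by move=> ->; exact: is_path_cst.
by move=> [<- /IH]; apply: is_path_cat; exact: edge_map_path.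
Qed.

Lemma walk_cat x w w' y : walk x (w ++ w') y <-> exists z, walk x w z /\ walk z w' y.
Proof.
elim: w x => [|a w IH] x /=; first by split=> [|[z [->]]//]; exists x.
split=> [[ax /IH[z [wz wy]]]|[z [[ax wz] wy]]]; first by exists z.
by split=> //; apply/IH; exists z.
Qed.

(** The edge path [w] run backwards. *)
Definition rev_walk (w : seq (oedge K)) := rev (map (@rev_edge R T K) w).

Lemma rev_walk_cons a w : rev_walk (a :: w) = rev_walk w ++ [:: rev_edge a].
Proof. by rewrite /rev_walk/= rev_cons cats1. Qed.

Lemma walk_rev x w y : walk x w y -> walk y (rev_walk w) x.
Proof.
elim: w x => [|a w IH] x /=; first by move=> ->.
move=> [<- /IH H]; rewrite rev_walk_cons; apply/walk_cat; exists (tgt a).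
by split=> //=; rewrite src_rev tgt_rev.
Qed.

(** Oriented edges dual to the same oriented hyperplane. *)
Definition same_side (a b : oedge K) := clos_refl_sym_trans _ (@oparallel R T K) a b.

Lemma same_side_refl a : same_side a a. Proof. exact: rst_refl. Qed.
Lemma same_side_sym a b : same_side a b -> same_side b a.
Proof. exact: rst_sym. Qed.
Lemma same_side_trans b a c : same_side a b -> same_side b c -> same_side a c.
Proof. exact: rst_trans. Qed.

Lemma same_side_rev a b : same_side a b -> same_side (rev_edge a) (rev_edge b).
Proof.
elim=> [x y xy|x|x y _ IH|x y z _ IH _ IH'].
- by apply: rst_step; exact: oparallel_rev.
- exact: rst_refl.
- exact: rst_sym.
- exact: rst_trans IH IH'.
Qed.

Hypothesis two_sidedK : forall a, ~ same_side a (rev_edge a).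

Section Crossing.
Variable a0 : oedge K.

(** The sign with which an oriented edge crosses the hyperplane oriented by [a0]. *)
Definition crossing_sign (a : oedge K) : int :=
  if `[< same_side a0 a >] then 1 else if `[< same_side a0 (rev_edge a) >] then -1 else 0.

Lemma crossing_sign_same a : same_side a0 a -> crossing_sign a = 1.
Proof. by move=> H; rewrite /crossing_sign asboolT. Qed.

Lemma crossing_sign_opp a : same_side a0 (rev_edge a) -> crossing_sign a = -1.
Proof.
move=> H; rewrite /crossing_sign; case: asboolP => [H'|_]; last by rewrite asboolT.
by exfalso; apply: (two_sidedK (a := a)); apply: same_side_trans H; exact: same_side_sym.
Qed.

Lemma crossing_sign_none a : ~ same_side a0 a -> ~ same_side a0 (rev_edge a) ->
  crossing_sign a = 0.
Proof. by move=> H H'; rewrite /crossing_sign !asboolF. Qed.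

Lemma crossing_sign_rev a : crossing_sign (rev_edge a) = - crossing_sign a.
Proof.
have [H|H] := pselect (same_side a0 a).
  by rewrite (crossing_sign_same H) crossing_sign_opp// rev_edgeK.
have [H'|H'] := pselect (same_side a0 (rev_edge a)).
  by rewrite (crossing_sign_opp H') crossing_sign_same// opprK.
by rewrite !crossing_sign_none ?oppr0// rev_edgeK.
Qed.

Lemma crossing_sign_eq a b : same_side a b -> crossing_sign a = crossing_sign b.
Proof.
move=> ab; have E c d : same_side c d -> same_side a0 c = same_side a0 d.
  move=> cd; apply/propext; split=> H; apply: same_side_trans H _ => //.
  exact: same_side_sym.
by rewrite /crossing_sign (E _ _ ab) (E _ _ (same_side_rev ab)).
Qed.

(** All corners are reached from the origin by flipping coordinates. *)
Lemma corner_flip_ind k (P : corner k -> Prop) : P [ffun=> false] ->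
  (forall e j, P e -> P (flip j e)) -> forall e, P e.
Proof.
move=> P0 PS e; have [n] := ubnP #|[set j | e j]%SET|.
elim: n => // n IH in e *; have [/existsP[j ej]|] := boolP [exists j, e j].
  rewrite (cardsD1 j) inE ej add1n ltnS => en; rewrite -(flipK j e); apply: PS.
  apply: IH; suff <- : ([set j | e j] :\ j)%SET = [set l | flip j e l]%SET by [].
  by apply/setP => l; rewrite !inE ffunE; case: eqP => [->|]; rewrite ?ej// addbF.
rewrite negb_exists => /forallP e0 _; suff -> : e = [ffun=> false] by [].
by apply/ffunP => j; rewrite ffunE; apply/negbTE.
Qed.

(** The sign with which the sides of [c] parallel to the direction [i] cross the
    hyperplane, when they are oriented by increasing coordinate. *)
Definition direction_sign k (c : cell K k) (i : 'I_k) : int :=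
  crossing_sign (projT1 (cid (corner_side_exists KC c [ffun=> false] i))).

Lemma crossing_sign_side k (c : cell K k) e i a : corner_side c e i a ->
  crossing_sign a = if e i then - direction_sign c i else direction_sign c i.
Proof.
elim/corner_flip_ind: e a => [|e j IH] a ca.
  rewrite ffunE /direction_sign; case: cid => b /= cb.
  by rewrite (corner_side_inj KC ca cb).
have [b cb] := corner_side_exists KC c e i.
have := IH _ cb; rewrite ffunE; have [ij|ij] := eqVneq i j.
  rewrite -ij in ca.
  have -> : a = rev_edge b by apply: (corner_side_inj KC ca); exact: corner_side_rev.
  by rewrite crossing_sign_rev addbT => ->; case: (e i) => //=; rewrite opprK.
rewrite addbF => <-; apply/esym/crossing_sign_eq/rst_step.
exact: (opposite_sides_parallel KC ij cb ca).
Qed.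

(** The sum of the coordinates in the directions dual to the hyperplane, counted with
    their signs. *)
Definition cell_height k (c : cell K k) (x : 'rV[R]_k) : R :=
  \sum_i (direction_sign c i)%:~R * x 0 i.

(** The heights on a cube and on one of its faces differ by an integer, since the
    isometry between the face and a cell permutes coordinates and reflects some of them. *)
Lemma cell_height_face k (c : cell K k.+1) j b : exists (d : cell K k) g,
  [/\ forall x, cube x -> cube (g x),
      forall x, cube x -> chi K c (cube_face j b x) = chi K d (g x) &
      exists m : int, forall x, cube x ->
        cell_height c (cube_face j b x) = cell_height d (g x) + m%:~R].
Proof.
have [d [g [s [r [gs gC cd dc]]]]] := face_cell KC c j b.
exists d, g; split=> // [x cx|]; first by rewrite -gC; exists x.
exists (direction_sign c j * b%:Z + \sum_i (direction_sign c (lift j i) * (r i)%:Z)) => x cx.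
rewrite /cell_height (bigD1_ord j)//= mxE unlift_none.
rewrite [X in _ = X + _](reindex_inj (@perm_inj _ s)) /=.
rewrite intrD rmorph_sum /= addrCA -big_split /=; congr (_ + _).
  by rewrite intrM.
apply: eq_bigr => i _; rewrite mxE liftK gs// intrM.
have [a da] := corner_side_exists KC d (symmetry_corner s r [ffun=> false]) (s i).
have := crossing_sign_side da; rewrite (crossing_sign_side (dc _ _ _ da)).
rewrite symmetry_cornerE !ffunE liftK ffunE /= => ->.
by case: (r i) => /=; rewrite ?mulrNz; lra.
Qed.

(** The cell whose open cube contains [t], with the coordinates of [t]. *)
Definition height_rep (t : T) := projT1 (cid (cube_complex_partition KC t)).

(** The map to the circle that wraps once around it when one crosses the
    hyperplane. *)
Definition height (t : T) : @circle R :=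
  to_circle (cell_height (projT2 (height_rep t)).1 (projT2 (height_rep t)).2).

Lemma heightE k (c : cell K k) x : cube x -> height (chi K c x) = to_circle (cell_height c x).
Proof.
have opn k' (c' : cell K k') x' : open_cube x' -> height (chi K c' x') = to_circle (cell_height c' x').
  move=> ox; rewrite /height /height_rep; case: cid => q [[oq Eq] _] /=.
  case: q oq Eq => l [d y] /= oy Ey.
  exact: (congr1 (fun q : {k & (cell K k * 'rV[R]_k)%type} =>
    to_circle (cell_height (projT2 q).1 (projT2 q).2)) (chi_inj KC oy ox Ey)).
elim: k => [|k IH] in c x *; first by move=> _; apply: opn => -[].
move=> /cube_open_or_face[ox|[j [b [y [cy ->]]]]]; first exact: opn.
have [d [g [gC cd [m cm]]]] := cell_height_face c j b.
by rewrite cd// IH ?cm ?to_circleD//; exact: gC.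
Qed.

Lemma cell_height_continuous k (c : cell K k) : continuous (cell_height c).
Proof.
rewrite /cell_height; apply: continuous_big => [|i _].
  by move=> x; apply: cvgD; [exact: cvg_fst|exact: cvg_snd].
rewrite (_ : (fun x => _) = fun x : 'rV[R]_k => (direction_sign c i)%:~R * x 0 i + 0).
  by apply: continuous_affine => x; exact: coord_continuous.
by apply/funext => x; rewrite addr0.
Qed.

(** For the weak topology, continuity is checked in each cell, where the height is
    affine modulo 1. *)
Lemma height_continuous : continuous height.
Proof.
apply/continuous_closedP => A cA; apply/(cube_complex_weak KC) => k c.
rewrite (_ : _ `&` _ = cube `&` (to_circle \o cell_height c) @^-1` A); last first.
  by apply/seteqP; split=> x /= [cx]; rewrite heightE.
apply: closedI; first exact: closed_cube.
apply: preimage_closed cA => x _; apply: continuous_comp.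
  exact: cell_height_continuous.
exact: to_circle_continuous.
Qed.

Lemma height_edge a t : `[0, 1]%classic t ->
  height (edge_map a t) = to_circle ((crossing_sign a)%:~R * t).
Proof.
move=> /inI t01; case: a => c o; rewrite /edge_map /= heightE; last first.
  by move=> i; rewrite mxE; case: o; lra.
have := crossing_sign_side (edge_corner_side c [ffun=> ~~ o] 0).
rewrite ffunE negbK => ->; rewrite /cell_height big_ord1 mxE.
case: o => //=; rewrite mulrBr mulr1 addrC to_circleD mulrNz; congr to_circle; lra.
Qed.

(** The height along an edge path lifts to the line, where its total variation is the
    algebraic number of crossings. *)
Lemma walk_height_lift w x y (k : int) : height x = to_circle k%:~R -> walk x w y ->
  exists2 v : R -> R, is_path (k%:~R : R) ((k + \sum_(a <- w) crossing_sign a)%:~R : R) v &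
    forall t, `[0, 1]%classic t -> to_circle (v t) = height (walk_path x w t).
Proof.
elim: w => [|a w IH] in x k *.
  by move=> hx /= _; rewrite big_nil addr0; exists (cst k%:~R) => //; exact: is_path_cst.
move=> hx /= [ax wy].
have [|v pv hv] := IH (tgt a) (k + crossing_sign a) _ wy.
  by rewrite /tgt height_edge ?mulr1 ?(addrC k) ?intrD ?to_circleD//; exact: I1.
exists (path_cat (fun t => (crossing_sign a)%:~R * t + k%:~R) v).
  apply: is_path_cat; last by rewrite big_cons addrA; exact: pv.
  split; [apply: continuous_subspaceT; exact: continuous_aff|lra|].
  by rewrite mulr1 intrD addrC.
apply: (path_cat_rel (P := fun r z => to_circle r = height z)) => // t It.
by rewrite height_edge// to_circleD.
Qed.

(** A closed edge path of a simply connected cube complex crosses each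
    hyperplane as often in both directions. *)
Theorem closed_walk_crossing x w : simply_connected R T -> walk x w x ->
  \sum_(a <- w) crossing_sign a = 0.
Proof.
move=> [_ _ sc]; case: w => [_|a w wx]; first by rewrite big_nil.
have := sc x (\pi_(pi1 R x) (Loop (walk_is_path wx)))%qT.
move=> /(pi1P _ (loop_cst x)).1 /(path_homotopic_comp height_continuous) hom.
have hx : height x = to_circle (0 : int)%:~R.
  by have [<- _] := wx; rewrite /src height_edge ?mulr0//; exact: I0.
have [v pv hv] := walk_height_lift hx wx.
have := homotopic_lift_end circle_covering hom pv (is_path_cst _) hv.
move=> /(_ (fun _ _ => esym hx)) /eqP; rewrite eqr_int add0r => /eqP; exact.
Qed.

End Crossing.

End Walks.

(** * Lifting edges and squares to a covering cube complex *)

Section CubicalCovering.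
Context {R : realType} {Y X : topologicalType}.
Context {L : cubulation R Y} {K : cubulation R X} {p : Y -> X}.
Hypotheses (LC : is_cube_complex L) (KC : is_cube_complex K).
Hypotheses (pcov : covering_map p) (pC : combinatorial L K p).

Local Notation I := (`[0%R, 1%R]%classic : set R).
Local Notation pe := (edge_image pC).

Lemma segment_path (T : topologicalType) (N : cubulation R T) k (c : cell N k) x y :
  is_cube_complex N -> cube x -> cube y ->
  is_path (chi N c x) (chi N c y) (fun t => chi N c (segment x y t)).
Proof.
move=> NC cx cy; split.
- apply: (within_comp (f := segment x y) _ (@chi_continuous _ _ _ NC _ c)).
    by apply: continuous_subspaceT; exact: segment_continuous.
  by move=> t /inI t01; exact: segment_cube.
- by congr (chi N c _); apply/rowP => i; rewrite mxE mulr0 add0r.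
- by congr (chi N c _); apply/rowP => i; rewrite mxE mulr1 subrK.
Qed.

Lemma symmetry_open_cube k (g : 'rV[R]_k -> 'rV[R]_k) s r x :
  cube_symmetry g s r -> open_cube x -> open_cube (g x).
Proof.
move=> gs ox l; rewrite -(permKV s l) gs; last exact: open_cubeW.
by have := ox ((s^-1)%g l); case: (r _); lra.
Qed.

(** A cell of the base lifts to a cell through any point of the fibre over one of
    its points: lift the segment from this point to the center of the cell. *)
Lemma lift_cell k (c : cell K k) x y : cube x -> p y = chi K c x ->
  exists (d : cell L k) (g : 'rV[R]_k -> 'rV[R]_k) s r,
  [/\ cube_symmetry g s r, g @` cube = cube,
      forall w, cube w -> p (chi L d w) = chi K c (g w) &
      forall z, cube z -> g z = x -> chi L d z = y].
Proof.
move=> cx pyx; have cc := open_cubeW (@cube_center_open R k).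
have [v pv vu] := path_lift pcov (segment_path c KC cx cc) pyx.
have [[k' [d z1]] [[/= oz1 dz1] _]] := cube_complex_partition LC (v 1).
have [d' [g [s [r [gs gC dd']]]]] := combinatorial_cell pC d.
have cz1 := open_cubeW oz1.
have E1 : chi K d' (g z1) = chi K c (cube_center k).
  rewrite -dd'// dz1 vu; last exact: I1.
  by congr (chi K c _); apply/rowP => i; rewrite mxE mulr1 subrK.
have E := chi_inj KC (symmetry_open_cube gs oz1) (@cube_center_open R k) E1.
have kk : k' = k by exact: (congr1 (@projT1 _ _) E).
subst k'; have [d'c gz1] := Eqdep_dec.inj_pair2_eq_dec _ PeanoNat.Nat.eq_dec _ _ _ _ E.
exists d, g, s, r; split=> // [w cw|z cz gz]; first by rewrite dd'// d'c.
have pw := segment_path d LC cz cz1.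
have vw : forall t, I t -> v t = chi L d (segment z z1 t).
  apply: (path_lift_unique pcov pv pw _ I1) => [t /inI t01|].
    rewrite vu; last exact/inI.
    rewrite dd'; last exact: segment_cube.
    by rewrite (symmetry_segment gs)// gz gz1 d'c.
  by case: pw => _ _ ->.
by case: pv => _ <- _; case: pw => _ <- _; rewrite vw//; exact: I0.
Qed.

Lemma symmetry_vertex_pt k (g : 'rV[R]_k -> 'rV[R]_k) s r e : cube_symmetry g s r ->
  g (vertex_pt e) = vertex_pt (symmetry_corner s r e).
Proof.
move=> gs; apply/rowP => l; rewrite -(permKV s l) gs ?mxE ?symmetry_cornerE; last exact: vertex_pt_cube.
by case: (r _); case: (e _) => /=; lra.
Qed.

Lemma lift_corner k (c : cell K k) (e : corner k) y : p y = chi K c (vertex_pt e) ->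
  exists (d : cell L k) (e' : corner k) (s : {perm 'I_k}),
  chi L d (vertex_pt e') = y /\
  forall i a, corner_side c e (s i) a -> exists2 b, corner_side d e' i b & pe b = a.
Proof.
move=> pye.
have [d [g [s [r [gs gC dc dy]]]]] := lift_cell (vertex_pt_cube e) pye.
have [e' ee'] := symmetry_corner_surj s r e.
exists d, e', s; split.
  by apply: dy; [exact: vertex_pt_cube|rewrite (symmetry_vertex_pt _ gs) ee'].
move=> i a ca; have [b db] := corner_side_exists LC d e' i; exists b => //.
apply: (edge_image_unique KC) => t /inI t01.
rewrite -db// dc; last exact: corner_edge_cube.
by rewrite (symmetry_corner_edge _ _ gs)// ee' ca.
Qed.

Lemma lift_edge (a : oedge K) y : p y = src a -> exists2 b : oedge L, src b = y & pe b = a.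
Proof.
case: a => f o pya.
have ca := edge_corner_side f [ffun=> ~~ o] 0; rewrite ffunE negbK in ca.
rewrite (corner_side_src ca) in pya.
have [d [e' [s [dy H]]]] := lift_corner pya.
have [|b db pb] := H 0 (f, o); first by rewrite (ord1 (s 0)).
by exists b => //; rewrite (corner_side_src db).
Qed.

(** A lift of an edge is determined by its origin. *)
Lemma lift_edge_unique (b b' : oedge L) : src b = src b' -> pe b = pe b' -> b = b'.
Proof.
move=> sbb pbb; apply: (edge_map_inj LC).
apply: (path_lift_unique pcov (edge_map_path LC b) (edge_map_path LC b') _ I0 sbb).
by move=> t It; rewrite !(edge_imageE pC)// pbb.
Qed.

Lemma lift_span_square (b b' : oedge L) : src b = src b' ->
  span_square (pe b) (pe b') -> span_square b b'.
Proof.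
move=> sbb [c [e [i [i' [ii' cb cb']]]]].
have py : p (src b) = chi K c (vertex_pt e) by rewrite -(src_edge_image pC) (corner_side_src cb).
have [d [e' [s [dy H]]]] := lift_corner py.
rewrite -(permKV s i) -(permKV s i') in cb cb'.
have [b1 db1 pb1] := H _ _ cb; have [b2 db2 pb2] := H _ _ cb'.
have b1E : b1 = b by apply: lift_edge_unique; rewrite ?(corner_side_src db1).
have b2E : b2 = b' by apply: lift_edge_unique; rewrite ?(corner_side_src db2) -?sbb.
exists d, e', ((s^-1)%g i), ((s^-1)%g i'); rewrite (inj_eq perm_inj).
by rewrite -b1E -b2E.
Qed.

Lemma lift_walk y W z : walk (p y) W z ->
  exists w z', [/\ walk y w z', map pe w = W & p z' = z].
Proof.
elim: W => [|a W IH] in y *; first by move=> <-; exists [::], y.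
move=> /= [ay Wz]; have [b by_ ba] := lift_edge (esym ay).
have [|w [z' [wz' <- pz']]] := IH (tgt b); first by rewrite -(tgt_edge_image pC) ba.
by exists (b :: w), z'; split=> //=; rewrite ba.
Qed.

Lemma walk_image y w z : walk y w z -> walk (p y) (map pe w) (p z).
Proof.
elim: w y => [|b w IH] y /=; first by move=> ->.
by move=> [<- /IH]; rewrite (src_edge_image pC) (tgt_edge_image pC).
Qed.

Lemma walk_path_image y w t : I t -> p (walk_path y w t) = walk_path (p y) (map pe w) t.
Proof.
elim: w y t => [//|b w IH] y t It /=.
apply: (path_cat_rel (P := fun u v => p u = v)) It => {}t It; first exact: edge_imageE.
by rewrite IH// (tgt_edge_image pC).
Qed.

Lemma same_side_image (b b' : oedge L) : same_side b b' -> same_side (pe b) (pe b').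
Proof.
elim=> [c d cd|c|c d _ IH|c d e _ IH _ IH'].
- by apply: rst_step; exact: edge_image_oparallel.
- exact: rst_refl.
- exact: rst_sym.
- exact: rst_trans IH IH'.
Qed.

End CubicalCovering.

(** * Hyperplanes of a special cube complex *)

Section Special.
Context {R : realType} {X : topologicalType} {K : cubulation R X}.
Hypothesis KS : special_cube_complex K.

Let KC := special_is_cube_complex KS.

(** The hyperplanes dual to two edges are transverse. *)
Definition crossing (a b : oedge K) := transverse (hyperplane a.1) (hyperplane b.1).

Lemma special_two_sidedP (a : oedge K) : ~ same_side a (rev_edge a).
Proof.
move=> H; apply: (special_two_sided KS (a := a)); apply/seteqP; split=> b /=.
  move=> ab; exists (rev_edge b); last exact: rev_edgeK.
  by apply: same_side_trans H _; exact: same_side_rev.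
by move=> [c ac <-]; apply: same_side_trans H _; exact: same_side_rev.
Qed.

Lemma hyperplane_eq (f f' : cell K 1) :
  clos_refl_sym_trans _ (@parallel R X K) f f' -> hyperplane f = hyperplane f'.
Proof.
move=> ff'; apply/seteqP; split=> h; apply: rst_trans => //.
exact: rst_sym.
Qed.

Lemma same_side_hyperplane (a b : oedge K) :
  same_side a b -> hyperplane a.1 = hyperplane b.1.
Proof.
move=> ab; apply: hyperplane_eq; elim: ab => [c d cd|c|c d _|c d e _ IH _].
- by apply: rst_step; exists c.2, d.2; rewrite -!surjective_pairing.
- exact: rst_refl.
- exact: rst_sym.
- exact: rst_trans.
Qed.

Lemma span_square_perpendicular (a b : oedge K) : span_square a b -> perpendicular a.1 b.1.
Proof.
move=> [c [e [i [i' [ii' ca cb]]]]]; exists c, e, e, i, i', a.2, b.2.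
by rewrite -!surjective_pairing.
Qed.

Lemma perpendicular_hyperplane (f f' : cell K 1) :
  perpendicular f f' -> hyperplane f <> hyperplane f'.
Proof.
move=> ff' E; apply: (special_self_intersecting KS (f := f)); exists f, f'.
by split=> //; [|rewrite E]; exact: rst_refl.
Qed.

Lemma span_square_crossing (a b : oedge K) : span_square a b -> crossing a b.
Proof.
move=> /span_square_perpendicular ab; split; first exact: perpendicular_hyperplane.
by exists a.1, b.1; split=> //; exact: rst_refl.
Qed.

Lemma crossing_span_square (a b : oedge K) :
  src a = src b -> crossing a b -> span_square a b.
Proof.
move=> sab ab; apply: contrapT => nab.
apply: (special_inter_osculating KS (f := a.1) (f' := b.1)); split=> //.
by exists a, b; split=> //; exact: rst_refl.
Qed.

(** An edge is determined by its origin and its oriented hyperplane. *)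
Lemma same_side_src_inj (a b : oedge K) : src a = src b -> same_side a b -> a = b.
Proof.
move=> sab ab; apply: contrapT => nab.
have [sq|nsq] := pselect (span_square a b).
  exact: perpendicular_hyperplane (span_square_perpendicular sq) (same_side_hyperplane ab).
apply: (special_self_osculating KS (a := a)); exists a, b; split=> //; last by left.
exact: rst_refl.
Qed.

Lemma crossing_hyperplane (a a' b b' : oedge K) : hyperplane a.1 = hyperplane a'.1 ->
  hyperplane b.1 = hyperplane b'.1 -> crossing a b -> crossing a' b'.
Proof. by rewrite /crossing => -> ->. Qed.

Lemma crossing_neq (a b : oedge K) : crossing a b -> ~ same_side a b.
Proof. by move=> [ab _] /same_side_hyperplane. Qed.

(** In the word [W], no letter is followed by one dual to the same hyperplane with the
    opposite orientation and separated from it only by letters whose hyperplanes are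
    transverse to this one. *)
Definition reduced (W : seq (oedge K)) := forall w1 a u b w2,
  W = w1 ++ a :: u ++ b :: w2 -> same_side (rev_edge a) b -> ~ List.Forall (crossing a) u.

Lemma reduced_infix w1 w w2 : reduced (w1 ++ w ++ w2) -> reduced w.
Proof.
move=> red v1 a u b v2 wE; apply: (red (w1 ++ v1) _ _ _ (v2 ++ w2)).
by rewrite wE -!catA /= -!catA.
Qed.

End Special.

Lemma Forall_split (A : Type) (P : A -> Prop) (u : seq A) :
  (forall u1 c u2, u = u1 ++ c :: u2 -> P c) -> List.Forall P u.
Proof.
elim: u => [|c u IH] H; first exact: List.Forall_nil.
apply: List.Forall_cons; first exact: (H [::] c u).
by apply: IH => u1 d u2 E; apply: (H (c :: u1) d u2); rewrite E.
Qed.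

Lemma sum_Forall0 (A : Type) (F : A -> int) (u : seq A) :
  List.Forall (fun c => F c = 0) u -> \sum_(c <- u) F c = 0.
Proof.
by elim=> [|c v Fc _ IH]; rewrite ?big_nil// big_cons Fc IH.
Qed.

(** * Edge paths in the universal cover *)

Section UniversalCover.
Context {R : realType} {X Y : topologicalType}.
Context {K : cubulation R X} {L : cubulation R Y} {p : Y -> X}.
Hypothesis KS : special_cube_complex K.
Hypothesis LK : universal_cover L K p.

Let KC := special_is_cube_complex KS.
Let LC := universal_cover_complex LK.
Let pcov := universal_cover_covering LK.
Let pC := universal_cover_combinatorial LK.
Local Notation pe := (edge_image pC).

Lemma cover_two_sided (b : oedge L) : ~ same_side b (rev_edge b).
Proof.
move=> /(same_side_image pC); rewrite (edge_image_rev KC).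
exact: special_two_sidedP.
Qed.

Lemma Forall_rev_walk (P P' : oedge L -> Prop) q : (forall g, P g -> P' (rev_edge g)) ->
  List.Forall P q -> List.Forall P' (rev_walk q).
Proof.
move=> PP'; elim=> [|g v Pg _ IH]; first exact: List.Forall_nil.
rewrite rev_walk_cons; apply/List.Forall_app; split=> //.
by apply: List.Forall_cons; [exact: PP'|exact: List.Forall_nil].
Qed.

(** Two edges dual to the same oriented hyperplane have their ends joined by a path
    in the boundary of the carrier, which crosses only transverse hyperplanes. *)
Lemma carrier_walk (b b' : oedge L) : same_side b b' -> exists q,
  walk (tgt b) q (tgt b') /\ List.Forall (fun g => crossing (pe b) (pe g)) q.
Proof.
elim=> [c c' cc'|c|c c' cc' [q [wq Fq]]|c c' c'' cc' [q [wq Fq]] _ [q' [wq' Fq']]].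
- have [d [e [i [j [ij dc dc']]]]] := oparallelP cc'.
  have [h dh] := corner_side_exists LC d (flip i e) j.
  exists [:: h]; split=> /=.
    rewrite (corner_side_src dh) (corner_side_tgt dh) (corner_side_tgt dc).
    rewrite (corner_side_tgt dc'); split=> //; congr (chi L d (vertex_pt _)).
    by apply/ffunP => l; rewrite !ffunE addbAC.
  apply: List.Forall_cons; last exact: List.Forall_nil.
  have /(edge_image_span_square pC)/(span_square_crossing KS) : span_square (rev_edge c) h.
    by exists d, (flip i e), i, j; split=> //; exact: corner_side_rev.
  by rewrite (edge_image_rev KC).
- by exists [::]; split=> //; exact: List.Forall_nil.
- exists (rev_walk q); split; first exact: walk_rev.
  have cc : hyperplane (pe c).1 = hyperplane (pe c').1.
    by apply: same_side_hyperplane; exact: (same_side_image pC).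
  apply: Forall_rev_walk Fq => g cg.
  by rewrite (edge_image_rev KC); exact: crossing_hyperplane cg.
- exists (q ++ q'); split; first by apply/walk_cat; exists (tgt c').
  apply/List.Forall_app; split=> //.
  have cc : hyperplane (pe c').1 = hyperplane (pe c).1.
    by apply/esym/same_side_hyperplane; exact: (same_side_image pC).
  by apply: List.Forall_impl Fq' => g; exact: crossing_hyperplane.
Qed.

Lemma crossing_not_same_side (a g : oedge L) : crossing (pe a) (pe g) ->
  ~ same_side a g /\ ~ same_side a (rev_edge g).
Proof.
move=> ag; split=> /(same_side_image pC); first exact: crossing_neq.
by rewrite (edge_image_rev KC); exact: crossing_neq.
Qed.

Lemma carrier_sum0 (a : oedge L) (q : seq (oedge L)) :
  List.Forall (fun g => crossing (pe a) (pe g)) q -> \sum_(g <- q) crossing_sign a g = 0.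
Proof.
move=> Fq; apply: sum_Forall0; apply: List.Forall_impl Fq => g ag.
by have [? ?] := crossing_not_same_side ag; exact: crossing_sign_none.
Qed.

(** A path with reduced image crosses each hyperplane at most once: if two of its
    edges are dual to the same hyperplane and are innermost with this property, then
    either the first one, the path between them and the carrier form a closed path
    crossing this hyperplane exactly once, or the hyperplanes crossed in between
    also cross the carrier. *)
Lemma reduced_crosses_once n a u b x y : (size u < n)%N ->
  walk x (a :: u ++ [:: b]) y -> reduced (map pe (a :: u ++ [:: b])) ->
  ~ same_side a b /\ ~ same_side a (rev_edge b : oedge L).
Proof.
elim: n => [//|n IH] in a u b x y *; rewrite ltnS => un wk red.
have infix w1 c v d w2 : a :: u ++ [:: b] = w1 ++ (c :: v ++ [:: d]) ++ w2 -> (size v < n)%N ->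
    ~ same_side c d /\ ~ same_side c (rev_edge d).
  move=> E vn; move: wk red; rewrite E.
  move=> /walk_cat[z [_ /walk_cat[z' [wz _]]]]; rewrite !map_cat => /reduced_infix.
  exact: IH vn wz.
have pre u1 c u2 : u = u1 ++ c :: u2 -> ~ same_side a c /\ ~ same_side a (rev_edge c).
  move=> uE; apply: (infix [::] a u1 c (u2 ++ [:: b])).
    by rewrite uE /= -!catA.
  by move: un; rewrite uE size_cat /=; lia.
have pair u1 c u2 d u3 : u = u1 ++ c :: u2 ++ d :: u3 -> ~ same_side c d /\ ~ same_side c (rev_edge d).
  move=> uE; apply: (infix (a :: u1) c u2 d (u3 ++ [:: b])).
    by rewrite uE /= -!catA /= -!catA.
  by move: un; rewrite uE !size_cat /= size_cat /=; lia.
(* an edge between [a] and [b] is the only one there to cross its hyperplane *)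
have sum1 u1 c u2 : u = u1 ++ c :: u2 -> \sum_(g <- u) crossing_sign c g = 1.
  move=> uE; rewrite uE big_cat big_cons /=.
  rewrite (crossing_sign_same (same_side_refl c)) !sum_Forall0 ?add0r ?addr0//.
    apply: Forall_split => u3 g u4 E.
    have [] := pair u1 c u3 g u4; first by rewrite uE E.
    exact: crossing_sign_none.
  apply: Forall_split => u3 g u4 E.
  have [|gc gc'] := pair u3 g u4 c u2; first by rewrite uE E -catA.
  apply: crossing_sign_none => H; first by apply: gc; exact: same_side_sym.
  by apply: gc'; apply/same_side_sym; rewrite -[g]rev_edgeK; exact: same_side_rev.
have suma : \sum_(g <- u) crossing_sign a g = 0.
  apply: sum_Forall0; apply: Forall_split => u1 g u2 /pre[].
  exact: crossing_sign_none.
have [ax /walk_cat[z [wu [bz _]]]] : src a = x /\ walk (tgt a) (u ++ [:: b]) y := wk.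
have sc := universal_cover_simply_connected LK.
have closed0 := closed_walk_crossing LC cover_two_sided.
split=> ab.
  have [q [wq Fq]] := carrier_walk (same_side_rev (same_side_sym ab)).
  rewrite !tgt_rev in wq.
  have : walk x (a :: u ++ q) x.
    by split=> //; apply/walk_cat; exists z; split=> //; rewrite -bz -[in X in walk _ _ X]ax.
  move=> /(closed0 a _ _ sc); rewrite big_cons big_cat /= suma.
  rewrite (crossing_sign_same (same_side_refl a)) carrier_sum0//.
  apply: List.Forall_impl Fq => g; rewrite (edge_image_rev KC).
  apply: crossing_hyperplane => //=.
  by apply/esym/same_side_hyperplane; exact: (same_side_image pC).
have [q [wq Fq]] := carrier_walk ab; rewrite tgt_rev bz in wq.
have uq : walk (tgt a) (u ++ rev_walk q) (tgt a).
  by apply/walk_cat; exists z; split=> //; exact: walk_rev.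
apply: (red [::] (pe a) (map pe u) (pe b) [::]).
- by rewrite map_cons map_cat.
- rewrite -(edge_image_rev KC); apply: (same_side_image pC).
  by rewrite -[b]rev_edgeK; exact: same_side_rev.
apply/List.Forall_map/Forall_split => u1 c u2 uE.
apply: contrapT => nac.
have : \sum_(g <- u ++ rev_walk q) crossing_sign c g = 0 by exact: closed0 sc uq.
rewrite big_cat (sum1 _ _ _ uE) /= sum_Forall0//.
apply: Forall_rev_walk Fq => g ag.
have cpe d : same_side c d -> hyperplane (pe d).1 = hyperplane (pe c).1.
  by move=> cd; apply/esym/same_side_hyperplane; exact: (same_side_image pC).
apply: crossing_sign_none => [/cpe|]; last rewrite rev_edgeK => /cpe; move=> E; apply: nac;
  apply: crossing_hyperplane ag => //.
by rewrite -E (edge_image_rev KC).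
Qed.

(** A closed edge path with reduced image is trivial. *)
Theorem reduced_closed_nil x w : walk x w x -> reduced (map pe w) -> w = [::].
Proof.
case: w => [//|a w] wk red.
have /eqP := closed_walk_crossing LC cover_two_sided a (universal_cover_simply_connected LK) wk.
rewrite big_cons (crossing_sign_same (same_side_refl a)) sum_Forall0//.
apply: Forall_split => u g v E; move: wk red; rewrite E.
rewrite (_ : a :: u ++ g :: v = (a :: u ++ [:: g]) ++ v); last by rewrite /= -catA.
move=> /walk_cat[z [wz _]]; rewrite map_cat => /(@reduced_infix _ _ _ [::]) red.
have [] := reduced_crosses_once (ltnSn _) wz red.
exact: crossing_sign_none.
Qed.

(** An edge can be pushed along a path crossing transverse hyperplanes. *)
Lemma push_edge (a : oedge L) u x z : walk x (a :: u) z ->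
  List.Forall (fun g => crossing (pe a) (pe g)) u ->
  exists u' a', [/\ size u' = size u, walk x (u' ++ [:: a']) z & same_side a a'].
Proof.
elim: u => [|g u IH] in a x *.
  by move=> wk _; exists [::], a; split=> //; exact: same_side_refl.
move=> [ax [ga wk]] /List.Forall_cons_iff[ag Fu].
have sq : span_square (rev_edge a) g.
  apply: (lift_span_square LC KC pcov); first by rewrite src_rev.
  apply: (crossing_span_square KS).
    by rewrite !(src_edge_image pC) src_rev ga.
  by rewrite (edge_image_rev KC); exact: crossing_hyperplane ag.
have [a1 [g1 [aa1 gg1 sa1 sg1 t1]]] := span_square_complete LC sq.
have ss : same_side a (rev_edge a1).
  by rewrite -[a]rev_edgeK; apply/same_side_rev/rst_step.
have [||u' [a' [su' wu' aa']]] := IH (rev_edge a1) (src (rev_edge a1)).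
- by split=> //; rewrite tgt_rev sa1.
- apply: List.Forall_impl Fu => h; apply: crossing_hyperplane => //.
  by apply: same_side_hyperplane; exact: (same_side_image pC).
exists (g1 :: u'), a'; split=> /=; first by rewrite su'.
  rewrite sg1 tgt_rev -t1 -src_rev; split=> //.
exact: same_side_trans ss aa'.
Qed.

(** Two inverse letters which are separated by commuting letters only can be
    cancelled, so that the path is not a geodesic. *)
Theorem shorten_walk (a b : oedge L) u x y : walk x (a :: u ++ [:: b]) y ->
  same_side (rev_edge (pe a)) (pe b) -> List.Forall (fun g => crossing (pe a) (pe g)) u ->
  exists2 w : seq (oedge L), walk x w y & size w = size u.
Proof.
move=> /(walk_cat _ (a :: u))[z [wz [bz <-]]] ab Fu.
have [u' [a' [su' /walk_cat[z' [wz' [az' tz']]] aa']]] := push_edge wz Fu.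
exists u' => //; suff : rev_edge a' = b by move=> <-; rewrite tgt_rev az'.
apply: (lift_edge_unique LC pcov (pC := pC)); first by rewrite src_rev bz; exact: tz'.
apply: (same_side_src_inj KS).
  by rewrite !(src_edge_image pC) src_rev bz -tz'.
rewrite (edge_image_rev KC); apply: same_side_trans ab.
by apply/same_side_rev/same_side_sym; exact: (same_side_image pC).
Qed.

End UniversalCover.

(** * A compact cube complex has finitely many edges *)

Section Finiteness.
Context {R : realType} {X : topologicalType} {K : cubulation R X}.
Hypothesis KC : is_cube_complex K.

(** A set all of whose subsets are closed has no accumulation point. *)
Lemma compact_discrete_finite (T : topologicalType) (A : set T) :
  compact [set: T] -> (forall B, B `<=` A -> closed B) -> finite_set A.
Proof.
move=> cT cA; apply: contrapT => infA.
(* the filter generated by the complements in A of finite sets *)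
pose F : set_system T := [set B | finite_set (A `\` B)].
have FF : Filter F.
  split.
  - by rewrite /F/= setDT; exact: finite_set0.
  - by move=> B C; rewrite /F/= setDIr => fB fC; rewrite finite_setU.
  - by move=> B C BC; rewrite /F/=; apply: sub_finite_set => x [Ax Cx]; split=> // /BC.
have PF : ProperFilter F.
  split=> //; rewrite /F/= => H; apply: infA.
  by rewrite setD0 in H.
have [|x [_ Fx]] := cT F PF; first by rewrite /F/= setDT; exact: finite_set0.
have cB : closed (A `\ x) by apply: cA => y [].
have : (A `\ x) x; last by move=> [_]; apply.
apply: cB => U Ux; have := Fx (A `\ x) U _ Ux; rewrite setIC; apply.
apply: sub_finite_set (finite_set1 x) => y [Ay nAy].
by apply: contrapT => yx; apply: nAy.
Qed.

Lemma finite_closed_rV k (A : set 'rV[R]_k) : finite_set A -> closed A.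
Proof.
move=> fA; apply: (accessible_finite_set_closed.1 _) => //.
by apply: hausdorff_accessible; exact: norm_hausdorff.
Qed.

Definition edge_midpoints (S : set (cell K 1)) : set X :=
  [set chi K c (cube_center 1) | c in S].

(** A cube contains only finitely many midpoints of edges: its center if it is an edge,
    and those in its faces, by induction on the dimension. *)
Lemma midpoints_in_cell_finite S k (c : cell K k) :
  finite_set (cube `&` chi K c @^-1` (edge_midpoints S)).
Proof.
have opn k' (c' : cell K k') x : open_cube x -> edge_midpoints S (chi K c' x) -> x = cube_center k'.
  move=> ox [d Sd E]; have := chi_inj KC (@cube_center_open R 1) ox E => {}E.
  have : (projT2 (existT (fun k => (cell K k * 'rV[R]_k)%type) _ (d, cube_center 1))).2 =
    cube_center (projT1 (existT (fun k => (cell K k * 'rV[R]_k)%type) _ (d, cube_center 1))) by [].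
  by rewrite E.
elim: k => [|k IH] in c *.
  apply: sub_finite_set (finite_set1 0) => x _.
  by apply/rowP => -[].
have fin j b : finite_set [set x | exists y, [/\ cube y, x = cube_face j b y & edge_midpoints S (chi K c x)]].
  have [d [g [s [r [gs gC cd _]]]]] := face_cell KC c j b.
  apply: (sub_finite_set _ (finite_image (fun w : 'rV[R]_k => cube_face j b
    (\row_i (if r i then 1 - w 0 (s i) else w 0 (s i)))) (IH d))) => x [y [cy -> My]].
  exists (g y); first by split; [rewrite -gC; exists y|rewrite /= -cd].
  congr cube_face; apply/rowP => i; rewrite mxE gs//.
  by case: (r i); rewrite ?subKr.
pose Fc (jb : 'I_k.+1 * bool) := [set x | exists y,
  [/\ cube y, x = cube_face jb.1 jb.2 y & edge_midpoints S (chi K c x)]].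
apply: (@sub_finite_set _ _ ([set cube_center k.+1] `|` \bigcup_(jb in [set: ('I_k.+1 * bool)%type]) Fc jb)).
  move=> x [/cube_open_or_face[ox|[j [b [y [cy xE]]]]] Mx]; first by left; exact: opn Mx.
  by right; exists (j, b) => //; exists y; rewrite /= -xE.
rewrite finite_setU; split; first exact: finite_set1.
by apply: bigcup_finite => // -[j b] _; exact: fin.
Qed.

Lemma finite_edges : compact [set: X] ->
  exists (N : nat) (code : cell K 1 -> 'I_N), injective code.
Proof.
move=> cX; have fM : finite_set (edge_midpoints setT).
  apply: compact_discrete_finite cX _ => B BM.
  have -> : B = edge_midpoints [set c | B (chi K c (cube_center 1))].
    apply/seteqP; split=> [x Bx|_ [c Bc <-]//].
    by have [c _ cx] := BM _ Bx; exists c => //=; rewrite cx.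
  apply/(cube_complex_weak KC) => k c; apply: finite_closed_rV.
  exact: midpoints_in_cell_finite.
have [s sE] := (finite_seqP _).1 fM.
have mem_s c : chi K c (cube_center 1) \in s.
  by have : edge_midpoints setT (chi K c (cube_center 1)) by [exists c]; rewrite sE.
exists (size s), (fun c => Ordinal (etrans (index_mem _ _) (mem_s c))) => c d [E].
have /(chi_inj_eq KC)[] // : chi K c (cube_center 1) = chi K d (cube_center 1);
  try exact: cube_center_open.
by rewrite -(nth_index (chi K c (cube_center 1)) (mem_s c)) E nth_index.
Qed.

End Finiteness.

(** * Periodic words *)

Lemma pigeonhole (F : finType) (f : nat -> F) : exists a b, (a < b)%N /\ f a = f b.
Proof.
have : ~~ injectiveb [ffun i : 'I_#|F|.+1 => f i].
  by apply/negP => /injectiveP /leq_card; rewrite card_ord ltnn.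
move=> /injectivePn[i [j ij]]; rewrite !ffunE => fij.
have [lt|gt|/val_inj/eqP] := ltngtP i j; last by rewrite (negbTE ij).
  by exists i, j.
by exists j, i.
Qed.

Lemma Forall_nth (A : Type) (P : A -> Prop) (d : A) u k :
  List.Forall P u -> (k < size u)%N -> P (nth d u k).
Proof.
move=> Fu; elim: Fu k => [//|c v Pc _ IH] [|k] //=.
exact: IH.
Qed.

Lemma cat_split (A : Type) (s1 s2 t1 t2 : seq A) : s1 ++ s2 = t1 ++ t2 ->
  (exists2 l, s1 = t1 ++ l & t2 = l ++ s2) \/ (exists2 l, t1 = s1 ++ l & s2 = l ++ t2).
Proof.
elim: s1 t1 => [|x s1 IH] [|y t1] /= E.
- by left; exists [::].
- by right; exists (y :: t1).
- by left; exists (x :: s1).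
- case: E => <- /IH[[l -> ->]|[l -> ->]]; first by left; exists l.
  by right; exists l.
Qed.

Section Words.
Context {R : realType} {X : topologicalType} {K : cubulation R X}.
Hypothesis KS : special_cube_complex K.

(** The version of [reduced] for infinite words. *)
Definition reduced_seq (M : nat -> oedge K) := forall i j, (i < j)%N ->
  same_side (rev_edge (M i)) (M j) ->
  ~ forall k, (i < k)%N -> (k < j)%N -> crossing (M i) (M k).

Lemma reduced_mkseq M n : reduced_seq M -> reduced (mkseq M n).
Proof.
move=> red w1 a u b w2 E ab Fu.
have sz : n = (size w1 + (size u + (size w2).+1).+1)%N.
  by rewrite -(size_mkseq M n) E size_cat /= size_cat.
have nthE k : (k < n)%N -> M k = nth a (w1 ++ a :: u ++ b :: w2) k.
  by move=> kn; rewrite -E nth_mkseq.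
have aE : M (size w1) = a.
  by rewrite nthE ?nth_cat ?ltnn ?subnn//; lia.
have bE : M (size w1 + (size u).+1)%N = b.
  rewrite nthE; last lia.
  by rewrite nth_cat ltnNge leq_addr /= addKn /= nth_cat ltnn subnn.
apply: (red (size w1) (size w1 + (size u).+1)%N); rewrite ?aE ?bE//; first lia.
move=> k k1 k2; rewrite nthE; last lia.
rewrite nth_cat ltnNge (ltnW k1) /=.
have -> : (k - size w1 = (k - size w1).-1.+1)%N by lia.
rewrite /= nth_cat; case: ltnP => H; last lia.
exact: Forall_nth.
Qed.

Lemma reduced_nil : reduced ([::] : seq (oedge K)).
Proof. by case. Qed.

Lemma rev_walk_cat (w w' : seq (oedge K)) : rev_walk (w ++ w') = rev_walk w' ++ rev_walk w.
Proof. by rewrite /rev_walk map_cat rev_cat. Qed.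

Lemma rev_walkK : involutive (@rev_walk R X K).
Proof.
by move=> w; rewrite /rev_walk map_rev revK mapK//; exact: rev_edgeK.
Qed.

(** The inverse of a reduced word is reduced. *)
Lemma reduced_rev (w : seq (oedge K)) : reduced w -> reduced (rev_walk w).
Proof.
move=> red w1 a u b w2 E ab Fu.
have ba : hyperplane b.1 = hyperplane a.1.
  exact: esym (same_side_hyperplane ab).
apply: (red (rev_walk w2) (rev_edge b) (rev_walk u) (rev_edge a) (rev_walk w1)).
- rewrite -[w]rev_walkK E !rev_walk_cat rev_walk_cons rev_walk_cat rev_walk_cons.
  by rewrite -!catA.
- by rewrite rev_edgeK; exact: same_side_sym.
apply: Forall_rev_walk Fu => g; exact: crossing_hyperplane.
Qed.

Lemma reduced_cat (w w' : seq (oedge K)) : reduced w -> reduced w' ->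
  List.Forall (fun a => List.Forall (crossing a) w') w -> reduced (w ++ w').
Proof.
move=> red red' ww' w1 a u b w2 E ab.
have nab v1 v2 v3 v4 : w = v1 ++ a :: v2 -> w' = v3 ++ b :: v4 -> False.
  move=> wE w'E; move: ww'; rewrite wE w'E.
  move=> /List.Forall_app[_ /List.Forall_cons_iff[/List.Forall_app[_ /List.Forall_cons_iff[]]]].
  by move=> [ne _] _ _; apply: ne; rewrite -(same_side_hyperplane ab).
case: (cat_split E) => [[[|a' l] wE]|[l _ w'E]]; last exact: red' w'E ab.
  by move=> /= /esym w'E; exact: (red' [::] _ _ _ _ w'E ab).
move=> [aE] /cat_split[[m uE w'E]|[[|b' m] lE]].
- by exfalso; move: wE w'E; rewrite -aE; exact: nab.
- by move=> /= /esym w'E; exfalso; apply: (nab _ _ [::] _ _ w'E); rewrite wE -aE.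
- by move=> [bE _]; apply: (red w1 _ _ _ m _ ab); rewrite wE -aE lE -bE.
Qed.

Lemma reduced_flatten (I : eqType) (B : I -> seq (oedge K)) (s : seq I) : uniq s ->
  (forall i, reduced (B i)) ->
  (forall i j, i != j -> List.Forall (fun a => List.Forall (crossing a) (B j)) (B i)) ->
  reduced (flatten (map B s)).
Proof.
move=> us redB crB; elim: s us => [_|i s IH] /=; first exact: reduced_nil.
move=> /andP[is_ us]; apply: reduced_cat; [exact: redB|exact: IH|].
elim: s is_ {us IH} => [_|j s IH] /=.
  by apply/List.Forall_forall => a _; exact: List.Forall_nil.
rewrite inE negb_or => /andP[ij /IH H]; move: (crB _ _ ij) H.
elim: (B i) => [|a w IHw]; first by move=> *; exact: List.Forall_nil.
move=> /List.Forall_cons_iff[aj wj] /List.Forall_cons_iff[as_ ws].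
apply: List.Forall_cons; last exact: IHw.
by apply/List.Forall_app.
Qed.

(** From a reduced infinite word on finitely many edges one extracts a segment all of
    whose powers are reduced: by the pigeonhole principle, two positions [a < b] carry the same letter
    and see the same set of letters as reachable by commutations. *)
Lemma periodic_reduced (N : nat) (code : cell K 1 -> 'I_N) (M : nat -> oedge K) :
  injective code -> reduced_seq M ->
  exists a b, [/\ (a < b)%N, M a = M b &
    reduced_seq (fun k => M (a + k %% (b - a))%N)].
Proof.
move=> codeI red.
(* a letter on the same side as [c] can be brought to the position [m] by commutations *)
pose reach m (c : oedge K) := exists k, same_side (M (m + k)%N) c /\
  forall k', (k' < k)%N -> crossing c (M (m + k')%N).
pose enc (c : oedge K) := (code c.1, c.2).
have encI : injective enc by move=> [f o] [f' o'] [/codeI/= -> ->].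
pose state m := (enc (M m), [ffun q => `[< exists2 c, enc c = q & reach m c >]]).
have [a [b [ab sab]]] := pigeonhole state.
have Mab : M a = M b by apply: encI; exact: (congr1 fst sab).
have /ffunP rab := congr1 snd sab.
have reach_ab c : reach a c -> reach b c.
  move=> rc; have E := rab (enc c); rewrite /= !ffunE in E.
  have : `[< exists2 d, enc d = enc c & reach b d >] by rewrite -E; apply/asboolP; exists c.
  by move=> /asboolP[d /encI ->].
exists a, b; split=> //; move: rab => _.
set l := (b - a)%N; set P := fun k : nat => M (a + k %% l)%N.
have l0 : (0 < l)%N by rewrite subn_gt0.
have Pper k q : P (q * l + k)%N = P k by rewrite /P modnMDl.
suff H i j : (i < l)%N -> (i < j)%N -> same_side (rev_edge (P i)) (P j) ->
    ~ forall k, (i < k)%N -> (k < j)%N -> crossing (P i) (P k).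
  move=> i j ij Pij Pk; have iE := divn_eq i l; have il := ltn_pmod i l0.
  have jE : j = (i %/ l * l + (j - i %/ l * l))%N by rewrite subnKC//; lia.
  apply: (H (i %% l)%N (j - i %/ l * l)%N il); first lia.
    by move: Pij; rewrite {1}iE {1}jE !Pper.
  have Pi : P (i %% l)%N = P i by rewrite [in RHS]iE Pper.
  by move=> k k1 k2; rewrite Pi -(Pper k (i %/ l)%N); apply: Pk; lia.
move=> il ij Pij Pk.
have Pl : P (i + l)%N = P i by rewrite addnC -{1}[l]mul1n Pper.
have jl : (j < i + l)%N.
  rewrite ltnNge; apply/negP; rewrite leq_eqVlt => /orP[/eqP E|lt].
    by move: Pij; rewrite -E Pl => /same_side_sym; exact: (special_two_sidedP KS).
  have ilk : (i < i + l)%N by lia.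
  have := Pk _ ilk lt; rewrite Pl => /crossing_neq; apply.
  exact: same_side_refl.
have PE k : (k < l)%N -> P k = M (a + k)%N by move=> kl; rewrite /P modn_small.
have PE2 k : (k < l)%N -> P (l + k)%N = M (a + k)%N.
  by move=> kl; rewrite -{1}[l]mul1n Pper PE.
have hP : hyperplane (P i).1 = hyperplane (P j).1 by exact: same_side_hyperplane Pij.
(* the pair of inverse letters lies in one period, or else straddles two *)
have [jl'|jl'] := ltnP j l.
  apply: (red (a + i)%N (a + j)%N); [lia|by rewrite -!PE|].
  move=> k k1 k2; have -> : k = (a + (k - a))%N by lia.
  by rewrite -!PE; [apply: Pk| |]; lia.
have jE : j = (l + (j - l))%N by lia.
have jll : (j - l < l)%N by lia.
have [k [bk Hk]] : reach b (P j).
  apply: reach_ab; exists (j - l)%N; split.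
    by rewrite -PE2// -jE; exact: same_side_refl.
  move=> k' k'j; have := Pk (l + k')%N; rewrite PE2; last lia.
  by move=> Hk'; apply: crossing_hyperplane (Hk' _ _) => //; lia.
apply: (red (a + i)%N (b + k)%N); first lia.
  by rewrite -PE//; apply: same_side_trans Pij _; exact: same_side_sym.
move=> m m1 m2; rewrite -PE//; have [mb|mb] := ltnP m b.
  have -> : m = (a + (m - a))%N by lia.
  by rewrite -PE; [apply: Pk|]; lia.
have -> : m = (b + (m - b))%N by lia.
by apply: (crossing_hyperplane _ _ (Hk (m - b)%N _)) => //; lia.
Qed.

End Words.

(** * Homotopies of edge paths *)

Section ConvexHomotopy.
Context {R : realType} {T : topologicalType} {K : cubulation R T}.
Hypothesis KC : is_cube_complex K.
Local Notation I := (`[0%R, 1%R]%classic : set R).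

Lemma within_coord (k : nat) (A : set R) (u : R -> 'rV[R]_k) i :
  {within A, continuous u} -> {within A, continuous (fun t => u t 0 i)}.
Proof.
move=> cu; apply: (within_comp (B := setT) (g := fun z : 'rV[R]_k => z 0 i) cu) => //.
by apply: continuous_subspaceT => z; exact: coord_continuous.
Qed.

(** Two paths with the same ends in a cube are homotopic. *)
Lemma cube_path_homotopic k (c : cell K k) x y (u v : R -> 'rV[R]_k) :
  is_path x y u -> is_path x y v -> (forall t, I t -> cube (u t)) ->
  (forall t, I t -> cube (v t)) ->
  path_homotopic (chi K c x) (chi K c y) (chi K c \o u) (chi K c \o v).
Proof.
move=> [cu u0 u1] [cv v0 v1] Cu Cv.
exists (chi K c \o (fun z => segment (u z.1) (v z.1) z.2)); split.
- apply: (within_comp (f := fun z : R * R => segment (u z.1) (v z.1) z.2) _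
    (@chi_continuous _ _ _ KC _ c)).
    have c1 (w : R -> 'rV[R]_k) i : {within I, continuous w} ->
        {within I `*` I, continuous (fun z : R * R => w z.1 0 i)}.
      move=> cw; apply: (within_comp (f := fst) _ (within_coord (i := i) cw)); last by move=> z [].
      by apply: continuous_subspaceT => z; exact: cvg_fst.
    apply: rV_continuous => i z.
    rewrite (_ : (fun z => _) = fun z : R * R => (v z.1 0 i - u z.1 0 i) * z.2 + u z.1 0 i); last first.
      by apply/funext => w; rewrite mxE.
    apply: cvgD; last exact: c1.
    apply: cvgM; first by apply: cvgB; exact: c1.
    by apply: continuous_subspaceT => w; exact: cvg_snd.
  by move=> z [/= z1 /inI z2]; apply: segment_cube => //; [exact: Cu|exact: Cv].
- move=> t It /=; split; congr (chi K c _); apply/rowP => i; rewrite mxE.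
    by rewrite mulr0 add0r.
  by rewrite mulr1 subrK.
- move=> s Is /=; rewrite u0 u1 v0 v1; split; congr (chi K c _); apply/rowP => i; rewrite mxE;
  by rewrite subrr mul0r add0r.
Qed.

Lemma corner_edge_path k (e : corner k) i :
  is_path (vertex_pt e : 'rV[R]_k) (vertex_pt (flip i e)) (corner_edge e i).
Proof.
split.
- apply: continuous_subspaceT; apply: rV_continuous => j.
  rewrite (_ : (fun u => _) = fun t => (if j == i then (if e j then -1 else 1) else 0) * t + (e j)%:R).
    exact: continuous_aff.
  by apply/funext => t; rewrite mxE; case: (j == i); case: (e j) => /=; lra.
- by apply/rowP => j; rewrite !mxE; case: (j == i); case: (e j) => /=; lra.
- by apply/rowP => j; rewrite !mxE ffunE; case: (j == i); case: (e j) => /=; lra.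
Qed.

End ConvexHomotopy.

Section WalkHomotopy.
Context {R : realType} {T : topologicalType} {K : cubulation R T}.
Hypothesis KC : is_cube_complex K.
Local Notation I := (`[0%R, 1%R]%classic : set R).

Lemma path_homotopic_eq (x y : T) (u v : R -> T) : is_path x y u ->
  (forall t, I t -> u t = v t) -> path_homotopic x y u v.
Proof.
move=> pu uv; have [cu u0 u1] := pu.
apply: (@path_homotopic_reparam _ _ x y x y u v u id id pu) => //.
- exact: continuous_Rid.
- exact: continuous_Rid.
- by move=> t It; rewrite uv.
Qed.

Lemma walk_path_cat x z y w w' : walk x w z -> walk z w' y ->
  path_homotopic x y (walk_path x (w ++ w')) (path_cat (walk_path x w) (@walk_path _ _ K z w')).
Proof.
elim: w x => [|a w IH] x /=.
  move=> -> wy; apply/path_homotopic_sym/path_cat1p; exact: walk_is_path.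
move=> [<- wz] wy; have pa := edge_map_path KC a.
apply: path_homotopic_trans (path_catA pa (walk_is_path KC wz) (walk_is_path KC wy)).
by apply: path_homotopic_cat; [exact: path_homotopic_refl pa|exact: IH].
Qed.

(** Edge paths with the same ends which are homotopic. *)
Definition walk_eq x y (w w' : seq (oedge K)) :=
  [/\ walk x w y, walk x w' y & path_homotopic x y (walk_path x w) (walk_path x w')].

Lemma walk_eq_refl x y w : walk x w y -> walk_eq x y w w.
Proof. by move=> wy; split=> //; apply: path_homotopic_refl; exact: walk_is_path wy. Qed.

Lemma walk_eq_trans x y w w' w'' : walk_eq x y w w' -> walk_eq x y w' w'' -> walk_eq x y w w''.
Proof. by move=> [? ? H] [? ? H']; split=> //; exact: path_homotopic_trans H H'. Qed.

Lemma walk_eq_cat x y z w w' v v' : walk_eq x y w w' -> walk_eq y z v v' ->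
  walk_eq x z (w ++ v) (w' ++ v').
Proof.
move=> [w1 w2 ww] [v1 v2 vv]; split; try by apply/walk_cat; exists y.
apply: path_homotopic_trans (walk_path_cat w1 v1) _.
apply: path_homotopic_trans (path_homotopic_cat ww vv) _.
exact: path_homotopic_sym (walk_path_cat w2 v2).
Qed.

Lemma walk_eq_rev x y w : walk x w y -> walk_eq x x (w ++ rev_walk w) [::].
Proof.
elim: w x => [|a w IH] x /=; first by move=> _; exact: walk_eq_refl.
move=> [ax wy]; rewrite rev_walk_cons.
have a1 : walk x [:: a] (tgt a) by [].
have a2 : walk (tgt a) [:: rev_edge a] x by split; [exact: src_rev|rewrite /= tgt_rev].
apply: (@walk_eq_trans _ _ _ ([:: a] ++ ([::] ++ [:: rev_edge a]))).
  rewrite (_ : a :: _ = [:: a] ++ ((w ++ rev_walk w) ++ [:: rev_edge a])) /=; last by rewrite catA.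
  by apply: (walk_eq_cat (walk_eq_refl a1)); apply: walk_eq_cat (IH _ wy) (walk_eq_refl a2).
split; [by split; [exact: ax|exact: a2]|by []|rewrite /=].
have pa := edge_map_path KC a; rewrite ax in pa.
have pr := is_path_rev pa.
apply: path_homotopic_trans (path_catpV pa).
apply: path_homotopic_cat; first exact: path_homotopic_refl pa.
have -> : edge_map (rev_edge a) = path_rev (edge_map a).
  by apply/funext => t; rewrite edge_map_rev.
by rewrite tgt_rev ax; exact: path_catp1.
Qed.

(** The two ways around a square. *)
Lemma square_walk_eq (a b a' b' : oedge K) (c : cell K 2) e i i' : i != i' ->
  corner_side c e i a -> corner_side c e i' b ->
  corner_side c (flip i' e) i a' -> corner_side c (flip i e) i' b' ->
  walk_eq (src a) (tgt a') [:: a; b'] [:: b; a'].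
Proof.
move=> ii' ca cb ca' cb'.
have eC : flip i' (flip i e) = flip i (flip i' e) by apply/ffunP => l; rewrite !ffunE addbAC.
have tt : tgt b' = tgt a' by rewrite (corner_side_tgt ca') (corner_side_tgt cb') eC.
have w1 : walk (src a) [:: a; b'] (tgt a').
  by split=> //; split=> //; rewrite (corner_side_src cb') (corner_side_tgt ca).
have w2 : walk (src a) [:: b; a'] (tgt a').
  split; first by rewrite (corner_side_src ca) (corner_side_src cb).
  by split=> //; rewrite (corner_side_src ca') (corner_side_tgt cb).
split=> //.
pose g1 := path_cat (corner_edge e i) (corner_edge (flip i e) i' : R -> 'rV[R]_2).
pose g2 := path_cat (corner_edge e i') (corner_edge (flip i' e) i : R -> 'rV[R]_2).
have p1 : is_path (vertex_pt e : 'rV[R]_2) (vertex_pt (flip i (flip i' e))) g1.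
  by rewrite -eC; exact: is_path_cat (corner_edge_path _ _) (corner_edge_path _ _).
have p2 : is_path (vertex_pt e : 'rV[R]_2) (vertex_pt (flip i (flip i' e))) g2.
  exact: is_path_cat (corner_edge_path _ _) (corner_edge_path _ _).
have cub (e1 e2 : corner 2) i1 i2 t : I t ->
    cube (path_cat (corner_edge e1 i1) (corner_edge e2 i2 : R -> 'rV[R]_2) t).
  by move=> /inI t01; rewrite /path_cat; case: leP => ?; apply: corner_edge_cube; lra.
have := cube_path_homotopic KC c p1 p2 (cub _ _ _ _) (cub _ _ _ _).
rewrite -(corner_side_src ca) -(corner_side_tgt ca') => hom.
have two x y a1 a2 (c1 c2 : corner 2) i1 i2 : walk x [:: a1; a2] y ->
    corner_side c c1 i1 a1 -> corner_side c c2 i2 a2 ->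
    path_homotopic x y (walk_path x [:: a1; a2])
      (chi K c \o path_cat (corner_edge c1 i1) (corner_edge c2 i2)).
  move=> /= [<- [a12 <-]] ca1 ca2.
  have pa1 := edge_map_path KC a1; have pa2 := edge_map_path KC a2; rewrite a12 in pa2.
  apply: (@path_homotopic_trans _ _ _ _ _ (path_cat (edge_map a1) (edge_map a2))).
    by apply: path_homotopic_cat; [exact: path_homotopic_refl pa1|exact: path_catp1].
  apply: path_homotopic_eq; first exact: is_path_cat pa1 pa2.
  move=> t /inI t01; rewrite /= /path_cat.
  by case: leP => ?; rewrite (ca1, ca2)//; lra.
apply: path_homotopic_trans (two _ _ _ _ _ _ _ _ w1 ca cb') _.
exact: path_homotopic_trans hom (path_homotopic_sym (two _ _ _ _ _ _ _ _ w2 cb ca')).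
Qed.

(** The two ways around a rectangle tiled by squares. *)
Lemma rectangle_walk_eq (v : nat -> nat -> T) (a b : nat -> nat -> oedge K) :
  (forall s t, walk_eq (v s t) (v s.+1 t.+1) [:: a s t; b s.+1 t] [:: b s t; a s t.+1]) ->
  (forall s t, walk (v s t) [:: a s t] (v s.+1 t)) ->
  (forall s t, walk (v s t) [:: b s t] (v s t.+1)) ->
  forall m n, walk_eq (v 0 0) (v m n)
    (mkseq (a^~ 0) m ++ mkseq (b m) n) (mkseq (b 0) n ++ mkseq (a^~ n) m).
Proof.
move=> sq wa wb.
have mkS (f : nat -> oedge K) n : mkseq f n.+1 = mkseq f n ++ [:: f n].
  by rewrite mkseqS cats1.
have wA t m : walk (v 0 t) (mkseq (a^~ t) m) (v m t).
  elim: m => [//|m IH]; rewrite mkS; apply/walk_cat; exists (v m t); split=> //.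
have wB s n : walk (v s 0) (mkseq (b s) n) (v s n).
  elim: n => [//|n IH]; rewrite mkS; apply/walk_cat; exists (v s n); split=> //.
have row m t : walk_eq (v 0 t) (v m t.+1)
    (mkseq (a^~ t) m ++ [:: b m t]) ([:: b 0 t] ++ mkseq (a^~ t.+1) m).
  elim: m => [|m IH]; first exact: walk_eq_refl.
  rewrite !mkS -catA.
  apply: walk_eq_trans (walk_eq_cat (walk_eq_refl (wA t m)) (sq m t)) _.
  rewrite -[[:: b m t; _]]/([:: b m t] ++ [:: a m t.+1]) !catA.
  by apply: walk_eq_cat IH (walk_eq_refl _).
move=> m; elim=> [|n IH]; first by rewrite cats0; exact: walk_eq_refl.
rewrite !mkS catA -[X in walk_eq _ _ _ X]catA.
apply: walk_eq_trans (walk_eq_cat IH (walk_eq_refl (wb m n))) _.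
by rewrite -catA; apply: walk_eq_cat (walk_eq_refl (wB 0 n)) (row m n).
Qed.

End WalkHomotopy.

(** * Classes of closed edge paths in the fundamental group *)

Section LoopClass.
Context {R : realType} {X : topologicalType} {K : cubulation R X}.
Hypothesis KC : is_cube_complex K.
Context (x0 x : X) (d : R -> X).
Hypothesis pd : is_path x0 x d.

(** The path [w] at [x], moved to [x0] along [d]. *)
Definition based_path (w : seq (oedge K)) : R -> X :=
  path_cat d (path_cat (walk_path x w) (path_rev d)).

Lemma based_path_path w : walk x w x -> is_path x0 x0 (based_path w).
Proof.
move=> wx; apply: is_path_cat pd (is_path_cat (walk_is_path KC wx) _).
exact: is_path_rev.
Qed.

(** The class of the closed edge path [w] at [x], moved to the base point [x0]
    along [d]; it is trivial when [w] is not closed. *)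
Definition loop_class (w : seq (oedge K)) : pi1 R x0 :=
  if pselect (walk x w x) is left wx then (\pi_(pi1 R x0) (Loop (based_path_path wx)))%qT
  else 1%g.

Lemma loop_classE w (wx : walk x w x) :
  loop_class w = (\pi_(pi1 R x0) (Loop (based_path_path wx)))%qT.
Proof. by rewrite /loop_class; case: pselect => // wx'; rewrite (Prop_irrelevance wx wx'). Qed.

Lemma loop_class_eq w w' : walk_eq x x w w' -> loop_class w = loop_class w'.
Proof.
move=> [wx wx' ww']; rewrite (loop_classE wx) (loop_classE wx').
apply/pi1P; apply: path_homotopic_cat; first exact: path_homotopic_refl pd.
by apply: path_homotopic_cat ww' _; apply: path_homotopic_refl; exact: is_path_rev pd.
Qed.

Lemma loop_class_nil : loop_class [::] = 1%g.
Proof.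
have wx : walk x ([::] : seq (oedge K)) x by []; rewrite (loop_classE wx).
apply/(pi1P _ (loop_cst x0)); apply: path_homotopic_trans (path_catpV pd).
apply: path_homotopic_cat; first exact: path_homotopic_refl pd.
by apply: path_cat1p; exact: is_path_rev pd.
Qed.

Lemma loop_class_cat w w' : walk x w x -> walk x w' x ->
  loop_class (w ++ w') = (loop_class w * loop_class w')%g.
Proof.
move=> wx wx'; have wwx : walk x (w ++ w') x by apply/walk_cat; exists x.
rewrite (loop_classE wx) (loop_classE wx') (loop_classE wwx).
rewrite -[RHS]/(pi1_mul _ _) pi1_mulE; apply/pi1P => /=.
have pr := is_path_rev pd; have rr := path_homotopic_refl pr.
have pw := walk_is_path KC wx; have pw' := walk_is_path KC wx'.
have pwr := is_path_cat pw pr; have pw'r := is_path_cat pw' pr.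
have rd := path_homotopic_refl pd; have rw := path_homotopic_refl pw.
apply: path_homotopic_trans (path_catA pd pwr (is_path_cat pd pw'r)).
apply: path_homotopic_cat rd _.
apply: path_homotopic_trans (path_catA pw pr (is_path_cat pd pw'r)).
apply: path_homotopic_trans (path_homotopic_cat (walk_path_cat KC wx wx') rr) _.
apply: path_homotopic_trans (path_homotopic_sym (path_catA pw pw' pr)) _.
apply: path_homotopic_cat rw _; apply: path_homotopic_sym.
apply: path_homotopic_trans (path_catA pr pd pw'r) _.
apply: path_homotopic_trans (path_homotopic_cat (path_catVp pd) (path_homotopic_refl pw'r)) _.
exact: path_cat1p.
Qed.

Lemma loop_class_rev w : walk x w x -> loop_class (rev_walk w) = (loop_class w)^-1%g.
Proof.
move=> wx; apply: esym; apply: mulg1_eq; rewrite -loop_class_cat//; last exact: walk_rev.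
by rewrite (loop_class_eq (walk_eq_rev KC wx)) loop_class_nil.
Qed.

Lemma loop_class1 w : walk x w x -> loop_class w = 1%g -> path_homotopic x0 x0 (based_path w) (cst x0).
Proof. by move=> wx; rewrite (loop_classE wx) => /(pi1P _ (loop_cst x0)). Qed.

Lemma loop_class_pow (M : nat -> oedge K) l m : walk x (mkseq M l) x -> (forall k, M (k + l)%N = M k) ->
  walk x (mkseq M (m * l)) x /\ loop_class (mkseq M (m * l)) = (loop_class (mkseq M l) ^+ m)%g.
Proof.
move=> wl per; elim: m => [|m [IHw IH]]; first by rewrite mul0n expg0 loop_class_nil.
have -> : mkseq M (m.+1 * l) = mkseq M l ++ mkseq M (m * l).
  rewrite mulSn /mkseq iotaD map_cat; congr (_ ++ _).
  rewrite add0n -[l in iota l]addn0 iotaDl -map_comp; apply: eq_map => k /=.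
  by rewrite addnC per.
split; first by apply/walk_cat; exists x.
by rewrite loop_class_cat// IH expgS.
Qed.

End LoopClass.

(** Integer powers. *)
Definition zpow (G : groupType) (g : G) (z : int) : G :=
  match z with Posz m => (g ^+ m)%g | Negz m => ((g ^+ m.+1)^-1)%g end.

Section Zpow.
Context {G : groupType}.
Implicit Types g h : G.

Lemma zpowS g (z : int) : zpow g (z + 1) = (zpow g z * g)%g.
Proof.
case: z => [m|m]; first by rewrite -PoszD addn1 /= expgSr.
rewrite NegzE; case: m => [|m].
  by rewrite (_ : - 1%:Z + 1 = 0) //= expg1 mulVg.
rewrite (_ : - m.+2%:Z + 1 = Negz m); last by rewrite NegzE; lia.
by rewrite -NegzE /= [in RHS]expgS invgM mulgVK.
Qed.

Lemma zpowD g (a b : int) : zpow g (a + b) = (zpow g a * zpow g b)%g.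
Proof.
elim/int_ind: b => [|m IH|m IH].
- by rewrite addr0 /= mulg1.
- by rewrite -addn1 PoszD addrA !zpowS IH mulgA.
- apply: (@mulIg _ g); rewrite -zpowS -mulgA -zpowS.
  have -> : a + - m.+1%:Z + 1 = a - m%:Z by lia.
  by have -> : - m.+1%:Z + 1 = - m%:Z by lia.
Qed.

Lemma commute_zpow g h (a b : int) : commute g h -> commute (zpow g a) (zpow h b).
Proof.
move=> gh; have H x y (c : int) : commute x y -> commute x (zpow y c).
  by move=> xy; case: c => m; [exact: commuteX|apply: commuteV; exact: commuteX].
by apply: (H); apply: commute_sym; apply: (H); exact: commute_sym.
Qed.

(** Pairwise commuting elements define a homomorphism on families of exponents. *)
Lemma prod_zpowD (I : eqType) (s : seq I) (g : I -> G) (a b : I -> int) :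
  (forall i j, commute (g i) (g j)) ->
  (\prod_(i <- s) zpow (g i) (a i + b i))%g =
  ((\prod_(i <- s) zpow (g i) (a i)) * (\prod_(i <- s) zpow (g i) (b i)))%g.
Proof.
move=> cg; elim: s => [|i s IH]; first by rewrite !big_nil mulg1.
rewrite !big_cons zpowD IH !mulgA; congr (_ * _)%g; rewrite -!mulgA; congr (_ * _)%g.
elim: s {IH} => [|j s IH]; first by rewrite big_nil mulg1 mul1g.
rewrite big_cons mulgA (commute_zpow (b i) (a j) (cg i j)) -!mulgA; congr (_ * _)%g.
exact: IH.
Qed.

End Zpow.

(** * The standard cubulation of Euclidean space *)

Section Standard.
Context {R : realType} {n : nat}.
Local Notation S := (std_cubulation R n).
Local Notation unit_vec := (delta_mx 0 : 'I_n -> 'rV[int]_n).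

(** The vertices of the standard cubulation. *)
Definition lattice_pt (v : 'rV[int]_n) : 'rV[R]_n := \row_j (v 0 j)%:~R.

Lemma increasing0 (d : {ffun 'I_0 -> 'I_n}) :
  [forall i : 'I_0, forall j : 'I_0, (i < j)%N ==> (d i < d j)%N].
Proof. by apply/forallP => -[]. Qed.

Lemma lattice_pt_vertex v : is_vertex S (lattice_pt v).
Proof.
pose d : {ffun 'I_0 -> 'I_n} := [ffun l : 'I_0 => match notF (ltn_ord l) with end].
exists (v, exist _ d (increasing0 d)); apply/rowP => j.
by rewrite !mxE big_mkcond big_ord0 addr0.
Qed.

Lemma increasing1 (i : 'I_n) :
  [forall k : 'I_1, forall j : 'I_1, (k < j)%N ==>
    (([ffun=> i] : {ffun 'I_1 -> 'I_n}) k < ([ffun=> i] : {ffun 'I_1 -> 'I_n}) j)%N].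
Proof. by apply/forallP => k; apply/forallP => j; rewrite (ord1 k) (ord1 j). Qed.

(** The edge from [v] to [v + unit_vec i]. *)
Definition std_edge (v : 'rV[int]_n) (i : 'I_n) : oedge S :=
  ((v, exist _ [ffun=> i] (increasing1 i)), true).

Lemma std_edge_map v i t : edge_map (std_edge v i) t =
  \row_j ((v 0 j)%:~R + (if i == j then t else 0)).
Proof.
apply/rowP => j; rewrite !mxE /=; congr (_ + _).
by rewrite big_mkcond big_ord1 ffunE mxE.
Qed.

Lemma src_std_edge v i : src (std_edge v i) = lattice_pt v.
Proof. by rewrite /src std_edge_map; apply/rowP => j; rewrite !mxE; case: eqP; rewrite addr0. Qed.

Lemma tgt_std_edge v i : tgt (std_edge v i) = lattice_pt (v + unit_vec i).
Proof.
rewrite /tgt std_edge_map; apply/rowP => j; rewrite !mxE eqxx /= eq_sym intrD.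
by case: eqP.
Qed.

Definition two_directions (i j : 'I_n) : {ffun 'I_2 -> 'I_n} :=
  [ffun k => if k == 0 then i else j].

Lemma increasing2 (i j : 'I_n) : (i < j)%N ->
  [forall k : 'I_2, forall l : 'I_2,
    (k < l)%N ==> (two_directions i j k < two_directions i j l)%N].
Proof.
move=> ij; apply/forallP => k; apply/forallP => l; apply/implyP => kl; rewrite !ffunE.
have -> : k == 0 by apply/eqP/val_inj => /=; have := ltn_ord l; lia.
by case: (eqVneq l 0) kl => // ->.
Qed.

Lemma std_square_lt v (i j : 'I_n) : (i < j)%N -> exists (c : cell S 2) e,
  [/\ corner_side c e 0 (std_edge v i), corner_side c e 1 (std_edge v j),
      corner_side c (flip 1 e) 0 (std_edge (v + unit_vec j) i) &
      corner_side c (flip 0 e) 1 (std_edge (v + unit_vec i) j)].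
Proof.
move=> ij; pose c : cell S 2 := (v, exist _ (two_directions i j) (increasing2 ij)).
have chiE (x : 'rV[R]_2) l : chi S c x 0 l = (v 0 l)%:~R + ((if i == l then x 0 0 else 0) + (if j == l then x 0 1 else 0)).
  rewrite mxE /= big_mkcond big_ord_recl big_ord1 /= !ffunE /=.
  by congr (_ + (_ + _)); rewrite (_ : lift ord0 ord0 = 1)//; exact: val_inj.
exists c, [ffun=> false]; split=> t t01; rewrite std_edge_map; apply/rowP => l;
  rewrite chiE !mxE !ffunE ?eqxx /= ?intrD ?[l == _]eq_sym;
  by case: (i == l); case: (j == l) => /=; lra.
Qed.

Lemma std_square v (i j : 'I_n) : i != j -> exists (c : cell S 2) e k l,
  [/\ k != l, corner_side c e k (std_edge v i), corner_side c e l (std_edge v j) &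
    corner_side c (flip l e) k (std_edge (v + unit_vec j) i) /\
    corner_side c (flip k e) l (std_edge (v + unit_vec i) j)].
Proof.
move=> ij; have [lt|gt|/val_inj/eqP] := ltngtP i j; last by rewrite (negbTE ij).
  by have [c [e [c1 c2 c3 c4]]] := std_square_lt v lt; exists c, e, 0, 1.
by have [c [e [c1 c2 c3 c4]]] := std_square_lt v gt; exists c, e, 1, 0.
Qed.

Lemma std_edge_dist (a : oedge S) i : tgt a 0 i - src a 0 i <= 1.
Proof.
case: a => c o; rewrite /tgt /src /edge_map /= !mxE opprD addrACA subrr add0r.
rewrite !(big_mkcond (fun l => sval c.2 l == i)) !big_ord1 !mxE /=.
by case: (sval c.2 0 == i); case: o => /=; lra.
Qed.

Lemma std_walk_dist k x y i : edge_walk S k x y -> y 0 i - x 0 i <= k%:R.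
Proof.
elim: k x => [|k IH] x /=; first by move=> ->; rewrite subrr.
move=> [a <- /IH]; have := std_edge_dist a i; rewrite -natr1; lra.
Qed.

Lemma std_line_walk v i k : edge_walk S k (lattice_pt v) (lattice_pt (v + unit_vec i *+ k)).
Proof.
elim: k v => [|k IH] v; first by rewrite mulr0n addr0.
exists (std_edge v i); first exact: src_std_edge.
by rewrite tgt_std_edge mulrS addrA; exact: IH.
Qed.

Lemma std_line_dist v i k : graph_dist S (lattice_pt v) (lattice_pt (v + unit_vec i *+ k)) k.
Proof.
split; first exact: std_line_walk.
move=> l wl; have := std_walk_dist i wl; rewrite !mxE intrD addrAC subrr add0r mulmxnE mxE !eqxx.
by rewrite /= rmorphMn /= rmorph1 ler_nat.
Qed.

Lemma walk_edge_walk (T : topologicalType) (K : cubulation R T) x (w : seq (oedge K)) y :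
  walk x w y -> edge_walk K (size w) x y.
Proof.
by elim: w x => [|a w IH] x //= [ax wy]; exists a => //; exact: IH.
Qed.

End Standard.

(** * The image of a combinatorial flat *)

Section Flat.
Context {R : realType} {X Y : topologicalType}.
Context {K : cubulation R X} {L : cubulation R Y} {p : Y -> X}.
Context {n : nat} {f : 'rV[R]_n -> Y}.
Hypothesis KS : special_cube_complex K.
Hypothesis LK : universal_cover L K p.
Hypothesis fC : combinatorial (std_cubulation R n) L f.
Hypothesis fD : forall x y, is_vertex (std_cubulation R n) x ->
  is_vertex (std_cubulation R n) y -> forall k,
  graph_dist (std_cubulation R n) x y k <-> graph_dist L (f x) (f y) k.

Let KC := special_is_cube_complex KS.
Let LC := universal_cover_complex LK.
Let pcov := universal_cover_covering LK.
Let pC := universal_cover_combinatorial LK.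
Local Notation pe := (edge_image pC).
Local Notation unit_vec := (delta_mx 0 : 'I_n -> 'rV[int]_n).

Implicit Types (u v : 'rV[int]_n) (i j : 'I_n).

(** The vertices and edges of the flat, and their images in the base. *)
Definition flat_vertex (v : 'rV[int]_n) : Y := f (lattice_pt v).
Definition flat_edge (v : 'rV[int]_n) (i : 'I_n) : oedge L := edge_image fC (std_edge v i).
Definition image_vertex (v : 'rV[int]_n) : X := p (flat_vertex v).
Definition image_edge (v : 'rV[int]_n) (i : 'I_n) : oedge K := pe (flat_edge v i).

Lemma src_flat_edge v i : src (flat_edge v i) = flat_vertex v.
Proof. by rewrite /flat_edge src_edge_image src_std_edge. Qed.

Lemma tgt_flat_edge v i : tgt (flat_edge v i) = flat_vertex (v + unit_vec i).
Proof. by rewrite /flat_edge tgt_edge_image tgt_std_edge. Qed.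

Lemma src_image_edge v i : src (image_edge v i) = image_vertex v.
Proof. by rewrite /image_edge src_edge_image src_flat_edge. Qed.

Lemma tgt_image_edge v i : tgt (image_edge v i) = image_vertex (v + unit_vec i).
Proof. by rewrite /image_edge tgt_edge_image tgt_flat_edge. Qed.

Lemma image_square v i j : i != j -> exists (c : cell K 2) e k l,
  [/\ k != l, corner_side c e k (image_edge v i), corner_side c e l (image_edge v j) &
    corner_side c (flip l e) k (image_edge (v + unit_vec j) i) /\
    corner_side c (flip k e) l (image_edge (v + unit_vec i) j)].
Proof.
move=> /(@std_square R n v i j)[c [e [k [l [kl c1 c2 [c3 c4]]]]]].
have [d [s [r H]]] := combinatorial_side fC c; have [d' [s' [r' H']]] := combinatorial_side pC d.
have {}H e1 k1 a ca := H' _ _ _ (H e1 k1 a ca).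
exists d', (symmetry_corner s' r' (symmetry_corner s r e)), (s' (s k)), (s' (s l)).
rewrite !(inj_eq perm_inj) -!symmetry_corner_flip.
by split=> //; [exact: H|exact: H|split; exact: H].
Qed.

Lemma image_edge_crossing v i j : i != j -> crossing (image_edge v i) (image_edge v j).
Proof.
move=> /(image_square v)[c [e [k [l [kl ci cj _]]]]].
by apply: (span_square_crossing KS); exists c, e, k, l.
Qed.

Lemma image_edge_parallel v i j : i != j ->
  same_side (image_edge v i) (image_edge (v + unit_vec j) i).
Proof.
move=> /(image_square v)[c [e [k [l [kl ci _ [ci' _]]]]]].
by apply: rst_step; exact: (opposite_sides_parallel KC kl ci ci').
Qed.

(** The oriented hyperplane dual to an edge of the flat depends only on the
    direction of the edge and on the coordinate of its origin in this direction. *)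
Lemma image_edge_same_side v v' i : v 0 i = v' 0 i ->
  same_side (image_edge v i) (image_edge v' i).
Proof.
move=> vv.
have step u j (z : int) : i != j -> same_side (image_edge u i) (image_edge (u + z *: unit_vec j) i).
  move=> ij; elim/int_ind: z => [|m IH|m IH].
  - by rewrite scale0r addr0; exact: same_side_refl.
  - have -> : m.+1%:Z = m%:Z + 1 by lia.
    rewrite scalerDl scale1r addrA.
    exact: same_side_trans IH (image_edge_parallel _ ij).
  - apply: same_side_trans IH _; apply: same_side_sym.
    have -> : u + - m%:Z *: unit_vec j = u + - m.+1%:Z *: unit_vec j + unit_vec j.
      rewrite -addrA; congr (_ + _); rewrite -[X in _ + X]scale1r -scalerDl.
      by congr (_ *: _); lia.
    exact: image_edge_parallel.
have path u (z : 'I_n -> int) (s : seq 'I_n) : z i = 0 ->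
    same_side (image_edge u i) (image_edge (u + \sum_(j <- s) z j *: unit_vec j) i).
  move=> zi; elim: s u => [|j s IH] u; first by rewrite big_nil addr0; exact: same_side_refl.
  rewrite big_cons addrA; apply: same_side_trans (IH _).
  have [<-|ij] := eqVneq i j; last exact: step.
  by rewrite zi scale0r addr0; exact: same_side_refl.
have -> : v' = v + \sum_j (v' - v) 0 j *: unit_vec j by rewrite -row_sum_delta addrC subrK.
by apply: path; rewrite !mxE vv subrr.
Qed.

Lemma image_edge_crossing2 v v' i j : i != j -> crossing (image_edge v i) (image_edge v' j).
Proof.
move=> ij; pose u : 'rV[int]_n := \row_k (if k == i then v 0 i else v' 0 k).
apply: crossing_hyperplane (image_edge_crossing u ij); apply/same_side_hyperplane/image_edge_same_side.
  by rewrite mxE eqxx.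
by rewrite mxE eq_sym (negbTE ij).
Qed.

(** The image of the flat is deterministic: an edge is determined by the image of
    its origin and by its oriented hyperplane. *)
Lemma image_edge_eq v v' i : image_vertex v = image_vertex v' -> v 0 i = v' 0 i ->
  image_edge v i = image_edge v' i.
Proof.
move=> vv vi; apply: (same_side_src_inj KS); first by rewrite !src_image_edge.
exact: image_edge_same_side.
Qed.

(** Starting from two vertices with the same image, the same moves lead to vertices
    with the same image. *)
Lemma image_vertex_step v v' i (m : nat) : image_vertex v = image_vertex v' -> v 0 i = v' 0 i ->
  image_vertex (v + unit_vec i *+ m) = image_vertex (v' + unit_vec i *+ m).
Proof.
elim: m v v' => [|m IH] v v' vv vi; first by rewrite !mulr0n !addr0.
rewrite mulrS !addrA; apply: IH; last by rewrite !mxE vi.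
by rewrite -!tgt_image_edge (image_edge_eq vv vi).
Qed.

Lemma image_vertex_shift v v' (z : 'I_n -> nat) (s : seq 'I_n) : image_vertex v = image_vertex v' ->
  (forall i, z i != 0%N -> v 0 i = v' 0 i) ->
  image_vertex (v + \sum_(i <- s) unit_vec i *+ z i) = image_vertex (v' + \sum_(i <- s) unit_vec i *+ z i).
Proof.
elim: s v v' => [|i s IH] v v' vv vz; first by rewrite !big_nil !addr0.
rewrite !big_cons !addrA; apply: IH => [|j /vz vj]; last by rewrite !mxE vj.
have [->|/vz zi] := eqVneq (z i) 0%N; first by rewrite !mulr0n !addr0.
exact: image_vertex_step.
Qed.

(** The edges of a coordinate axis of the flat. *)
Definition axis_edge (i : 'I_n) (m : nat) : oedge K := image_edge (unit_vec i *+ m) i.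

Lemma flat_line_walk v i k : walk (flat_vertex v) (mkseq (fun m => flat_edge (v + unit_vec i *+ m) i) k)
  (flat_vertex (v + unit_vec i *+ k)).
Proof.
elim: k => [|k IH]; first by rewrite mulr0n addr0.
rewrite mkseqS -cats1; apply/walk_cat; exists (flat_vertex (v + unit_vec i *+ k)).
by split=> //=; rewrite src_flat_edge tgt_flat_edge mulrSr addrA.
Qed.

(** An axis of the flat is a geodesic, which cannot be shortened. *)
Lemma axis_reduced i : reduced_seq (axis_edge i).
Proof.
move=> a b ab ss Hc.
have [k bE] : exists k, b = (a + k.+1)%N by exists (b - a).-1; lia.
pose v := unit_vec i *+ a.
have wk := flat_line_walk v i k.+2.
pose F m := flat_edge (v + unit_vec i *+ m) i.
have FE m : pe (F m) = axis_edge i (a + m) by rewrite /F /v -mulrnDr.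
have E : mkseq F k.+2 = F 0%N :: mkseq (fun m => F m.+1) k ++ [:: F k.+1].
  rewrite mkseqS -cats1 /mkseq /=; congr (_ :: _ ++ _).
  by rewrite -[1%N]addn0 iotaDl -map_comp.
rewrite -/F E in wk.
have [||w ww sw] := shorten_walk KS (LK := LK) wk.
- by rewrite !FE addn0 -bE.
- apply/List.Forall_map/Forall_split => u1 m u2 mE.
  have mk : (m < k)%N.
    have : m \in iota 0 k by rewrite mE mem_cat inE eqxx orbT.
    by rewrite mem_iota.
  by rewrite !FE addn0; apply: Hc; lia.
rewrite size_mkseq in sw.
have := (fD (lattice_pt_vertex v) (lattice_pt_vertex (v + unit_vec i *+ k.+2)) k.+2).1 (std_line_dist v i k.+2).
by move=> [_ /(_ _ (walk_edge_walk ww))]; rewrite sw; lia.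
Qed.

Section Periods.
Variables a b : 'I_n -> nat.
Hypothesis ab : forall i, (a i < b i)%N.
Hypothesis axis_ab : forall i, axis_edge i (a i) = axis_edge i (b i).
Hypothesis axis_periodic : forall i,
  reduced_seq (fun k => axis_edge i (a i + k %% (b i - a i))%N).

Let l i := (b i - a i)%N.

(** A vertex of the flat at which all directions are periodic. *)
Definition base_vertex : 'rV[int]_n := \sum_i unit_vec i *+ a i.

Local Notation x := (image_vertex base_vertex).

Lemma base_vertexE i : base_vertex 0 i = a i.
Proof.
rewrite summxE (bigD1 i)//= big1 ?addr0 => [|j ji]; rewrite mulmxnE mxE ?eqxx/= ?natz//.
by rewrite eq_sym (negbTE ji) mul0rn.
Qed.

Lemma unit_vecE i j m : (unit_vec i *+ m) 0 j = if i == j then m%:Z else 0.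
Proof. by rewrite mulmxnE mxE eqxx eq_sym /=; case: eqP => _; rewrite ?natz ?mul0rn. Qed.

(** The period found along an axis is also a period along the parallel line through the
    base vertex. *)
Lemma image_vertex_period i : image_vertex (base_vertex + unit_vec i *+ l i) = x.
Proof.
pose z j := if j == i then 0%N else a j.
have zE : \sum_j unit_vec j *+ z j = \sum_(j | j != i) unit_vec j *+ a j.
  rewrite (bigD1 i)//= /z eqxx mulr0n add0r; apply: eq_bigr => j.
  by case: eqP.
have -> : base_vertex + unit_vec i *+ l i = unit_vec i *+ b i + \sum_j unit_vec j *+ z j.
  rewrite /base_vertex (bigD1 i)//= addrAC zE -mulrnDr; congr (_ *+ _ + _).
  by rewrite /l subnKC// ltnW.
have -> : base_vertex = unit_vec i *+ a i + \sum_j unit_vec j *+ z j.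
  by rewrite /base_vertex (bigD1 i)//= zE.
apply/esym/image_vertex_shift; first by rewrite -!(src_image_edge _ i); congr src; exact: axis_ab.
move=> j; rewrite /z; case: (eqVneq j i) => [->//|ji] _.
by rewrite !unit_vecE eq_sym (negbTE ji).
Qed.

(** The letter at the position [k] of the closed path in the direction [i], repeated
    periodically. *)
Definition period_edge i (k : nat) : oedge K :=
  image_edge (base_vertex + unit_vec i *+ (k %% l i)) i.

(** One period of the closed path in the direction [i]. *)
Definition period i := mkseq (period_edge i) (l i).

Lemma l_gt0 i : (0 < l i)%N. Proof. by rewrite subn_gt0. Qed.

Lemma periodE i : period i = mkseq (fun k => image_edge (base_vertex + unit_vec i *+ k) i) (l i).
Proof.
by apply/eq_in_map => k; rewrite mem_iota => kl; rewrite /period_edge modn_small.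
Qed.

Lemma period_edge_per i k : period_edge i (k + l i) = period_edge i k.
Proof. by rewrite /period_edge modnDr. Qed.

Lemma image_line_walk v i k : walk (image_vertex v)
  (mkseq (fun m => image_edge (v + unit_vec i *+ m) i) k) (image_vertex (v + unit_vec i *+ k)).
Proof. by have := walk_image pC (flat_line_walk v i k); rewrite /mkseq -map_comp. Qed.

Lemma period_closed i : walk x (period i) x.
Proof. by rewrite periodE -{2}(image_vertex_period i); exact: image_line_walk. Qed.

Lemma period_reduced i : reduced_seq (period_edge i).
Proof.
have ss k : same_side (period_edge i k) (axis_edge i (a i + k %% l i)%N).
  by apply: image_edge_same_side; rewrite mxE base_vertexE !unit_vecE eqxx PoszD.
move=> c d cd cdr H; apply: (axis_periodic cd).
  apply: same_side_trans (same_side_trans cdr (ss d)).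
  exact/same_side_rev/same_side_sym.
by move=> k kc kd; apply: crossing_hyperplane (H _ kc kd); exact: same_side_hyperplane.
Qed.

Lemma period_crossing i j c d : i != j -> crossing (period_edge i c) (period_edge j d).
Proof. exact: image_edge_crossing2. Qed.

(** The rectangle spanned by two periods is tiled by squares, and its opposite sides
    have the same image. *)
Lemma period_commute i j : walk_eq x x (period i ++ period j) (period j ++ period i).
Proof.
have [->|ij] := eqVneq i j.
  by apply: (walk_eq_refl KC); apply/walk_cat; exists x; split; exact: period_closed.
pose v s t := base_vertex + unit_vec i *+ s + unit_vec j *+ t.
have vi s t : v s.+1 t = v s t + unit_vec i by rewrite /v mulrSr (addrA base_vertex) [LHS]addrAC.
have vj s t : v s t.+1 = v s t + unit_vec j by rewrite /v mulrSr [LHS]addrA.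
have := @rectangle_walk_eq R X K KC (fun s t => image_vertex (v s t))
  (fun s t => image_edge (v s t) i) (fun s t => image_edge (v s t) j) _ _ _ (l i) (l j).
have vij : image_vertex (v (l i) (l j)) = x.
  rewrite -[RHS](image_vertex_period j); apply: image_vertex_step; first exact: image_vertex_period.
  by rewrite mxE unit_vecE (negbTE ij) addr0.
have E1 : mkseq (fun s => image_edge (v s 0%N) i) (l i) = period i.
  by rewrite periodE; apply: eq_mkseq => k; rewrite /v mulr0n addr0.
have E2 : mkseq (fun t => image_edge (v 0%N t) j) (l j) = period j.
  by rewrite periodE; apply: eq_mkseq => k; rewrite /v mulr0n addr0.
have E3 : mkseq (fun s => image_edge (v s (l j)) i) (l i) = period i.
  rewrite periodE; apply: eq_mkseq => k; apply: image_edge_eq.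
    rewrite /v addrAC; apply: image_vertex_step; first exact: image_vertex_period.
    by rewrite mxE unit_vecE eq_sym (negbTE ij) addr0.
  by rewrite /v mxE [X in _ + X]unit_vecE eq_sym (negbTE ij) addr0.
have E4 : mkseq (fun t => image_edge (v (l i) t) j) (l j) = period j.
  rewrite periodE; apply: eq_mkseq => k; apply: image_edge_eq.
    apply: image_vertex_step; first exact: image_vertex_period.
    by rewrite mxE unit_vecE (negbTE ij) addr0.
  by rewrite /v !mxE !unit_vecE (negbTE ij) eqxx addr0.
have v00 : image_vertex (v 0%N 0%N) = x by rewrite /v !mulr0n !addr0.
rewrite /= E1 E2 E3 E4 vij v00; apply.
- move=> s t; have [c [e [k [m [km c1 c2 [c3 c4]]]]]] := image_square (v s t) ij.
  have := square_walk_eq KC km c1 c2 c3 c4.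
  by rewrite src_image_edge tgt_image_edge -!vj -!vi.
- by move=> s t; rewrite vi; split; [exact: src_image_edge|exact: tgt_image_edge].
- by move=> s t; rewrite vj; split; [exact: src_image_edge|exact: tgt_image_edge].
Qed.

(** The closed path running [z] times along the period in the direction [i]. *)
Definition period_power i (z : int) : seq (oedge K) :=
  match z with
  | Posz m => mkseq (period_edge i) (m * l i)
  | Negz m => rev_walk (mkseq (period_edge i) (m.+1 * l i))
  end.

Lemma Forall_mkseq (A : Type) (P : A -> Prop) (g : nat -> A) m :
  (forall k, P (g k)) -> List.Forall P (mkseq g m).
Proof. by move=> Pg; apply/List.Forall_map/Forall_split => *; exact: Pg. Qed.

Lemma period_power_reduced i z : reduced (period_power i z).
Proof.
case: z => m /=; first exact: (reduced_mkseq (@period_reduced i)).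
exact: reduced_rev (reduced_mkseq (@period_reduced i)).
Qed.

Lemma period_power_letters (P : oedge K -> Prop) i z :
  (forall c k, hyperplane c.1 = hyperplane (period_edge i k).1 -> P c) ->
  List.Forall P (period_power i z).
Proof.
move=> HP; case: z => m /=; first by apply: Forall_mkseq => k; exact: (HP _ k).
apply: (Forall_rev_walk (P := fun c => exists k, hyperplane c.1 = hyperplane (period_edge i k).1)).
  by move=> c [k]; exact: (HP (rev_edge c) k).
by apply: Forall_mkseq => k; exists k.
Qed.

Lemma period_power_crossing i j z z' : i != j ->
  List.Forall (fun c => List.Forall (crossing c) (period_power j z')) (period_power i z).
Proof.
move=> ij; apply: period_power_letters => c k ck; apply: period_power_letters => d m dm.
exact: crossing_hyperplane (esym ck) (esym dm) (period_crossing k m ij).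
Qed.

Lemma size_period_power i z : period_power i z = [::] -> z = 0.
Proof.
case: z => m; rewrite /period_power /rev_walk => /(congr1 size).
  by rewrite size_mkseq => /eqP; rewrite muln_eq0 (gtn_eqF (l_gt0 i)) orbF => /eqP ->.
rewrite size_rev size_map size_mkseq => /eqP.
by rewrite muln_eq0 (gtn_eqF (l_gt0 i)).
Qed.

Section Representation.
Context {x0 : X} {d : R -> X}.
Hypothesis pd : is_path x0 x d.

(** The class of a period in the fundamental group. *)
Definition period_class i : pi1 R x0 := loop_class KC pd (period i).

Lemma period_power_class i z : walk x (period_power i z) x /\
  loop_class KC pd (period_power i z) = zpow (period_class i) z.
Proof.
have H m := loop_class_pow KC pd m (period_closed i) (period_edge_per i).
case: z => m /=; first exact: H.
have [wm cm] := H m.+1; split; first exact: walk_rev.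
by rewrite loop_class_rev// cm.
Qed.

Lemma period_powers_class (z : 'I_n -> int) (s : seq 'I_n) :
  let w := flatten [seq period_power i (z i) | i <- s] in walk x w x /\
  loop_class KC pd w = (\prod_(i <- s) zpow (period_class i) (z i))%g.
Proof.
elim: s => [|i s [IHw IH]] /=; first by rewrite big_nil loop_class_nil.
have [wi ci] := period_power_class i (z i).
split; first by apply/walk_cat; exists x.
by rewrite loop_class_cat// IH ci big_cons.
Qed.

Lemma period_class_commute i j : commute (period_class i) (period_class j).
Proof.
rewrite /commute -!loop_class_cat; try exact: period_closed.
exact: loop_class_eq (period_commute i j).
Qed.

(** The representation of the lattice defined by the classes of the periods. *)
Definition lattice_rep (u : 'rV[int]_n) : pi1 R x0 :=
  (\prod_i zpow (period_class i) (u 0 i))%g.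

Lemma lattice_rep_morph : {morph lattice_rep : u v / u + v >-> (u * v)%g}.
Proof.
move=> u v; rewrite /lattice_rep -prod_zpowD; last exact: period_class_commute.
by apply: eq_bigr => i _; rewrite mxE.
Qed.

(** The representation is faithful: if the class of a product of periods is trivial, then
    its lift is a closed path of the universal cover whose image is reduced, hence is
    the empty path. *)
Lemma lattice_rep_ker (y0 : Y) (e : R -> Y) u : is_path y0 (flat_vertex base_vertex) e ->
  p y0 = x0 -> (forall t, `[0, 1]%classic t -> p (e t) = d t) ->
  lattice_rep u = 1%g -> u = 0.
Proof.
move=> pe0 py0 ed u1; pose s := index_enum 'I_n.
have [wx wc] := period_powers_class (u 0) s; set w := flatten _ in wx wc.
have := loop_class1 wx (etrans wc u1) => hom.
have [v [z [wv vw pz]]] := lift_walk LC KC pcov pC (y := flat_vertex base_vertex) wx.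
have pv := walk_is_path LC wv.
have [r pr rd] := path_lift pcov (is_path_rev pd) pz.
have plift := is_path_cat pe0 (is_path_cat pv pr).
have end_r : r 1 = y0.
  apply: (homotopic_lift_end pcov hom plift (is_path_cst y0)) => t It.
    apply: (path_cat_rel (P := fun q q' => p q = q')) It => // {}t It.
    apply: (path_cat_rel (P := fun q q' => p q = q')) It => // {}t It.
    by rewrite (walk_path_image pC)// vw.
  exact: py0.
have zE : z = flat_vertex base_vertex.
  have [_ <- _] := pr; have [_ _ <-] := pe0.
  have := path_lift_unique pcov pe0 (is_path_rev pr) (t0 := 0) _ I0 _ I1.
  rewrite /path_rev subr0 subrr end_r => ->//; last by case: pe0.
  move=> t It; rewrite ed// rd; last by move: It => /inI It; apply/inI; lra.
  by rewrite /path_rev subKr.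
rewrite zE in wv.
have red : reduced w.
  apply: reduced_flatten; [exact: index_enum_uniq| |].
    by move=> i; exact: period_power_reduced.
  by move=> i j; exact: period_power_crossing.
have v0 : v = [::] by apply: (reduced_closed_nil KS (LK := LK) wv); rewrite vw.
have w0 : w = [::] by rewrite -vw v0.
apply/rowP => i; rewrite mxE; apply: (@size_period_power i).
have : i \in s by exact: mem_index_enum.
move: w0; rewrite /w; elim: s {w wx wc hom vw red} => [//|j s IH] /=.
move=> /(congr1 size)/eqP; rewrite size_cat addn_eq0 => /andP[/nilP j0 /nilP s0].
by rewrite inE => /orP[/eqP ->|/(IH s0)].
Qed.

End Representation.

End Periods.

End Flat.

(** * The subgroup of the fundamental group *)

Theorem theorem1p1 (R : realType) (X : topologicalType) (K : cubulation R X)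
    (Xt : topologicalType) (Kt : cubulation R Xt) (p : Xt -> X) (n : nat)
    (x0 : X) :
  special_cube_complex K -> compact [set: X] ->
  universal_cover Kt K p ->
  (1 <= n)%N ->
  (exists F : set Xt, combinatorial_flat Kt n F) ->
  exists f : 'rV[int]_n -> pi1 R x0,
    injective f /\ {morph f : u v / u + v >-> (u * v)%g}.
Proof.
move=> KS cX LK _ [_ [f [fC fD _]]].
have [N [code codeI]] := finite_edges (special_is_cube_complex KS) cX.
have ex i : exists ab : nat * nat, [/\ (ab.1 < ab.2)%N,
    axis_edge LK fC i ab.1 = axis_edge LK fC i ab.2 &
    reduced_seq (fun k => axis_edge LK fC i (ab.1 + k %% (ab.2 - ab.1))%N)].
  have [a [b [ab E red]]] := periodic_reduced KS codeI (@axis_reduced _ _ _ _ _ _ _ _ KS LK fC fD i).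
  by exists (a, b).
have [ab Hab] := choice ex.
have lt_ab i : ((ab i).1 < (ab i).2)%N by have [] := Hab i.
have axis_ab i : axis_edge LK fC i (ab i).1 = axis_edge LK fC i (ab i).2 by have [] := Hab i.
have red i : reduced_seq (fun k => axis_edge LK fC i ((ab i).1 + k %% ((ab i).2 - (ab i).1))%N).
  by have [] := Hab i.
pose a i := (ab i).1; pose b i := (ab i).2.
have [y0 _ py0] : (p @` [set: Xt]) x0.
  by have [_ -> _] := universal_cover_covering LK.
have [_ pconn _] := universal_cover_simply_connected LK.
have [e pe0] := pconn y0 (flat_vertex (f := f) (base_vertex a)).
have pd : is_path x0 (p (flat_vertex (f := f) (base_vertex a))) (p \o e).
  by rewrite -py0; apply: is_path_comp pe0; exact: covering_continuous (universal_cover_covering LK).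
have rep_morph := @lattice_rep_morph _ _ _ _ _ _ _ _ KS LK fC a b lt_ab axis_ab _ _ pd.
exists (lattice_rep KS LK fC b pd); split; last exact: rep_morph.
move=> u v uv; apply/eqP; rewrite -subr_eq0; apply/eqP.
apply: (lattice_rep_ker lt_ab axis_ab red (pd := pd) pe0 py0) => //.
apply: (@mulIg _ (lattice_rep KS LK fC b pd v)).
by rewrite mul1g -rep_morph subrK.
Qed.
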